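(* Let $s\in(0,1)$, let $u_0\in L^\infty(\mathbb{R}^d)$, and let $\Phi:\mathbb{R}\to\mathbb{R}$ be nondecreasing and locally Lipschitz. Then the problem $$u_t=-(-\Delta)^s\,\Phi(u)\ \text{ in }\mathbb{R}^d\times\mathbb{R}^+,\qquad u=u_0\ \text{ on }\mathbb{R}^d\times\{0\},$$ admits a very weak solution.
   Context: $\mathbb{R}^+=(0,\infty)$. The $s$-fractional Laplacian of a test function $\varphi\in C_c^\infty(\mathbb{R}^d)$ is $$(-\Delta)^s\varphi(x)=c_{d,s}\ \mathrm{p.v.}\int_{\mathbb{R}^d}\frac{\varphi(x)-\varphi(x')}{|x-x'|^{d+2s}}\,dx',\qquad c_{d,s}=\frac{2^{2s}s\,\Gamma(\frac d2+s)}{\pi^{d/2}\Gamma(1-s)};$$ for functions depending also on $t$ it acts in the variable $x$ only. Very weak solution: a measurable function $u$ is a very weak solution of the problem with datum $u_0$ if $u\in L^\infty(\mathbb{R}^d\times\mathbb{R}^+)$ and for a.e. $T>0$ $$\int_0^T\!\!\int_{\mathbb{R}^d}u\,\varphi_t\,dx\,dt=\int_0^T\!\!\int_{\mathbb{R}^d}\Phi(u)\,(-\Delta)^s\varphi\,dx\,dt+\int_{\mathbb{R}^d}u(x,T)\varphi(x,T)\,dx-\int_{\mathbb{R}^d}u_0(x)\varphi(x,0)\,dx$$ for every $\varphi\in C_c^\infty(\mathbb{R}^d\times[0,T])$. *)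

(* Defs.v *)
From HB Require Import structures.
From mathcomp Require Import all_boot all_order all_algebra.
From mathcomp Require Import all_classical all_reals all_analysis.

Set Implicit Arguments.
Unset Strict Implicit.
Unset Printing Implicit Defensive.
Import Order.TTheory GRing.Theory Num.Theory.
Import numFieldNormedType.Exports.
Local Open Scope classical_set_scope.
Local Open Scope ring_scope.

(* The measurable structure on ['rV_n] is the product sigma-algebra, generated
   by the coordinates (hence the Borel one when [T] is the real line), as for
   [n.-tuple T] in the library. *)
Definition rV_display : measure_display -> measure_display.
Proof. exact. Qed.

Section measurable_rV.
Context {d} {T : measurableType d} (n : nat).

Definition rV_coord (i : 'I_n) (x : 'rV[T]_n) : T := x ord0 i.

Let rV_set0 : g_sigma_preimage rV_coord set0.
Proof. exact: sigma_algebra0. Qed.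

Let rV_setC A : g_sigma_preimage rV_coord A -> g_sigma_preimage rV_coord (~` A).
Proof. exact: sigma_algebraC. Qed.

Let rV_bigcup (F : _^nat) : (forall i, g_sigma_preimage rV_coord (F i)) ->
  g_sigma_preimage rV_coord (\bigcup_i (F i)).
Proof. exact: sigma_algebra_bigcup. Qed.

HB.instance Definition _ := @isMeasurable.Build (rV_display d)
  'rV[T]_n (g_sigma_preimage rV_coord) rV_set0 rV_setC rV_bigcup.

End measurable_rV.

Lemma measurable_rV_coord d (T : measurableType d) n (i : 'I_n) :
  measurable_fun [set: 'rV[T]_n] (fun x : 'rV[T]_n => x ord0 i).
Proof.
move=> _ Y mY; rewrite setTI; apply: sub_sigma_algebra => /=.
rewrite -bigcup_seq/=; exists i => /=; first by rewrite mem_index_enum.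
by exists Y => //; rewrite setTI.
Qed.

Lemma measurable_fun_rVP d1 d2 (T1 : measurableType d1) (T2 : measurableType d2)
    n (f : T1 -> 'rV[T2]_n) :
  (forall i, measurable_fun [set: T1] (fun x => f x ord0 i)) ->
  measurable_fun [set: T1] f.
Proof.
move=> mf.
have H : g_sigma_preimage (fun i => rV_coord i \o f) `<=` measurable.
  apply: smallest_sub; first exact: sigma_algebra_measurable.
  case: n => [|n] in f mf *; first by rewrite big_ord0.
  rewrite -bigcup_mkord_ord; apply: bigcup_sub => i Ii.
  by move=> A [B mB <-]; exact: mf.
move: H; rewrite g_sigma_preimage_comp => prefS.
by move=> _ A mA; apply: prefS; exists A.
Qed.

Lemma product_sigma_finite d1 d2 (T1 : measurableType d1)
    (T2 : measurableType d2) (R : realType)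
    (m1 : {sigma_finite_measure set T1 -> \bar R})
    (m2 : {sigma_finite_measure set T2 -> \bar R}) :
  sigma_finite setT (m1 \x m2)%E.
Proof.
have /sigma_finiteP[F [TF ndF Foo]] := sigma_finiteT m1.
have /sigma_finiteP[G [TG ndG Goo]] := sigma_finiteT m2.
exists (fun n => F n `*` G n).
  rewrite -setXTT TF TG predeqE => -[x y]; split.
    move=> [/= [n _ Fnx] [k _ Gky]]; exists (maxn n k) => //; split.
    - by move: x Fnx; exact/subsetPset/ndF/leq_maxl.
    - by move: y Gky; exact/subsetPset/ndG/leq_maxr.
  by move=> [n _ []/= ? ?]; split; exists n.
move=> k; have [? ?] := Foo k; have [? ?] := Goo k.
split; first exact: measurableX.
by rewrite product_measure1E// lte_mul_pinfty// ge0_fin_numE.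
Qed.

Section lebesgue_rV.
Context {R : realType}.

Definition cons_rV n (p : R * 'rV[R]_n) : 'rV[R]_n.+1 :=
  \row_i oapp (fun j => p.2 ord0 j) p.1 (unlift ord0 i).

Definition uncons_rV n (x : 'rV[R]_n.+1) : R * 'rV[R]_n :=
  (x ord0 ord0, \row_j x ord0 (lift ord0 j)).

Lemma cons_rVK n : cancel (@cons_rV n) (@uncons_rV n).
Proof.
move=> [a y]; rewrite /uncons_rV /cons_rV mxE unlift_none /=; congr pair.
by apply/rowP => j; rewrite !mxE liftK.
Qed.

Lemma measurable_cons_rV n : measurable_fun setT (@cons_rV n).
Proof.
apply: measurable_fun_rVP => i.
case: (unliftP ord0 i) => [j|] ->.
  under eq_fun do rewrite mxE liftK /=.
  exact: (measurableT_comp (measurable_rV_coord j) measurable_snd).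
under eq_fun do rewrite mxE unlift_none /=.
exact: measurable_fst.
Qed.

Lemma measurable_uncons_rV n : measurable_fun setT (@uncons_rV n).
Proof.
apply/measurable_fun_pairP; split; first exact: measurable_rV_coord.
apply: measurable_fun_rVP => i /=.
under eq_fun do rewrite mxE.
exact: measurable_rV_coord.
Qed.

Section step.
Variables (n : nat) (m : {sigma_finite_measure set 'rV[R]_n -> \bar R}).

Definition lebesgue_cons : set 'rV[R]_n.+1 -> \bar R :=
  pushforward (lebesgue_measure \x m)%E (@cons_rV n).

Let mcons : measurable_fun setT (@cons_rV n) := @measurable_cons_rV n.

Let lebesgue_cons0 : lebesgue_cons set0 = 0%E.
Proof. by rewrite /lebesgue_cons /pushforward preimage_set0 measure0. Qed.

Let lebesgue_cons_ge0 A : (0 <= lebesgue_cons A)%E.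
Proof. exact: measure_ge0. Qed.

Let lebesgue_cons_sigma_additive : semi_sigma_additive lebesgue_cons.
Proof.
move=> F mF tF mUF; rewrite /lebesgue_cons /pushforward preimage_bigcup.
apply: measure_semi_sigma_additive.
- by move=> k; rewrite -[X in measurable X]setTI; exact: mcons.
- apply/trivIsetP => /= i j _ _ ij; rewrite -preimage_setI.
  by move/trivIsetP : tF => /(_ _ _ _ _ ij) ->//; rewrite preimage_set0.
- by rewrite -preimage_bigcup -[X in measurable X]setTI; exact: mcons.
Qed.

HB.instance Definition _ := isMeasure.Build _ _ _ lebesgue_cons
  lebesgue_cons0 lebesgue_cons_ge0 lebesgue_cons_sigma_additive.

Let lebesgue_cons_sigma_finite : sigma_finite setT lebesgue_cons.
Proof.
pose l : {sigma_finite_measure set _ -> \bar R} := @lebesgue_measure R.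
have [F FT Foo] := product_sigma_finite l m.
exists (fun k => @uncons_rV n @^-1` F k).
  by rewrite -preimage_bigcup -FT preimage_setT.
move=> k; have [mF Fk] := Foo k; split.
  by rewrite -[X in measurable X]setTI; exact: measurable_uncons_rV.
rewrite /lebesgue_cons /pushforward -comp_preimage.
rewrite (_ : _ \o _ = id) ?preimage_id//.
by apply/funext => x /=; rewrite cons_rVK.
Qed.

HB.instance Definition _ := Measure_isSigmaFinite.Build _ _ _ lebesgue_cons
  lebesgue_cons_sigma_finite.

End step.

Fixpoint lebesgue_rV (n : nat) : {sigma_finite_measure set 'rV[R]_n -> \bar R} :=
  match n with
  | 0 => \d_(0 : 'rV[R]_0)
  | n'.+1 => lebesgue_cons (lebesgue_rV n')
  end.

End lebesgue_rV.
Arguments lebesgue_rV : clear implicits.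

Lemma lebesgue_rV_box (R : realType) n (A : 'I_n -> set R) :
  (forall i, measurable (A i)) ->
  lebesgue_rV R n [set x | forall i, A i (x ord0 i)] =
  (\prod_(i < n) lebesgue_measure (A i))%E.
Proof.
elim: n A => [|n IHn] A mA.
  by rewrite big_ord0 /= diracE mem_set //= => -[].
pose B := [set x : 'rV[R]_n | forall i, A (lift ord0 i) (x ord0 i)].
have mB : measurable B.
  rewrite (_ : B = \bigcap_(i in [set: 'I_n])
      ((fun x : 'rV[R]_n => x ord0 i) @^-1` A (lift ord0 i))); last first.
    by apply/seteqP; split=> [x Bx i _|x Bx i]; [exact: Bx|exact: Bx].
  apply: fin_bigcap_measurable => // i _.
  by rewrite -[X in measurable X]setTI; exact: measurable_rV_coord.
rewrite big_ord_recl /= /lebesgue_cons /pushforward.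
rewrite (_ : _ @^-1` _ = A ord0 `*` B); last first.
  apply/seteqP; split=> [[a y] /= Aay|[a y] /= [Aa By] i].
    split=> [|i]; [have := Aay ord0|have := Aay (lift ord0 i)].
      by rewrite mxE unlift_none.
    by rewrite mxE liftK.
  by rewrite mxE; case: (unliftP ord0 i) => [j|] -> //=; exact: By.
pose l : {sigma_finite_measure set _ -> \bar R} := @lebesgue_measure R.
rewrite (product_measure1E l (lebesgue_rV R n) (mA ord0) mB).
by rewrite -(IHn (fun i => A (lift ord0 i))).
Qed.

Section problem.
Context {R : realType}.

Section smooth.
Context {V : normedModType R}.

Fixpoint Cn (k : nat) (f : V -> R) : Prop :=
  match k with
  | 0 => continuous f
  | k'.+1 => (forall x, differentiable f x) /\ forall v, Cn k' ('D_v f)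
  end.

Definition smooth (f : V -> R) := forall k, Cn k f.

End smooth.

Definition Gamma (z : R) : R :=
  \int[lebesgue_measure]_(t in `]0, +oo[) (t `^ (z - 1) * expR (- t)).

(* The library norm of ['rV_d] is the max norm. *)
Definition enorm d (x : 'rV[R]_d) : R := Num.sqrt (\sum_i x ord0 i ^+ 2).

Definition fracLap_const (d : nat) (s : R) : R :=
  2 `^ (2 * s) * s * Gamma (d%:R / 2 + s) / (pi `^ (d%:R / 2) * Gamma (1 - s)).

Definition fracLap d (s : R) (phi : 'rV[R]_d -> R) (x : 'rV[R]_d) : R :=
  fracLap_const d s *
  lim ((\int[lebesgue_rV R d]_(y in [set y | (eps < enorm (x - y))%R])
         ((phi x - phi y) / enorm (x - y) `^ (d%:R + 2 * s)))
       @[eps --> 0^'+]).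

(* Functions on the closed slab are represented by smooth functions on the
   whole space; only the support in the slab is required to be compact. *)
Definition slab_test d (T : R) (phi : 'rV[R]_d * R -> R) :=
  smooth phi /\
  compact (closure [set p : 'rV[R]_d * R | 0 <= p.2 <= T /\ phi p != 0]).

Definition locally_lipschitz (Phi : R -> R) :=
  forall x : R, exists2 U : set R, nbhs x U & [lipschitz Phi y | y in U].

Definition very_weak_solution d (s : R) (Phi : R -> R) (u0 : 'rV[R]_d -> R)
    (u : 'rV[R]_d * R -> R) :=
  u \_ (setT `*` `]0, +oo[) \in
    Lfun (lebesgue_rV R d \x lebesgue_measure)%E +oo%E /\
  {ae lebesgue_measure, forall T : R, 0 < T ->
    forall phi : 'rV[R]_d * R -> R, slab_test T phi ->
    \int[lebesgue_measure]_(t in `[0, T]) \int[lebesgue_rV R d]_x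
       (u (x, t) * derive1 (fun r => phi (x, r)) t) =
    \int[lebesgue_measure]_(t in `[0, T]) \int[lebesgue_rV R d]_x
       (Phi (u (x, t)) * fracLap s (fun y => phi (y, t)) x)
    + \int[lebesgue_rV R d]_x (u (x, T) * phi (x, T))
    - \int[lebesgue_rV R d]_x (u0 x * phi (x, 0))}.

End problem.

(* Main.v *)
Require Import Defs.
From HB Require Import structures.
From mathcomp Require Import all_boot all_order all_algebra.
From mathcomp Require Import all_classical all_reals all_analysis.
From mathcomp Require Import measurable_realfun ess_sup_inf ring lra.

(** The nonlinearity only matters on the range of the
    data: if |u0| <= M almost everywhere, shift by M and set
    Psi v = c (Phi (v - M) - Phi (-M)), truncated outside [0, 2M], where c is the
    constant of the fractional Laplacian.  Psi is nondecreasing, Lipschitz and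
    vanishes at 0, and u = U - M solves the problem as soon as U, with
    values in [0, 2M], solves the problem in which the datum is u0 + M and
    Psi includes the constant of the operator.  The shift is harmless in the weak formulation because constants are solutions: the
    fractional Laplacian of a test function has integral 0 ([mean_Lam]).

    The singular operator is approximated by jump operators
    J g x = int K_p(z) (g (x + z) - g x) dz, where K_p cuts off the jumps shorter
    than 2^-p.  K_p is integrable, so the equation u_t = J (Psi u) is an ordinary
    differential equation, discretised by explicit Euler steps of length 32^-p.
    The step is small against the mass of K_p (at most 4^p times a constant), so
    the scheme is monotone ([step_le]); hence it preserves bounds, is an L1
    contraction and conserves mass.

    Compactness is replaced by a Cauchy estimate in L1 for data which are
    bounded with bounded support.  Refining the time step costs little because
    one step moves the solution by an amount controlled by its mass
    ([refine_time]).  Refining the kernel is handled by doubling variables in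
    the manner of Kuznetsov ([kuznetsov_step]): integrate the L1 distance between
    one solution and the translate by w of the other against a bump rho(w).
    The additional short jumps k = K_q - K_p can be moved by symmetry onto
    rho, where the second difference makes them cost only the second moment of the
    short jumps ([second_diff_convol]), that is [tail] at 2^-p, which tends to 0.
    What remains is the L1 modulus of continuity of the datum, small by
    continuity of translations in L1 ([translation_continuity]).  Together these give
    [evol_cauchy_bound].

    A test function enters only through [test_data]: its values, its
    time derivative, and a function Lam within a multiple of [tail] at 2^-p of
    minus the jump operator of level p applied to it.  Summation by parts in time shows that the scheme satisfies the
    weak formulation up to an error vanishing with p ([evol_weak_defect]), and
    the weak formulation passes to almost everywhere limits of bounded
    functions by dominated convergence ([weak_defect_cvg]).  Along a fast subsequence the
    scheme converges almost everywhere, which gives solutions for the data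
    w0 restricted to boxes; by monotonicity these increase with the box, and their limit
    solves the problem for the merely bounded datum w0 ([solution_exists]).

    Finally [slab_test_data] produces such data from a smooth test
    function: a Taylor estimate bounds its second differences, so the truncated
    principal values converge uniformly, with limit the fractional Laplacian. *)

Set Implicit Arguments.
Unset Strict Implicit.
Unset Printing Implicit Defensive.
Import Order.TTheory GRing.Theory Num.Theory.
Import numFieldNormedType.Exports.
Local Open Scope classical_set_scope.
Local Open Scope ring_scope.

(** * Invariance of the Lebesgue measure of row vectors *)

Section invariance.
Context {R : realType}.

Lemma measurable_rV_add n :
  measurable_fun setT (fun p : 'rV[R]_n * 'rV[R]_n => p.1 + p.2).
Proof.
apply: measurable_fun_rVP => i.
under eq_fun do rewrite mxE.
by apply: measurable_funD; apply: (measurableT_comp (measurable_rV_coord i)).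
Qed.

Lemma measurable_rV_opp n : measurable_fun setT (fun x : 'rV[R]_n => - x).
Proof.
apply: measurable_fun_rVP => i.
under eq_fun do rewrite mxE.
exact: measurableT_comp (measurable_rV_coord i).
Qed.

Lemma measurable_rV_addr n (w : 'rV[R]_n) :
  measurable_fun setT (fun x : 'rV[R]_n => x + w).
Proof.
apply: measurable_fun_rVP => i; under eq_fun do rewrite mxE.
by apply: measurable_funD => //; exact: measurable_rV_coord.
Qed.

Lemma measurable_enorm n : measurable_fun setT (@enorm R n).
Proof.
rewrite /enorm; apply: measurableT_comp.
  by apply: continuous_measurable_fun; exact: sqrt_continuous.
apply: measurable_sum => i.
by apply: measurable_funX; exact: measurable_rV_coord.
Qed.

(** Both measures agree on half-open intervals, up to the end points, which
    are null; uniqueness of the Lebesgue measure does the rest. *)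
Lemma ge0_integral_lebesgue_affine (e c : R) (f : R -> \bar R) :
  (e == 1) || (e == -1) ->
  measurable_fun setT f -> (forall r, 0 <= f r)%E ->
  (\int[lebesgue_measure]_r f (e * r + c)%R =
   \int[lebesgue_measure]_r f r)%E.
Proof.
move=> e1 mf f0.
pose phi : measurableTypeR R -> measurableTypeR R := fun r => e * r + c.
have mphi : measurable_fun setT phi.
  by apply: measurable_funD => //; apply: measurable_funM.
transitivity (\int[pushforward lebesgue_measure phi]_r f r)%E.
  by rewrite (ge0_integral_pushforward mphi)// => y _.
apply: eq_measure_integral => //= A mA _.
apply/esym/lebesgue_measure_unique => //= _ [[a b]] _ <-.
rewrite /pushforward /phi.
case/orP: e1 => /eqP ->.
- rewrite (_ : _ @^-1` _ = `](a - c), (b - c)]%classic); last first.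
    by apply/seteqP; split=> x /=; rewrite !in_itv/= mul1r ltrBlDr lerBrDr.
  rewrite !lebesgue_measure_itv/= !lte_fin ltrBlDr subrK -!EFinB.
  by rewrite opprB addrA subrK.
- rewrite (_ : _ @^-1` _ = `[(c - b), (c - a)[%classic); last first.
    apply/seteqP; split=> x /=; rewrite !in_itv/= mulN1r => /andP[h1 h2];
      by apply/andP; split; lra.
  rewrite !lebesgue_measure_itv/= !lte_fin -!EFinB.
  rewrite (_ : (c - b < c - a) = (a < b)); last by apply/idP/idP; lra.
  by case: ifP => // _; congr EFin; lra.
Qed.

Lemma cons_rV_add n (e : R) (a b : R) (x y : 'rV[R]_n) :
  e *: cons_rV (a, x) + cons_rV (b, y) = cons_rV (e * a + b, e *: x + y).
Proof.
apply/rowP => i; rewrite /cons_rV !mxE /=.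
by case: (unlift ord0 i) => [j|] //=; rewrite !mxE.
Qed.

Lemma measurable_cons_rVr n (a : R) :
  measurable_fun setT (fun y : 'rV[R]_n => cons_rV (a, y)).
Proof.
apply: measurable_fun_rVP => i; under eq_fun do rewrite mxE.
by case: (unlift ord0 i) => [j|] /=; [exact: measurable_rV_coord|exact: measurable_cst].
Qed.

Lemma uncons_rVK n : cancel (@uncons_rV R n) (@cons_rV R n).
Proof.
move=> x; apply/rowP => i; rewrite /uncons_rV /cons_rV mxE.
by case: unliftP => [j|] -> /=; rewrite ?mxE.
Qed.

(** The measure on vectors is built one coordinate at a time, so this is
    Tonelli; it is the induction step for every property below. *)
Lemma ge0_integral_rVS n (f : 'rV[R]_n.+1 -> \bar R) :
  measurable_fun setT f -> (forall x, 0 <= f x)%E ->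
  (\int[lebesgue_rV R n.+1]_x f x =
   \int[lebesgue_measure]_a \int[lebesgue_rV R n]_y f (cons_rV (a, y)))%E.
Proof.
move=> mf f0; rewrite /=.
pose l : {sigma_finite_measure set _ -> \bar R} := @lebesgue_measure R.
pose c : measurableTypeR R * 'rV[R]_n -> 'rV[R]_n.+1 := @cons_rV R n.
have mc : measurable_fun setT c := @measurable_cons_rV R n.
transitivity (\int[l \x lebesgue_rV R n]_z f (c z))%E.
  by apply: (ge0_integral_pushforward mc (l \x lebesgue_rV R n)%E (D := setT)).
rewrite (fubini_tonelli1 (m1 := l) (m2 := lebesgue_rV R n) (f \o c))//.
  by apply: measurableT_comp => //; exact: measurable_cons_rV.
by move=> x; exact: f0.
Qed.

Lemma ge0_integral_rV_affine n (e : R) (w : 'rV[R]_n) (f : 'rV[R]_n -> \bar R) :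
  (e == 1) || (e == -1) ->
  measurable_fun setT f -> (forall x, 0 <= f x)%E ->
  (\int[lebesgue_rV R n]_x f (e *: x + w)%R = \int[lebesgue_rV R n]_x f x)%E.
Proof.
move=> e1; have maff m (v : 'rV[R]_m) : measurable_fun setT (fun x : 'rV[R]_m => e *: x + v).
  apply: measurable_fun_rVP => i; under eq_fun do rewrite !mxE.
  apply: measurable_funD => //; apply: measurable_funM => //.
  exact: measurable_rV_coord.
elim: n w f => [|n IH] w f mf f0.
  by apply: eq_integral => x _; congr f; apply/rowP => -[].
have [b [v ->]] : exists b v, w = cons_rV (b, v).
  by exists (uncons_rV w).1, (uncons_rV w).2; rewrite -surjective_pairing uncons_rVK.
have mfc : measurable_fun setT (f \o @cons_rV R n).
  exact: (measurableT_comp mf (@measurable_cons_rV R n)).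
rewrite ge0_integral_rVS//; last exact: (measurableT_comp mf (maff _ _)).
rewrite [RHS]ge0_integral_rVS//.
transitivity (\int[lebesgue_measure]_a
    \int[lebesgue_rV R n]_y f (cons_rV ((e * a + b)%R, y)))%E.
  apply: eq_integral => a _.
  pose g y := f (cons_rV ((e * a + b)%R, y)).
  have mg : measurable_fun setT g := measurableT_comp mf (measurable_cons_rVr _).
  have g0 y : (0 <= g y)%E by exact: f0.
  rewrite -(IH v g mg g0).
  by apply: eq_integral => y _; rewrite cons_rV_add.
apply: (@ge0_integral_lebesgue_affine e b
  (fun a => \int[lebesgue_rV R n]_x f (cons_rV (a, x)))%E) => //.
- have := @measurable_fun_fubini_tonelli_F _ _ _ _ R (lebesgue_rV R n) _ mfc.
  by apply => x; exact: f0.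
- by move=> r; apply: integral_ge0.
Qed.

Lemma ge0_integral_rV_shift n (w : 'rV[R]_n) (f : 'rV[R]_n -> \bar R) :
  measurable_fun setT f -> (forall x, 0 <= f x)%E ->
  (\int[lebesgue_rV R n]_x f (x + w)%R = \int[lebesgue_rV R n]_x f x)%E.
Proof.
move=> mf f0; have e1 : ((1 : R) == 1) || ((1 : R) == -1) by rewrite eqxx.
rewrite -(ge0_integral_rV_affine w e1 mf f0).
by apply: eq_integral => x _; rewrite scale1r.
Qed.

Lemma ge0_integral_rV_opp n (f : 'rV[R]_n -> \bar R) :
  measurable_fun setT f -> (forall x, 0 <= f x)%E ->
  (\int[lebesgue_rV R n]_x f (- x)%R = \int[lebesgue_rV R n]_x f x)%E.
Proof.
move=> mf f0; have e1 : ((-1 : R) == 1) || ((-1 : R) == -1) by rewrite eqxx orbT.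
rewrite -(ge0_integral_rV_affine 0 e1 mf f0).
by apply: eq_integral => x _; rewrite scaleN1r addr0.
Qed.

End invariance.

(** * Boxes and integrability of the stable density *)

Section kernel_integrability.
Context {R : realType} {d : nat}.
Local Notation V := 'rV[R]_d.
Local Notation mu := (lebesgue_rV R d).

Lemma enorm_ge0 (x : V) : 0 <= enorm x.
Proof. exact: sqrtr_ge0. Qed.

Lemma enorm_sqr (x : V) : enorm x ^+ 2 = \sum_i x ord0 i ^+ 2.
Proof. by rewrite sqr_sqrtr// sumr_ge0// => i _; exact: sqr_ge0. Qed.

Lemma coord_le_enorm (x : V) i : `|x ord0 i| <= enorm x.
Proof.
rewrite -[leLHS]sqrtr_sqr ler_wsqrtr// (bigD1 i)//= lerDl sumr_ge0// => j _.
exact: sqr_ge0.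
Qed.

Lemma enormN (x : V) : enorm (- x) = enorm x.
Proof. by congr Num.sqrt; apply: eq_bigr => i _; rewrite mxE sqrrN. Qed.

(** Boxes rather than Euclidean balls, since their measure is explicit. *)
Definition box (r : R) : set V := [set x | forall i, `|x ord0 i| <= r].

Lemma measurable_box r : measurable (box r).
Proof.
rewrite (_ : box r = \bigcap_(i in [set: 'I_d])
    ((fun x : V => x ord0 i) @^-1` `[- r, r])); last first.
  apply/seteqP; split=> [x Bx i _|x Bx i] /=.
    by rewrite in_itv/= -ler_norml; exact: Bx.
  by have := Bx i I; rewrite /= in_itv/= -ler_norml.
apply: fin_bigcap_measurable => // i _.
by rewrite -[X in measurable X]setTI; exact: measurable_rV_coord.
Qed.

Lemma lebesgue_rV_boxr r : 0 <= r -> mu (box r) = ((r *+ 2) ^+ d)%:E.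
Proof.
move=> r0.
rewrite (_ : box r = [set x | forall i, `[- r, r]%classic (x ord0 i)]); last first.
  apply/seteqP; split=> x Bx i.
    by rewrite /= in_itv/= -ler_norml; exact: Bx.
  by have := Bx i; rewrite /= in_itv/= -ler_norml.
rewrite (lebesgue_rV_box (A := fun=> `[- r, r]%classic))//.
rewrite (eq_bigr (fun=> (r *+ 2)%:E)); last first.
  move=> i _; rewrite lebesgue_measure_itv/= lte_fin -EFinB opprK.
  case: ifP => // /negbT; rewrite -leNgt => h.
  have -> : r = 0 by apply/eqP; rewrite eq_le r0 andbT; lra.
  by rewrite mul0rn.
by rewrite -(big_morph EFin (@EFinM R) erefl) prodr_const card_ord.
Qed.

Lemma sub_box (r r' : R) : r <= r' -> box r `<=` box r'.
Proof. by move=> rr' x bx i; exact: le_trans (bx i) rr'. Qed.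

Lemma enorm_box (x : V) r : enorm x <= r -> box r x.
Proof. by move=> xr i; apply: le_trans xr; exact: coord_le_enorm. Qed.

(** Bounding the partial sums by c / (1 - r) suffices. *)
Lemma nneseries_geometric_lty (c r : R) : 0 <= c -> 0 <= r < 1 ->
  (\sum_(0 <= j <oo) (c * r ^+ j)%:E < +oo)%E.
Proof.
move=> c0 /andP[r0 r1].
have r1' : 0 < 1 - r by rewrite subr_gt0.
apply: (@le_lt_trans _ _ (c / (1 - r))%:E); last exact: ltry.
apply: lime_le.
  by apply: is_cvg_nneseries => n _ _; rewrite lee_fin mulr_ge0// exprn_ge0.
apply: nearW => n; rewrite sumEFin lee_fin -mulr_sumr ler_wpM2l//.
rewrite big_mkord -div1r ler_pdivlMr// mulrC.
have := subrX1 r n; rewrite -(opprB 1 r) mulNr => /eqP.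
rewrite -eqr_oppLR => /eqP <-; rewrite opprB.
by rewrite lerBlDr lerDl exprn_ge0.
Qed.

Variable s : R.
Hypotheses (s0 : 0 < s) (s1 : s < 1).
Let p := d%:R + 2 * s.

(** The stable density times min(1, |z|^2): the integrable part of the
    singular kernel, which controls both long jumps and second moments of
    short ones. *)
Definition levy (z : V) : R := Num.min 1 (enorm z ^+ 2) / enorm z `^ p.

Lemma levy_ge0 z : 0 <= levy z.
Proof.
by rewrite divr_ge0 ?powR_ge0// le_min ler01 sqr_ge0.
Qed.

Lemma measurable_levy : measurable_fun setT levy.
Proof.
apply: measurable_funM.
  by apply: measurable_minr => //; apply: measurable_funX; exact: measurable_enorm.
have -> : (fun x : V => (enorm x `^ p)^-1) = (fun r => r `^ (- p)) \o @enorm R d.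
  by apply/funext => x; rewrite /= powRN.
apply: measurableT_comp; first exact: measurable_powR.
exact: measurable_enorm.
Qed.

Let P := 2 `^ p.
Let P0 : 0 < P. Proof. exact: powR_gt0. Qed.

Let powRX2 j : (2 ^+ j) `^ p = P ^+ j.
Proof.
by rewrite -(powR_mulrn j (ltW P0)) /P -powRrM mulrC powRrM (powR_mulrn j).
Qed.

Let dominating (j : nat) (z : V) : R :=
  4 ^- j * P ^+ j.+1 * \1_(box (2 ^- j)) z + P ^- j * \1_(box (2 ^+ j.+1)) z.

Let measurable_dominating j : measurable_fun setT (dominating j).
Proof.
by apply: measurable_funD; apply: measurable_funM => //;
  apply: measurable_indic; exact: measurable_box.
Qed.

Let dominating_ge0 j z : 0 <= dominating j z.
Proof.
by rewrite addr_ge0// !mulr_ge0 ?invr_ge0 ?exprn_ge0// ltW.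
Qed.

Let p0 : 0 < p. Proof. by rewrite ltr_wpDl// mulr_gt0. Qed.

Let levy_dominated z : exists j, levy z <= dominating j z.
Proof.
rewrite /levy; set t := enorm z.
have [t0|t0] := eqVneq t 0.
  by exists 0%N; rewrite t0 powR0 ?gt_eqF// invr0 mulr0.
have tp : 0 < t by rewrite lt_def t0 enorm_ge0.
have [t1|t1] := leP t 1.
  have exj : exists j, 2 ^- j.+1 < t.
    exists (Num.bound t^-1); rewrite invf_plt ?posrE ?exprn_gt0//.
    exact: upper_nthrootP.
  case: (ex_minnP exj) => j jt jmin; exists j.
  have tj : t <= 2 ^- j.
    case: j jt jmin => [_ _|j jt jmin]; first by rewrite expr0 invr1.
    by rewrite leNgt; apply/negP => /jmin; rewrite ltnn.
  apply: (@le_trans _ _ (4 ^- j * P ^+ j.+1 * \1_(box (2 ^- j)) z)); last first.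
    by rewrite lerDl mulr_ge0 ?invr_ge0 ?exprn_ge0// ltW.
  rewrite indicE mem_set ?mulr1; last exact: enorm_box.
  apply: ler_pM => //; first by rewrite le_min ler01 sqr_ge0.
  - by rewrite invr_ge0 powR_ge0.
  - rewrite ge_min; apply/orP; right.
    have -> : 4 ^- j = (2 ^- j) ^+ 2 :> R.
      by rewrite exprVn -exprM mulnC exprM; congr (_ ^- j); rewrite -natrX.
    by rewrite lerXn2r ?nnegrE ?invr_ge0 ?exprn_ge0// ltW.
  - rewrite -powRX2 -[leLHS]mul1r ler_pdivrMr ?powR_gt0//.
    rewrite -powRM ?exprn_ge0 ?(ltW tp)//.
    have h1 : 1 <= 2 ^+ j.+1 * t.
      by move: jt; rewrite -div1r ltr_pdivrMr ?exprn_gt0// mulrC => /ltW.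
    have := ge0_ler_powR (ltW p0) _ _ h1.
    rewrite powR1 !nnegrE ler01 (le_trans ler01 h1) => /(_ isT isT) h2.
    exact: h2.
have exj : exists j, t < 2 ^+ j.+1.
  by exists (Num.bound t); apply: upper_nthrootP; exact: leqnSn.
case: (ex_minnP exj) => j jt jmin; exists j.
have tj : 2 ^+ j <= t.
  case: j jt jmin => [_ _|j jt jmin]; first by rewrite expr0 ltW.
  by rewrite leNgt; apply/negP => /jmin; rewrite ltnn.
apply: (@le_trans _ _ (P ^- j * \1_(box (2 ^+ j.+1)) z)); last first.
  by rewrite lerDr !mulr_ge0 ?invr_ge0 ?exprn_ge0// ltW.
rewrite indicE mem_set ?mulr1; last by apply: enorm_box; exact: ltW.
apply: (@le_trans _ _ (1 / t `^ p)).
  by rewrite ler_wpM2r ?invr_ge0 ?powR_ge0// ge_min lexx.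
rewrite div1r lef_pV2 ?posrE ?powR_gt0 ?exprn_gt0//.
rewrite -powRX2 ge0_ler_powR ?nnegrE ?exprn_ge0 ?(ltW tp)//; exact: ltW.
Qed.

(** Majorise by a sum over dyadic shells, each replaced by the box containing
    it: on 2^(-j-1) < |z| <= 2^-j the density is at most 4^-j 2^((j+1)(d+2s)),
    and 2^(-j(d+2s)) on the shells outside the unit ball. The box volumes turn
    the two series into geometric ones of ratios 2^(2s-2) and 2^(-2s),
    convergent exactly for 0 < s < 1. *)
Lemma levy_integrable : (\int[mu]_z (levy z)%:E < +oo)%E.
Proof.
pose c1 : R := P * 2 ^+ d; pose r1 := P / (4 * 2 ^+ d).
pose c2 : R := 4 ^+ d; pose r2 := 2 ^+ d / P.
have PE : P = 2 ^+ d * 2 `^ (2 * s).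
  by rewrite /P powRD ?pnatr_eq0 ?implybT// powR_mulrn.
have d2 : (0 : R) < 2 ^+ d by rewrite exprn_gt0.
have gt1 (a : R) : 0 < a -> 1 < 2 `^ a :> R.
  move=> a0; rewrite -[ltLHS](_ : 1 `^ a = 1); last by rewrite powR1.
  by rewrite gt0_ltr_powR ?nnegrE// ltr1n.
have s2gt1 : 1 < 2 `^ (2 * s) :> R by rewrite gt1 ?mulr_gt0.
have s2lt4 : 2 `^ (2 * s) < 4 :> R.
  have -> : 4 = 2 `^ (2 * s) * 2 `^ (2 - 2 * s) :> R.
    rewrite -powRD ?pnatr_eq0 ?implybT// addrC subrK.
    by rewrite (powR_mulrn 2)// -natrX.
  by rewrite ltr_pMr ?powR_gt0// gt1// subr_gt0 gtr_pMr.
have r1P : 0 <= r1 < 1.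
  rewrite /r1 PE divr_ge0 ?mulr_ge0 ?powR_ge0 ?(ltW d2)//=.
  by rewrite ltr_pdivrMr ?mulr_gt0// mul1r mulrC ltr_pM2r.
have r2P : 0 <= r2 < 1.
  rewrite /r2 PE divr_ge0 ?mulr_ge0 ?powR_ge0 ?(ltW d2)//=.
  by rewrite ltr_pdivrMr ?mulr_gt0 ?powR_gt0// mul1r ltr_pMr.
apply: (@le_lt_trans _ _ (\int[mu]_z \sum_(0 <= j <oo) (dominating j z)%:E)%E).
  apply: ge0_le_integral => //.
  - by move=> z _; rewrite lee_fin levy_ge0.
  - by apply/measurable_EFinP; exact: measurable_levy.
  - apply: ge0_emeasurable_sum => //.
      by move=> j z _ _; rewrite lee_fin dominating_ge0.
    by move=> j _; apply/measurable_EFinP; exact: measurable_dominating.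
  - move=> z _; have [j jz] := levy_dominated z.
    apply: (@le_trans _ _ (\sum_(0 <= i < j.+1) (dominating i z)%:E)%E); last first.
      by apply: nneseries_lim_ge => i _ _; rewrite lee_fin dominating_ge0.
    rewrite big_nat_recr//= -[leLHS]add0e; apply: leeD; last by rewrite lee_fin.
    by apply: sume_ge0 => i _; rewrite lee_fin dominating_ge0.
rewrite integral_nneseries//; last 2 first.
- by move=> j; apply/measurable_EFinP; exact: measurable_dominating.
- by move=> j z _; rewrite lee_fin dominating_ge0.
have termE j : (\int[mu]_z (dominating j z)%:E =
    (c1 * r1 ^+ j)%:E + (c2 * r2 ^+ j)%:E)%E.
  have intbox (c : R) r : 0 <= c -> 0 <= r ->
      (\int[mu]_z (c * \1_(box r) z)%:E = (c * (r *+ 2) ^+ d)%:E)%E.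
    move=> c0 r0; under eq_integral do rewrite EFinM.
    rewrite ge0_integralZl_EFin//.
    - rewrite integral_indic//; last exact: measurable_box.
      by rewrite setIT EFinM; congr (_ * _)%E; exact: lebesgue_rV_boxr.
    - by apply/measurable_EFinP/measurable_indic; exact: measurable_box.
  have mbox (c r : R) :
      measurable_fun setT (fun z : V => (c * \1_(box r) z)%:E).
    apply/measurable_EFinP/measurable_funM => //.
    by apply: measurable_indic; exact: measurable_box.
  under eq_integral do rewrite EFinD.
  rewrite ge0_integralD//; last 2 first.
  - by move=> z _; rewrite lee_fin !mulr_ge0 ?invr_ge0 ?exprn_ge0// ltW.
  - by move=> z _; rewrite lee_fin mulr_ge0 ?invr_ge0 ?exprn_ge0// ltW.
  rewrite !intbox ?mulr_ge0 ?invr_ge0 ?exprn_ge0 ?(ltW P0)//.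
  have pow2 : (2 ^+ j) ^+ d = (2 ^+ d) ^+ j :> R by rewrite -!exprM mulnC.
  have -> : 4 ^- j * P ^+ j.+1 * (2 ^- j *+ 2) ^+ d = c1 * r1 ^+ j.
    have -> : 2 ^- j *+ 2 = 2 * 2 ^- j :> R by ring.
    rewrite /c1 /r1 [(2 * _) ^+ d]exprMn exprVn pow2 expr_div_n exprMn exprS invfM.
    ring.
  have -> : P ^- j * (2 ^+ j.+1 *+ 2) ^+ d = c2 * r2 ^+ j.
    have -> : 2 ^+ j.+1 *+ 2 = 4 * 2 ^+ j :> R by rewrite exprS; ring.
    rewrite /c2 /r2 exprMn pow2 expr_div_n; ring.
  by [].
have c10 : 0 <= c1 by rewrite mulr_ge0 ?exprn_ge0// ltW.
have c20 : 0 <= c2 by rewrite exprn_ge0.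
rewrite (eq_eseriesr (fun j _ => termE j)) nneseriesD; last 2 first.
- by move=> j _ _; rewrite lee_fin mulr_ge0// exprn_ge0//; case/andP: r1P.
- by move=> j _ _; rewrite lee_fin mulr_ge0// exprn_ge0//; case/andP: r2P.
by apply: lte_add_pinfty; exact: nneseries_geometric_lty.
Qed.

End kernel_integrability.

(** * Integration against symmetric integrable kernels *)

Section kernels.
Context {R : realType} {d : nat}.
Local Notation V := 'rV[R]_d.
Local Notation mu := (lebesgue_rV R d).

(** Symmetry makes the jump operator self-adjoint, integrability makes it
    bounded. *)
Definition jump_kernel (K : V -> R) := [/\ measurable_fun setT K,
  (forall z, 0 <= K z), (\int[mu]_z (K z)%:E < +oo)%E & forall z, K (- z) = K z].

Definition kint (K g : V -> R) : R := \int[mu]_z (K z * g z).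

Definition mass (K : V -> R) : R := \int[mu]_z (K z).

(** For an even kernel this is the usual convolution. *)
Definition convol (K f : V -> R) (x : V) : R := kint K (fun z => f (x + z)).

Section one_kernel.
Variable K : V -> R.
Hypothesis hK : jump_kernel K.

Let mK : measurable_fun setT K. Proof. by case: hK. Qed.
Let K0 z : 0 <= K z. Proof. by case: hK. Qed.
Let Kev z : K (- z) = K z. Proof. by case: hK. Qed.

Lemma kernel_integrable : mu.-integrable setT (EFin \o K).
Proof.
apply/integrableP; split; first exact/measurable_EFinP.
case: hK => _ _ + _; congr (_ < _)%E; apply: eq_integral => z _ /=.
by rewrite ger0_norm.
Qed.

Lemma mass_ge0 : 0 <= mass K.
Proof. exact: Rintegral_ge0. Qed.

Lemma massE : ((mass K)%:E = \int[mu]_z (K z)%:E)%E.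
Proof. by rewrite fineK//; exact: integrable_fin_num kernel_integrable. Qed.

Lemma kint_integrable (B : R) (g : V -> R) : measurable_fun setT g ->
  (forall z, `|g z| <= B) -> mu.-integrable setT (EFin \o (fun z => K z * g z)).
Proof.
move=> mg gB; apply: (@le_integrable _ _ _ mu setT measurableT _
    (fun z => B%:E * (K z)%:E)%E).
- by apply/measurable_EFinP; exact: measurable_funM.
- move=> z _ /=; rewrite lee_fin normrM (ger0_norm (K0 z)) mulrC.
  rewrite (ger0_norm (_ : 0 <= B * K z)) ?ler_wpM2r//.
  by rewrite mulr_ge0// (le_trans _ (gB z)).
- exact: integrableZl kernel_integrable.
Qed.

Lemma kintE (B : R) (g : V -> R) : measurable_fun setT g ->
  (forall z, `|g z| <= B) -> ((kint K g)%:E = \int[mu]_z (K z * g z)%:E)%E.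
Proof.
by move=> mg gB; rewrite fineK//; apply: integrable_fin_num (kint_integrable mg gB).
Qed.

Lemma le_kint (B : R) (g g' : V -> R) :
  measurable_fun setT g -> (forall z, `|g z| <= B) ->
  measurable_fun setT g' -> (forall z, `|g' z| <= B) ->
  (forall z, g z <= g' z) -> kint K g <= kint K g'.
Proof.
move=> mg gB mg' g'B gg'; apply: le_Rintegral => //.
- exact: kint_integrable gB.
- exact: kint_integrable g'B.
- by move=> z _; rewrite ler_wpM2l.
Qed.

Lemma kintB (B : R) (g g' : V -> R) :
  measurable_fun setT g -> (forall z, `|g z| <= B) ->
  measurable_fun setT g' -> (forall z, `|g' z| <= B) ->
  kint K (fun z => g z - g' z) = kint K g - kint K g'.
Proof.
move=> mg gB mg' g'B; rewrite /kint -RintegralB//.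
- by apply: eq_Rintegral => z _; rewrite mulrBr.
- exact: kint_integrable gB.
- exact: kint_integrable g'B.
Qed.

Lemma kint_cst c : kint K (fun=> c) = mass K * c.
Proof. by rewrite /kint RintegralZr//; exact: kernel_integrable. Qed.

Lemma kintZ (B c : R) (g : V -> R) :
  measurable_fun setT g -> (forall z, `|g z| <= B) ->
  kint K (fun z => c * g z) = c * kint K g.
Proof.
move=> mg gB; rewrite /kint -RintegralZl//; last exact: kint_integrable gB.
by apply: eq_Rintegral => z _; rewrite mulrCA.
Qed.

Lemma normr_kint (B : R) (g : V -> R) :
  measurable_fun setT g -> (forall z, `|g z| <= B) ->
  `|kint K g| <= kint K (fun z => `|g z|).
Proof.
move=> mg gB; apply: le_trans (le_normr_Rintegral _ (kint_integrable mg gB)) _ => //.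
rewrite le_eqVlt; apply/orP; left; apply/eqP; apply: eq_Rintegral => z _.
by rewrite normrM (ger0_norm (K0 z)).
Qed.

Lemma kint_ge0 (g : V -> R) : (forall z, 0 <= g z) -> 0 <= kint K g.
Proof. by move=> g0; apply: Rintegral_ge0 => z _; rewrite mulr_ge0. Qed.

Lemma kint_opp (B : R) (g : V -> R) :
  measurable_fun setT g -> (forall z, 0 <= g z <= B) ->
  kint K (fun z => g (- z)) = kint K g.
Proof.
move=> mg gB; rewrite /kint /Rintegral; congr fine.
rewrite -[RHS]ge0_integral_rV_opp//.
- by apply: eq_integral => z _; rewrite Kev.
- by apply/measurable_EFinP; exact: measurable_funM.
- by move=> z; rewrite lee_fin mulr_ge0//; case/andP: (gB z).
Qed.

(** Tonelli only applies to nonnegative integrands, hence the shift by the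
    bound B. *)
Lemma measurable_kint d' (T : measurableType d') (B : R) (g : T * V -> R) :
  measurable_fun setT g -> (forall z, `|g z| <= B) ->
  measurable_fun setT (fun x => kint K (fun z => g (x, z))).
Proof.
move=> mg gB.
have mgx x : measurable_fun setT (fun z => g (x, z)) by exact: measurable_fun_pair2.
have -> : (fun x => kint K (fun z => g (x, z))) =
    (fun x => kint K (fun z => g (x, z) - - B) - mass K * B).
  apply/funext => x.
  rewrite (@kintB B _ (fun=> - B))// ?kint_cst; first ring.
  by move=> _; rewrite normrN ger0_norm// (le_trans _ (gB (x, 0))).
apply: measurable_funB => //.
apply: measurableT_comp => //.
apply: (@measurable_fun_fubini_tonelli_F _ _ _ _ R mu
  (fun p => (K p.2 * (g p - - B))%:E)).
  apply/measurable_EFinP; apply: measurable_funM.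
    exact: measurableT_comp mK _.
  exact: measurable_funB.
move=> p; rewrite lee_fin mulr_ge0// opprK.
by have := gB p; rewrite ler_norml => /andP[+ _]; rewrite -subr_ge0 opprK addrC.
Qed.

Lemma measurable_shiftl (f : V -> R) (x : V) :
  measurable_fun setT f -> measurable_fun setT (fun z => f (x + z)).
Proof.
move=> mf; have -> : (fun z => f (x + z)) = f \o (fun z => z + x).
  by apply/funext => z /=; rewrite addrC.
exact: (measurableT_comp mf (measurable_rV_addr x)).
Qed.

Lemma measurable_shift2 (f : V -> R) :
  measurable_fun setT f -> measurable_fun setT (fun p : V * V => f (p.1 + p.2)).
Proof. by move=> mf; apply: measurableT_comp => //; exact: measurable_rV_add. Qed.

Lemma measurable_convol (B : R) (f : V -> R) : measurable_fun setT f ->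
  (forall z, `|f z| <= B) -> measurable_fun setT (convol K f).
Proof.
move=> mf fB.
exact: (@measurable_kint _ _ B (fun p : V * V => f (p.1 + p.2)) (measurable_shift2 mf)).
Qed.

(** Exchange the integrals: translation does not change the integral of f. *)
Lemma integral_convol (B : R) (f : V -> R) : measurable_fun setT f ->
  (forall z, 0 <= f z <= B) ->
  (\int[mu]_x (convol K f x)%:E = (mass K)%:E * \int[mu]_x (f x)%:E)%E.
Proof.
move=> mf fB; have f0 z : 0 <= f z by case/andP: (fB z).
have fB' z : `|f z| <= B by rewrite ger0_norm//; case/andP: (fB z).
transitivity (\int[mu]_x \int[mu]_z (K z * f (x + z)%R)%:E)%E.
  by apply: eq_integral => x _; rewrite (kintE (measurable_shiftl x mf) (fun z => fB' _)).
rewrite (fubini_tonelli (fun p : V * V => (K p.2 * f (p.1 + p.2)%R)%:E))/=; last 2 first.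
- apply/measurable_EFinP/measurable_funM; first exact: measurableT_comp mK _.
  exact: measurable_shift2.
- by move=> p; rewrite lee_fin mulr_ge0.
transitivity (\int[mu]_z ((\int[mu]_x (f x)%:E) * (K z)%:E))%E.
  apply: eq_integral => z _.
  under eq_integral do rewrite EFinM.
  rewrite ge0_integralZl_EFin//; last 2 first.
  - by move=> x _; rewrite lee_fin.
  - apply/measurable_EFinP; apply: measurableT_comp => //.
    exact: measurable_rV_addr.
  rewrite muleC; congr (_ * _)%E.
  rewrite (ge0_integral_rV_shift z (f := fun x => (f x)%:E))//.
  exact/measurable_EFinP.
rewrite ge0_integralZl//; last 3 first.
- exact/measurable_EFinP.
- by move=> z _; rewrite lee_fin.
- by apply: integral_ge0 => x _; rewrite lee_fin.
by rewrite muleC massE.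
Qed.

End one_kernel.

End kernels.

Section kernel_complements.
Context {R : realType} {d : nat}.
Local Notation V := 'rV[R]_d.
Local Notation mu := (lebesgue_rV R d).
Variable K : V -> R.
Hypothesis hK : jump_kernel K.

(** Adding the constant B reduces to the nonnegative case. *)
Lemma kint_opp_bounded (B : R) (g : V -> R) :
  measurable_fun setT g -> (forall z, `|g z| <= B) ->
  kint K (fun z => g (- z)) = kint K g.
Proof.
move=> mg gB.
have mg' : measurable_fun setT (fun z : V => g (- z)).
  exact: (measurableT_comp mg (@measurable_rV_opp R d)).
have cB (z : V) : `|- B| <= B.
  by rewrite normrN ger0_norm// (le_trans _ (gB 0)).
have := @kint_opp _ _ _ hK (B + B) (fun z => g z - - B).
rewrite (kintB hK mg' (fun z => gB _) (@measurable_cst _ _ _ _ _ _) cB).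
rewrite (kintB hK mg gB (@measurable_cst _ _ _ _ _ _) cB).
move=> /(_ _ _)/subIr; apply.
  exact: measurable_funB.
by move=> z; move: (gB z); rewrite ler_norml opprK -lerBlDr sub0r lerD2r.
Qed.

Lemma convolB_kint (B : R) (f : V -> R) x : measurable_fun setT f ->
  (forall z, `|f z| <= B) ->
  convol K f x - mass K * f x = kint K (fun z => f (x + z) - f x).
Proof.
move=> mf fB; rewrite (kintB hK (measurable_shiftl x mf) (fun z => fB _)
  (@measurable_cst _ _ _ _ _ _) (fun _ => fB x)).
by rewrite kint_cst.
Qed.

End kernel_complements.

(** * Truncated stable kernels *)

Section truncated_kernels.
Context {R : realType} {d : nat}.
Local Notation V := 'rV[R]_d.
Local Notation mu := (lebesgue_rV R d).
Variable s : R.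
Hypotheses (s0 : 0 < s) (s1 : s < 1).
Let p := d%:R + 2 * s.
Local Notation levy := (@levy R d s).

Let levyE z : levy z = Num.min 1 (enorm z ^+ 2) / enorm z `^ p.
Proof. by []. Qed.

(** The singular kernel |z|^(-d-2s) without its jumps of length at most e. *)
Definition kern (e : R) (z : V) : R := (e < enorm z)%R%:R / enorm z `^ p.

Lemma kern_ge0 e z : 0 <= kern e z.
Proof. by rewrite divr_ge0// powR_ge0. Qed.

Lemma measurable_kern e : measurable_fun setT (kern e).
Proof.
apply: measurable_funM.
  have -> : (fun x : V => (e < enorm x)%R%:R) =
      (\1_(`]e, +oo[%classic) : R -> R) \o (@enorm R d).
    apply/funext => x; rewrite /= indicE; congr (_%:R).
    by rewrite [in RHS](_ : (_ \in _) = (e < enorm x))// mem_setE in_itv/= andbT.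
  by apply: measurableT_comp; [exact: measurable_indic|exact: measurable_enorm].
have -> : (fun x : V => (enorm x `^ p)^-1) = (fun r => r `^ (- p)) \o @enorm R d.
  by apply/funext => x; rewrite /= powRN.
apply: measurableT_comp; first exact: measurable_powR.
exact: measurable_enorm.
Qed.

Lemma kernN e z : kern e (- z) = kern e z.
Proof. by rewrite /kern enormN. Qed.

Lemma le_kern e e' z : e <= e' -> kern e' z <= kern e z.
Proof.
move=> ee'; rewrite ler_wpM2r ?invr_ge0 ?powR_ge0//.
case: (ltP e' (enorm z)) => h; first by rewrite (le_lt_trans ee' h).
exact: ler0n.
Qed.

(** On |z| > e, the factor min(1, |z|^2) lost in the passage to the density is
    at least e^2. *)
Lemma kern_le_levy e z : 0 < e -> e <= 1 -> kern e z <= e ^- 2 * levy z.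
Proof.
move=> e0 e1; rewrite /kern levyE mulrA ler_wpM2r ?invr_ge0 ?powR_ge0//.
case: ltP => h /=; last by rewrite mulr_ge0 ?invr_ge0 ?exprn_ge0 ?(ltW e0)// le_min ler01 sqr_ge0.
rewrite mulrC ler_pdivlMr ?exprn_gt0// mul1r le_min exprn_ile1 ?(ltW e0)//=.
by rewrite lerXn2r ?nnegrE ?enorm_ge0 ?ltW.
Qed.

Lemma levy_integrableP : mu.-integrable setT (EFin \o levy).
Proof.
apply/integrableP; split; first by apply/measurable_EFinP; exact: measurable_levy.
have := @levy_integrable R d s s0 s1; congr (_ < _)%E; apply: eq_integral => z _ /=.
by rewrite ger0_norm// levy_ge0.
Qed.

Lemma kern_kernel e : 0 < e -> e <= 1 -> jump_kernel (kern e).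
Proof.
move=> e0 e1; split; [exact: measurable_kern|exact: kern_ge0| |exact: kernN].
have /integrableP[_] : mu.-integrable setT (EFin \o kern e).
  apply: (@le_integrable _ _ _ mu setT measurableT _ (fun z => (e ^- 2)%:E * (levy z)%:E)%E).
  - by apply/measurable_EFinP; exact: measurable_kern.
  - move=> z _ /=; rewrite lee_fin !ger0_norm ?kern_ge0 ?kern_le_levy//.
    by rewrite mulr_ge0 ?levy_ge0// invr_ge0 exprn_ge0// ltW.
  - exact: integrableZl levy_integrableP.
by congr (_ < _)%E; apply: eq_integral => z _ /=; rewrite ger0_norm// kern_ge0.
Qed.

Definition levy_mass : R := \int[mu]_z levy z.

Lemma levy_mass_ge0 : 0 <= levy_mass.
Proof. by apply: Rintegral_ge0 => z _; exact: levy_ge0. Qed.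

Lemma kern_mass e : 0 < e -> e <= 1 -> mass (kern e) <= e ^- 2 * levy_mass.
Proof.
move=> e0 e1; rewrite /levy_mass -RintegralZl//; last exact: levy_integrableP.
apply: le_Rintegral => //.
- exact/kernel_integrable/kern_kernel.
- exact: integrableZl levy_integrableP.
- by move=> z _; exact: kern_le_levy.
Qed.

Definition near_levy (e : R) (z : V) : R := levy z * (enorm z <= e)%R%:R.

(** Second moment of the jumps shorter than e (for e <= 1): the error made by
    neglecting them on a twice differentiable function. *)
Definition tail (e : R) : R := \int[mu]_z near_levy e z.

Lemma near_levy_ge0 e z : 0 <= near_levy e z.
Proof. by rewrite mulr_ge0 ?levy_ge0. Qed.

Lemma measurable_near_levy e : measurable_fun setT (near_levy e).
Proof.
apply: measurable_funM; first exact: measurable_levy.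
have -> : (fun x : V => (enorm x <= e)%R%:R) =
    (\1_(`]-oo, e]%classic) : R -> R) \o (@enorm R d).
  apply/funext => x; rewrite /= indicE; congr (_%:R).
  by rewrite [in RHS](_ : (_ \in _) = (enorm x <= e))// mem_setE in_itv/=.
by apply: measurableT_comp; [exact: measurable_indic|exact: measurable_enorm].
Qed.

Lemma near_levy_le_levy e z : near_levy e z <= levy z.
Proof. by rewrite ler_piMr ?levy_ge0// lern1 leq_b1. Qed.

Lemma near_levy_integrable e : mu.-integrable setT (EFin \o near_levy e).
Proof.
apply: le_integrable levy_integrableP => //.
- by apply/measurable_EFinP; exact: measurable_near_levy.
- move=> z _ /=; rewrite lee_fin !ger0_norm ?levy_ge0 ?near_levy_ge0//.
  exact: near_levy_le_levy.
Qed.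

Lemma tail_ge0 e : 0 <= tail e.
Proof. by apply: Rintegral_ge0 => z _; exact: near_levy_ge0. Qed.

(** Dominated convergence: the integrand vanishes eventually at every z. *)
Lemma tail_cvg0 : tail (2 ^- n) @[n --> \oo] --> (0 : R).
Proof.
have := @dominated_convergence _ _ _ mu setT measurableT
  (fun n z => (near_levy (2 ^- n) z)%:E) (fun=> 0%E) (EFin \o levy).
case.
- by move=> n; apply/measurable_EFinP; exact: measurable_near_levy.
- exact: measurable_cst.
- apply: aeW => z _.
  apply: cvg_near_cst.
  have [z0|z0] := eqVneq (enorm z) 0.
    apply: nearW => n; rewrite /near_levy levyE z0 powR0 ?invr0 ?mulr0 ?mul0r//.
    by rewrite gt_eqF// ltr_wpDl// mulr_gt0.
  have z1 : 0 < enorm z by rewrite lt_def z0 enorm_ge0.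
  exists (Num.bound (enorm z)^-1) => // n /= hn.
  rewrite /near_levy leNgt invf_plt ?posrE ?exprn_gt0//.
  by rewrite upper_nthrootP//= mulr0.
- exact: levy_integrableP.
- apply: aeW => z n _; rewrite lee_fin ger0_norm ?near_levy_ge0//.
  exact: near_levy_le_levy.
move=> _ _; rewrite integral0 => /fine_cvg /=.
by [].
Qed.

End truncated_kernels.

(** * Second differences and the bump function *)

Section second_differences.
Context {R : realType} {d : nat}.
Local Notation V := 'rV[R]_d.
Local Notation mu := (lebesgue_rV R d).

(** A C^2 bound localised in a box, asked only of increments of length at most
    1, the only ones that a cutoff neglects. *)
Definition second_diff (C r : R) (f : V -> R) := forall x z : V, enorm z <= 1 ->
  `|f (x + z) + f (x - z) - 2 * f x| <= C * enorm z ^+ 2 * \1_(box r) x.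

Variable s : R.
Hypotheses (s0 : 0 < s) (s1 : s < 1).

(** Averaging over z and -z, allowed by symmetry of K, replaces first
    differences by second differences, which are quadratic in |z| and so
    integrable against a kernel of short jumps. *)
Lemma second_diff_convol (K : V -> R) (e C r B : R) (f : V -> R) :
  jump_kernel K -> 0 <= e -> e <= 1 ->
  (forall z, K z * enorm z ^+ 2 <= near_levy s e z) ->
  measurable_fun setT f -> (forall x, `|f x| <= B) ->
  0 <= C -> second_diff C r f ->
  forall x, `|convol K f x - mass K * f x| <= C * @tail R d s e * \1_(box r) x.
Proof.
move=> hK e0 e1 Kz mf fB C0 sdf x.
have [_ K0 _ _] := hK.
rewrite (convolB_kint hK x mf fB).
set g := fun z => _.
have mg : measurable_fun setT g.
  by apply: measurable_funB => //; exact: measurable_shiftl.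
have gB z : `|g z| <= B + B by rewrite (le_trans (ler_normB _ _))// lerD.
have mg' : measurable_fun setT (fun z : V => g (- z)).
  exact: (measurableT_comp mg (@measurable_rV_opp R d)).
have intK := kint_integrable hK mg gB.
have intK' := kint_integrable hK mg' (fun z => gB (- z)).
have E : 2 * kint K g = \int[mu]_z (K z * g z + K z * g (- z)).
  by rewrite RintegralD// -![\int[mu]_x _]/(kint K _) (kint_opp_bounded hK mg gB); ring.
rewrite (@le_trans _ _ `|2 * kint K g|)//.
  by rewrite normrM (ger0_norm (_ : 0 <= 2))// ler_peMl// ler1n.
have intD : mu.-integrable setT (EFin \o (fun z => K z * g z + K z * g (- z))).
  by apply: eq_integrable (integrableD _ intK intK').
rewrite E (le_trans (le_normr_Rintegral _ intD))//.
have -> : C * @tail R d s e * \1_(box r) x =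
    \int[mu]_z (C * \1_(box r) x * near_levy s e z).
  rewrite RintegralZl//; last exact: near_levy_integrable.
  by rewrite mulrAC.
apply: le_Rintegral => //.
- exact: integrable_norm.
- exact: (integrableZl measurableT _ (near_levy_integrable s0 s1 e)).
move=> z _.
have [ez|ez] := leP (enorm z) e; last first.
  have : K z * enorm z ^+ 2 <= 0.
    by rewrite (le_trans (Kz z))// /near_levy (leNgt (enorm z)) ez mulr0.
  have z0 : 0 < enorm z ^+ 2.
    by rewrite exprn_gt0// (le_lt_trans e0 ez).
  rewrite pmulr_lle0// => Kz0.
  have -> : K z = 0 by apply/eqP; rewrite eq_le Kz0 K0.
  by rewrite !mul0r addr0 normr0 mulr_ge0 ?near_levy_ge0// mulr_ge0.
rewrite -mulrDr normrM (ger0_norm (K0 z)).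
have -> : g z + g (- z) = f (x + z) + f (x - z) - 2 * f x by rewrite /g; ring.
apply: (@le_trans _ _ (K z * (C * enorm z ^+ 2 * \1_(box r) x))).
  by rewrite ler_wpM2l// sdf// (le_trans ez).
rewrite [leLHS](_ : _ = C * \1_(box r) x * (K z * enorm z ^+ 2)); last by ring.
by rewrite ler_wpM2l// mulr_ge0.
Qed.

Definition dot (x z : V) : R := \sum_i x ord0 i * z ord0 i.

Lemma enormD_sqr (x z : V) :
  enorm (x + z) ^+ 2 = enorm x ^+ 2 + 2 * dot x z + enorm z ^+ 2.
Proof.
rewrite !enorm_sqr /dot mulr_sumr -!big_split/=; apply: eq_bigr => i _.
by rewrite mxE; ring.
Qed.

Lemma dotN (x z : V) : dot x (- z) = - dot x z.
Proof. by rewrite /dot -sumrN; apply: eq_bigr => i _; rewrite mxE mulrN. Qed.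

Lemma normr_dot r (x z : V) : 0 <= r -> box r x -> `|dot x z| <= d%:R * r * enorm z.
Proof.
move=> r0 bx; rewrite (le_trans (ler_norm_sum _ _ _))//.
rewrite (@le_trans _ _ (\sum_(i < d) r * enorm z))//.
  by apply: ler_sum => i _; rewrite normrM ler_pM// coord_le_enorm.
by rewrite sumr_const card_ord -mulrA mulr_natl.
Qed.

(** A bump supported in the ball of radius e. It is only C^1 with Lipschitz
    gradient, but polynomial inside the ball, so that its second differences
    can be estimated by hand. *)
Definition mollifier (e : R) (w : V) : R := (Num.max 0 (e ^+ 2 - enorm w ^+ 2)) ^+ 2.

Lemma measurable_mollifier e : measurable_fun setT (mollifier e).
Proof.
apply: measurable_funX; apply: measurable_maxr => //; apply: measurable_funB => //.
by apply: measurable_funX; exact: measurable_enorm.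
Qed.

Lemma mollifier_ge0 e w : 0 <= mollifier e w. Proof. exact: sqr_ge0. Qed.

Lemma mollifier_le1 e w : 0 <= e -> e <= 1 -> mollifier e w <= 1.
Proof.
move=> e0 e1; rewrite /mollifier exprn_ile1 ?le_max ?lexx// ge_max ler01/=.
by rewrite lerBlDr (le_trans (exprn_ile1 _ e0 e1))// lerDl sqr_ge0.
Qed.

Lemma mollifier_eq0 e w : 0 <= e -> e <= enorm w -> mollifier e w = 0.
Proof.
move=> e0 ew; rewrite /mollifier max_l ?expr0n// subr_le0.
by rewrite lerXn2r ?nnegrE ?enorm_ge0.
Qed.

(** The square of the positive part is convex with second derivative at most
    2: this is its Taylor formula of order two with a bound on the remainder. *)
Lemma sqr_max_taylor (a b : R) :
  0 <= (Num.max 0 b) ^+ 2 - (Num.max 0 a) ^+ 2 - 2 * Num.max 0 a * (b - a)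
    <= (b - a) ^+ 2.
Proof.
have ab : 0 <= (b - a) ^+ 2 by exact: sqr_ge0.
have [a0|/ltW a0] := leP 0 a; have [b0|/ltW b0] := leP 0 b.
- by apply/andP; split; nra.
- have ab0 : a * b <= 0 by rewrite mulr_ge0_le0.
  by apply/andP; split; nra.
- have ab0 : a * b <= 0 by rewrite mulr_le0_ge0.
  by apply/andP; split; nra.
- by rewrite expr0n/= subrr mulr0 mul0r subr0 lexx.
Qed.

(** Collects the remainders of [sqr_max_taylor] at the points x + z and x - z
    of the box of radius 2, where the scalar product of x and z is at most 2 d
    |z|. *)
Definition mollifier_C : R := 6 + 32 * d%:R ^+ 2.

(** Apply [sqr_max_taylor] with a the value at x: the terms linear in z cancel
    between z and -z. *)
Lemma second_diff_mollifier e : 0 <= e -> e <= 1 -> second_diff mollifier_C 2 (mollifier e).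
Proof.
move=> e0 e1 x z z1.
have [bx|bx] := pselect (box 2 x); last first.
  rewrite indicE memNset// mulr0.
  (* x + y is outside the unit ball, hence outside the support *)
  have far (y : V) : enorm y <= 1 -> e <= enorm (x + y).
    move=> y1; apply: (le_trans e1); rewrite leNgt; apply/negP => xy1; apply: bx => i.
    have -> : x ord0 i = (x + y) ord0 i - y ord0 i by rewrite mxE addrK.
    rewrite (le_trans (ler_normB _ _))// [leRHS](_ : 2 = 1 + 1)//.
    by rewrite lerD// (le_trans (coord_le_enorm _ _))// ltW.
  rewrite !mollifier_eq0 ?far ?enormN//; first by rewrite mulr0 addr0 subrr normr0.
  rewrite -(addr0 x) far//.
  by rewrite -[leLHS]/(Num.sqrt _) big1 ?sqrtr0// => i _; rewrite mxE expr0n.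
rewrite indicE mem_set// mulr1.
have dz := normr_dot z (ler0n _ 2) bx.
have z0 := enorm_ge0 z.
have d0 : (0 : R) <= d%:R by [].
rewrite /mollifier.
set a := e ^+ 2 - enorm x ^+ 2.
have a1 : Num.max 0 a <= 1.
  by rewrite ge_max ler01 lerBlDr (le_trans (exprn_ile1 _ e0 e1))// lerDl sqr_ge0.
have a0 : 0 <= Num.max 0 a by rewrite le_max lexx.
rewrite !enormD_sqr dotN enormN.
have /andP[T1 T2] := sqr_max_taylor a (e ^+ 2 - (enorm x ^+ 2 + 2 * dot x z + enorm z ^+ 2)).
have /andP[T3 T4] := sqr_max_taylor a (e ^+ 2 - (enorm x ^+ 2 + 2 * - dot x z + enorm z ^+ 2)).
have dz2 : dot x z ^+ 2 <= 4 * d%:R ^+ 2 * enorm z ^+ 2.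
  rewrite -real_normK ?num_real//.
  have -> : 4 * d%:R ^+ 2 * enorm z ^+ 2 = (d%:R * 2 * enorm z) ^+ 2 :> R by ring.
  by rewrite lerXn2r ?nnegrE ?mulr_ge0.
move: T1 T2 T3 T4; rewrite /mollifier_C.
rewrite (_ : e ^+ 2 - (enorm x ^+ 2 + 2 * dot x z + enorm z ^+ 2) - a =
  - (2 * dot x z) - enorm z ^+ 2); last by rewrite /a; ring.
rewrite (_ : e ^+ 2 - (enorm x ^+ 2 + 2 * - dot x z + enorm z ^+ 2) - a =
  2 * dot x z - enorm z ^+ 2); last by rewrite /a; ring.
set m := Num.max 0 a in a1 a0 *.
set t := dot x z in dz2 *.
move: (Num.max 0 _ ^+ 2) (Num.max 0 _ ^+ 2) => u v.
have zz1 : enorm z ^+ 2 <= 1 by rewrite exprn_ile1.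
have zz0 : 0 <= enorm z ^+ 2 by rewrite sqr_ge0.
move: (enorm z ^+ 2) zz1 zz0 dz2 => q q1 q0 tq T1 T2 T3 T4.
have qq : q * q <= q by nra.
have mq : m * q <= q by nra.
rewrite ler_norml; apply/andP; split; nra.
Qed.

End second_differences.

(** * The explicit Euler step *)

Section scheme.
Context {R : realType} {d : nat}.
Local Notation V := 'rV[R]_d.
Local Notation mu := (lebesgue_rV R d).
Variables (Psi : R -> R) (L M : R).
Hypotheses (Psi0 : Psi 0 = 0) (Psi_nd : {homo Psi : x y / x <= y})
  (L0 : 0 <= L) (Psi_lip : forall a b, `|Psi a - Psi b| <= L * `|a - b|)
  (M0 : 0 <= M).

(** One Euler step for u_t = K * Psi(u) - mass(K) Psi(u). *)
Definition step (K : V -> R) (h : R) (u : V -> R) (x : V) : R :=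
  u x + h * (convol K (Psi \o u) x - mass K * Psi (u x)).

Definition ranged (u : V -> R) :=
  measurable_fun setT u /\ forall x, 0 <= u x <= M.

Lemma measurable_Psi : measurable_fun setT Psi.
Proof. by apply: nondecreasing_measurable => // x y _ _; exact: Psi_nd. Qed.

Lemma ranged_Psi u : ranged u -> measurable_fun setT (Psi \o u).
Proof. by move=> [mu_ _]; apply: measurableT_comp => //; exact: measurable_Psi. Qed.

Lemma Psi_ge0 a : 0 <= a -> 0 <= Psi a.
Proof. by move=> a0; rewrite -Psi0 Psi_nd. Qed.

Lemma Psi_le a : 0 <= a -> Psi a <= L * a.
Proof.
by move=> a0; have := Psi_lip a 0; rewrite Psi0 !subr0 !ger0_norm// Psi_ge0.
Qed.

Lemma ranged_Psi_bound u : ranged u -> forall x, 0 <= (Psi \o u) x <= L * M.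
Proof.
move=> [_ hu] x; have /andP[u0 uM] := hu x; rewrite Psi_ge0//=.
by rewrite (le_trans (Psi_le u0))// ler_wpM2l.
Qed.

Lemma ranged_Psi_norm u : ranged u -> forall x, `|(Psi \o u) x| <= L * M.
Proof.
by move=> hu x; have /andP[? ?] := ranged_Psi_bound hu x; rewrite ger0_norm.
Qed.

(** Under c L <= 1 the map a - c Psi(a) is nondecreasing, so the difference
    keeps the sign of a - b, and so does that of Psi. *)
Lemma cfl_norm c a b : 0 <= c -> c * L <= 1 ->
  `|a - b - c * (Psi a - Psi b)| = `|a - b| - c * `|Psi a - Psi b|.
Proof.
move=> c0 cL; wlog ab : a b / b <= a.
  move=> H; have [|/ltW ab] := leP b a; first exact: H.
  rewrite (distrC a) (distrC (Psi a)) -(H b a ab) -normrN; congr (`|_|); ring.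
have Pab : 0 <= Psi a - Psi b by rewrite subr_ge0 Psi_nd.
have ab0 : 0 <= a - b by rewrite subr_ge0.
have := Psi_lip a b; rewrite (ger0_norm Pab) (ger0_norm ab0) => h.
suff : 0 <= a - b - c * (Psi a - Psi b) by move/ger0_norm.
by rewrite subr_ge0 (le_trans (ler_wpM2l c0 h))// mulrA ler_piMl.
Qed.

(** The new value at x is nondecreasing in the old value at x by [cfl_norm],
    and in the other old values because K and h are nonnegative. This
    monotonicity is the source of all estimates on the scheme. *)
Lemma step_le K h u v : jump_kernel K -> 0 <= h -> h * mass K * L <= 1 ->
  ranged u -> ranged v -> (forall x, u x <= v x) ->
  forall x, step K h u x <= step K h v x.
Proof.
move=> hK h0 cfl hu hv uv x; rewrite -subr_ge0 /step.
have c0 : 0 <= h * mass K by rewrite mulr_ge0// mass_ge0.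
have Puv : 0 <= Psi (v x) - Psi (u x) by rewrite subr_ge0 Psi_nd.
have uv0 : 0 <= v x - u x by rewrite subr_ge0.
have cvuv : convol K (Psi \o u) x <= convol K (Psi \o v) x.
  apply: (le_kint hK (B := L * M)); first exact: measurable_shiftl (ranged_Psi hu).
  - by move=> z; exact: ranged_Psi_norm.
  - exact: measurable_shiftl (ranged_Psi hv).
  - by move=> z; exact: ranged_Psi_norm.
  - by move=> z; exact: Psi_nd.
have := cfl_norm (v x) (u x) c0 cfl; rewrite !(ger0_norm uv0) (ger0_norm Puv) => e.
have : 0 <= v x - u x - h * mass K * (Psi (v x) - Psi (u x)) by rewrite -e.
have : 0 <= h * (convol K (Psi \o v) x - convol K (Psi \o u) x).
  by rewrite mulr_ge0// subr_ge0.
lra.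
Qed.

Lemma step_cst K h c : jump_kernel K -> step K h (fun=> c) = fun=> c.
Proof.
by move=> hK; apply/funext => x; rewrite /step /convol /= kint_cst// subrr mulr0 addr0.
Qed.

Lemma ranged_cst c : 0 <= c <= M -> ranged (fun=> c).
Proof. by move=> cM; split. Qed.

Lemma measurable_step K h u : jump_kernel K -> ranged u ->
  measurable_fun setT (step K h u).
Proof.
move=> hK hu; apply: measurable_funD; first by case: hu.
apply: measurable_funM => //; apply: measurable_funB.
  exact: measurable_convol hK _ _ (ranged_Psi hu) (ranged_Psi_norm hu).
by apply: measurable_funM => //; exact: ranged_Psi.
Qed.

(** The constants 0 and M are stationary, so the comparison [step_le] confines
    the step between them. *)
Lemma ranged_step K h u : jump_kernel K -> 0 <= h -> h * mass K * L <= 1 ->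
  ranged u -> ranged (step K h u).
Proof.
move=> hK h0 cfl hu; split; first exact: measurable_step.
move=> x; apply/andP; split.
  have := step_le hK h0 cfl (@ranged_cst 0 _) hu _ x.
  by rewrite step_cst//; apply=> [|y]; [rewrite lexx|case: hu => _ /(_ y)/andP[]].
have := step_le hK h0 cfl hu (@ranged_cst M _) _ x.
by rewrite step_cst//; apply=> [|y]; [rewrite lexx andbT|case: hu => _ /(_ y)/andP[]].
Qed.

Section comparison.
Variables (K1 K2 k : V -> R).
Hypotheses (hK1 : jump_kernel K1) (hK2 : jump_kernel K2) (hk : jump_kernel k)
  (K2E : forall z, K2 z = K1 z + k z).

Lemma massD : mass K2 = mass K1 + mass k.
Proof.
rewrite /mass -RintegralD//; [|exact: kernel_integrable|exact: kernel_integrable].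
by apply: eq_Rintegral => z _; rewrite K2E.
Qed.

Lemma kintD (B : R) (g : V -> R) : measurable_fun setT g ->
  (forall z, `|g z| <= B) -> kint K2 g = kint K1 g + kint k g.
Proof.
move=> mg gB; have i1 := kint_integrable hK1 mg gB.
have ik := kint_integrable hk mg gB.
rewrite /kint -(RintegralD _ i1 ik)//.
by apply: eq_Rintegral => z _; rewrite K2E mulrDl.
Qed.

(** The part K1 of the kernel moves both points x and y together; the
    additional part k only concerns v, and is written as a difference with u
    frozen at x. This asymmetry lets the doubling argument put k on the bump. *)
Lemma step_comparison h u v (x y : V) : 0 <= h -> h * mass K2 * L <= 1 ->
  ranged u -> ranged v ->
  `|step K1 h u x - step K2 h v y| + h * mass K2 * `|Psi (u x) - Psi (v y)| <=
  `|u x - v y| + h * kint K1 (fun z => `|Psi (u (x + z)) - Psi (v (y + z))|)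
  + h * kint k (fun z => `|Psi (u x) - Psi (v (y + z))|).
Proof.
move=> h0 cfl hu hv.
have mPu := measurable_shiftl x (ranged_Psi hu).
have mPv := measurable_shiftl y (ranged_Psi hv).
have bPu z := ranged_Psi_norm hu (x + z).
have bPv z := ranged_Psi_norm hv (y + z).
have c0 : 0 <= h * mass K2 by rewrite mulr_ge0// mass_ge0.
have E : step K1 h u x - step K2 h v y =
    (u x - v y - h * mass K2 * (Psi (u x) - Psi (v y)))
    + h * kint K1 (fun z => Psi (u (x + z)) - Psi (v (y + z)))
    + h * kint k (fun z => Psi (u x) - Psi (v (y + z))).
  rewrite (kintB hK1 mPu bPu mPv bPv).
  rewrite (kintB hk (@measurable_cst _ _ _ _ _ (Psi (u x)))
    (fun _ => ranged_Psi_norm hu x) mPv bPv) (kint_cst hk).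
  by rewrite /step /convol (kintD mPv bPv) massD/=; ring.
have b2 (a b : R) : `|a| <= L * M -> `|b| <= L * M -> `|a - b| <= L * M + L * M.
  by move=> aB bB; rewrite (le_trans (ler_normB _ _))// lerD.
have n1 : `|kint K1 (fun z => Psi (u (x + z)) - Psi (v (y + z)))| <=
    kint K1 (fun z => `|Psi (u (x + z)) - Psi (v (y + z))|).
  apply: (normr_kint hK1 (B := L * M + L * M)); first exact: measurable_funB.
  by move=> z; apply: b2; [exact: bPu|exact: bPv].
have n2 : `|kint k (fun z => Psi (u x) - Psi (v (y + z)))| <=
    kint k (fun z => `|Psi (u x) - Psi (v (y + z))|).
  apply: (normr_kint hk (B := L * M + L * M)); first exact: measurable_funB.
  by move=> z; apply: b2; [exact: (ranged_Psi_norm hu x)|exact: bPv].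
rewrite E -lerBrDr.
have := cfl_norm (u x) (v y) c0 cfl.
set A := u x - v y - _ => AE.
rewrite (le_trans (ler_normD _ _))//.
have := ler_normD A (h * kint K1 (fun z => Psi (u (x + z)) - Psi (v (y + z)))).
rewrite !normrM (ger0_norm h0) AE => h1.
have := ler_wpM2l h0 n1; have := ler_wpM2l h0 n2.
lra.
Qed.

End comparison.
End scheme.

(** * Distance in L1 to a translate *)

Section shifted_distance.
Context {R : realType} {d : nat}.
Local Notation V := 'rV[R]_d.
Local Notation mu := (lebesgue_rV R d).

(** The L1 distance from f to the translate of g by w, as a function of w. *)
Definition L1dist (f g : V -> R) (w : V) : R := \int[mu]_x `|f x - g (x + w)|.

Lemma integrable_shift (f : V -> R) w : mu.-integrable setT (EFin \o f) ->
  mu.-integrable setT (EFin \o (fun x => f (x + w))).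
Proof.
move=> /integrableP[/measurable_EFinP mf fi].
apply/integrableP; split.
  apply/measurable_EFinP.
  exact: (measurableT_comp mf (measurable_rV_addr w)).
rewrite (ge0_integral_rV_shift w (f := fun x => `|(f x)%:E|%E))//.
by apply: measurableT_comp => //; exact/measurable_EFinP.
Qed.

Lemma Rintegral_shift (f : V -> R) w : measurable_fun setT f ->
  (forall x, 0 <= f x) -> \int[mu]_x f (x + w) = \int[mu]_x f x.
Proof.
move=> mf f0; congr fine; rewrite (ge0_integral_rV_shift w (f := fun x => (f x)%:E))//.
exact/measurable_EFinP.
Qed.

Lemma L1dist_integrable (f g : V -> R) w :
  mu.-integrable setT (EFin \o f) -> mu.-integrable setT (EFin \o g) ->
  mu.-integrable setT (EFin \o (fun x => `|f x - g (x + w)|)).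
Proof.
move=> fi gi; apply: (integrable_norm (f := fun x => f x - g (x + w))).
by apply: eq_integrable (integrableB _ fi (integrable_shift w gi)).
Qed.

Lemma L1distE (f g : V -> R) w :
  mu.-integrable setT (EFin \o f) -> mu.-integrable setT (EFin \o g) ->
  ((L1dist f g w)%:E = \int[mu]_x (`|f x - g (x + w)|)%:E)%E.
Proof.
by move=> fi gi; rewrite fineK//; apply: integrable_fin_num (L1dist_integrable w fi gi).
Qed.

Lemma L1dist_ge0 (f g : V -> R) w : 0 <= L1dist f g w.
Proof. exact: Rintegral_ge0. Qed.

Lemma measurable_L1dist (f g : V -> R) :
  measurable_fun setT f -> measurable_fun setT g -> measurable_fun setT (L1dist f g).
Proof.
move=> mf mg; apply: measurableT_comp => //.
apply: (measurable_fun_fubini_tonelli_F (fun p : V * V =>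
  (`|f p.2 - g (p.2 + p.1)|)%:E)); last by move=> p; rewrite lee_fin.
apply/measurable_EFinP; apply: measurableT_comp => //; apply: measurable_funB.
  exact: measurableT_comp.
under eq_fun do rewrite addrC.
exact: (measurable_shift2 mg).
Qed.

Lemma L1dist_le (f g : V -> R) w :
  mu.-integrable setT (EFin \o f) -> mu.-integrable setT (EFin \o g) ->
  (forall x, 0 <= f x) -> (forall x, 0 <= g x) ->
  L1dist f g w <= \int[mu]_x f x + \int[mu]_x g x.
Proof.
move=> fi gi f0 g0.
have gi' := integrable_shift w gi.
have mg : measurable_fun setT g by case/integrableP : gi => /measurable_EFinP.
rewrite -(Rintegral_shift w mg g0) -RintegralD//.
apply: le_Rintegral => //; first exact: L1dist_integrable.
  by apply: eq_integrable (integrableD _ fi gi').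
move=> x _; rewrite (le_trans (ler_normB _ _))// !ger0_norm//.
Qed.

Lemma L1dist_triangle (f g h : V -> R) w :
  mu.-integrable setT (EFin \o f) -> mu.-integrable setT (EFin \o g) ->
  mu.-integrable setT (EFin \o h) ->
  L1dist f h w <= L1dist f g 0 + L1dist g h w.
Proof.
move=> fi gi hi.
have fg := L1dist_integrable 0 fi gi; have gh := L1dist_integrable w gi hi.
rewrite /L1dist -RintegralD//; apply: le_Rintegral => //; first exact: L1dist_integrable.
  by apply: eq_integrable (integrableD _ fg gh).
by move=> x _; rewrite addr0 (le_trans _ (ler_normD _ _))// addrA subrK.
Qed.

Lemma L1dist0C (f g : V -> R) : L1dist f g 0 = L1dist g f 0.
Proof. by apply: eq_Rintegral => x _; rewrite !addr0 distrC. Qed.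

Lemma L1dist_triangle_shift (f g : V -> R) w :
  mu.-integrable setT (EFin \o f) -> mu.-integrable setT (EFin \o g) ->
  L1dist f g 0 <= L1dist f g w + L1dist g g w.
Proof.
move=> fi gi.
have fg := L1dist_integrable w fi gi; have gg := L1dist_integrable w gi gi.
rewrite /L1dist -RintegralD//; apply: le_Rintegral => //; first exact: L1dist_integrable.
  by apply: eq_integrable (integrableD _ fg gg).
move=> x _; rewrite addr0 (distrC (g x) (g (x + w))) (le_trans _ (ler_normD _ _))//.
by rewrite addrA subrK.
Qed.

(** Tonelli, translation invariance and the symmetry of K. *)
Lemma convol_adjoint (K f g : V -> R) (A B : R) : jump_kernel K ->
  measurable_fun setT f -> (forall x, 0 <= f x <= A) ->
  measurable_fun setT g -> (forall x, 0 <= g x <= B) ->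
  (\int[mu]_x (f x * convol K g x)%:E = \int[mu]_x (convol K f x * g x)%:E)%E.
Proof.
move=> hK mf fA mg gB; have [mK K0 _ Kev] := hK.
have f0 x : 0 <= f x by case/andP: (fA x).
have g0 x : 0 <= g x by case/andP: (gB x).
have fA' x : `|f x| <= A by rewrite ger0_norm//; case/andP: (fA x).
have gB' x : `|g x| <= B by rewrite ger0_norm//; case/andP: (gB x).
transitivity (\int[mu]_x \int[mu]_z (f x * (K z * g (x + z)%R))%:E)%E.
  apply: eq_integral => x _.
  rewrite EFinM /convol (kintE hK (measurable_shiftl x mg) (fun z => gB' _)).
  rewrite -ge0_integralZl_EFin//.
  - by move=> z _; rewrite lee_fin mulr_ge0.
  - by apply/measurable_EFinP/measurable_funM => //; exact: measurable_shiftl.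
rewrite (fubini_tonelli (fun p : V * V => (f p.1 * (K p.2 * g (p.1 + p.2)%R))%:E))/=;
    last 2 first.
- apply/measurable_EFinP/measurable_funM; first exact: measurableT_comp mf _.
  apply/measurable_funM; first exact: measurableT_comp mK _.
  exact: measurable_shift2.
- by move=> p; rewrite lee_fin !mulr_ge0.
transitivity (\int[mu]_z \int[mu]_x (f (x - z)%R * (K z * g x))%:E)%E.
  apply: eq_integral => z _.
  rewrite -[RHS](ge0_integral_rV_shift z (f := fun x => (f (x - z)%R * (K z * g x))%:E)).
  - by apply: eq_integral => x _; rewrite addrK.
  - apply/measurable_EFinP/measurable_funM; last exact: measurable_funM.
    exact: (measurableT_comp mf (measurable_rV_addr (- z))).
  - by move=> x; rewrite lee_fin !mulr_ge0.
have msub : measurable_fun setT (fun p : V * V => f (p.2 - p.1)).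
  have -> : (fun p : V * V => f (p.2 - p.1)) =
      (fun p : V * V => f (p.1 + p.2)) \o (fun p : V * V => (p.2, - p.1)) by [].
  apply: measurableT_comp; first exact: measurable_shift2.
  apply: measurable_fun_pair => //.
  exact: (measurableT_comp (@measurable_rV_opp R d) _).
rewrite (fubini_tonelli (fun p : V * V => (f (p.2 - p.1)%R * (K p.1 * g p.2))%:E))/=;
    last 2 first.
- apply/measurable_EFinP/measurable_funM => //.
  apply/measurable_funM; first exact: measurableT_comp mK _.
  exact: measurableT_comp mg _.
- by move=> p; rewrite lee_fin !mulr_ge0.
apply: eq_integral => x _.
have mfx : measurable_fun setT (fun z : V => f (x + z)) by exact: measurable_shiftl.
rewrite /convol -(kint_opp hK mfx (fun z => fA _)).
have mfx' : measurable_fun setT (fun z : V => f (x - z)).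
  exact: (measurableT_comp mfx (@measurable_rV_opp R d)).
rewrite EFinM (kintE hK mfx' (fun z => fA' _)) muleC -ge0_integralZl_EFin//.
- by apply: eq_integral => z _; rewrite -EFinM; congr EFin; ring.
- by move=> z _; rewrite lee_fin mulr_ge0.
- by apply/measurable_EFinP/measurable_funM.
Qed.

End shifted_distance.

(** * One step in L1 *)

Section integrated_comparison.
Context {R : realType} {d : nat}.
Local Notation V := 'rV[R]_d.
Local Notation mu := (lebesgue_rV R d).
Variables (Psi : R -> R) (L M : R).
Hypotheses (Psi0 : Psi 0 = 0) (Psi_nd : {homo Psi : x y / x <= y})
  (L0 : 0 <= L) (Psi_lip : forall a b, `|Psi a - Psi b| <= L * `|a - b|)
  (M0 : 0 <= M).

Local Notation ranged := (@ranged R d M).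
Local Notation step := (@step R d Psi).

Definition state (u : V -> R) := ranged u /\ mu.-integrable setT (EFin \o u).

Let mPsi := @ranged_Psi R d Psi M Psi_nd.

Lemma state_ge0 u : state u -> forall x, 0 <= u x.
Proof. by move=> [[_ hu] _] x; case/andP: (hu x). Qed.

Lemma state_Psi_integrable u : state u -> mu.-integrable setT (EFin \o (Psi \o u)).
Proof.
move=> hu; have u0 := state_ge0 hu; case: hu => hu ui.
apply: (@le_integrable _ _ _ mu setT measurableT _ (fun x => L%:E * (u x)%:E)%E).
- by apply/measurable_EFinP; exact: mPsi hu.
- move=> x _ /=; rewrite lee_fin !ger0_norm ?mulr_ge0//.
  + exact: Psi_le Psi0 Psi_nd Psi_lip _ _.
  + exact: Psi_ge0 Psi0 Psi_nd _ _.
- exact: integrableZl.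
Qed.

Lemma state_Psi_mass u : state u -> \int[mu]_x Psi (u x) <= L * \int[mu]_x u x.
Proof.
move=> hu; have u0 := state_ge0 hu; rewrite -RintegralZl//; last by case: hu.
apply: le_Rintegral => //.
- exact: state_Psi_integrable.
- exact: (integrableZl measurableT L hu.2).
- by move=> x _; exact: Psi_le Psi0 Psi_nd Psi_lip _ _.
Qed.

Lemma convol_integrable K (f : V -> R) B : jump_kernel K -> measurable_fun setT f ->
  (forall x, 0 <= f x <= B) -> mu.-integrable setT (EFin \o f) ->
  mu.-integrable setT (EFin \o convol K f).
Proof.
move=> hK mf fB fi.
have fB' x : `|f x| <= B by case/andP: (fB x) => ? ?; rewrite ger0_norm.
have cv0 x : 0 <= convol K f x.
  by apply: (kint_ge0 hK) => z; case/andP: (fB (x + z)).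
apply/integrableP; split.
  by apply/measurable_EFinP; exact: (measurable_convol hK mf fB').
rewrite (_ : (\int[mu]_x _)%E = (\int[mu]_x (convol K f x)%:E)%E); last first.
  by apply: eq_integral => x _ /=; rewrite ger0_norm.
rewrite (integral_convol hK mf fB); apply: lte_mul_pinfty => //.
- by rewrite lee_fin (mass_ge0 hK).
- exact: (integrable_lty measurableT fi).
Qed.

Lemma Rintegral_convol K (f : V -> R) B : jump_kernel K -> measurable_fun setT f ->
  (forall x, 0 <= f x <= B) -> mu.-integrable setT (EFin \o f) ->
  \int[mu]_x convol K f x = mass K * \int[mu]_x f x.
Proof.
move=> hK mf fB fi; rewrite /Rintegral (integral_convol hK mf fB) fineM//.
exact: integrable_fin_num fi.
Qed.

Lemma state_step K h u : jump_kernel K -> 0 <= h -> h * mass K * L <= 1 ->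
  state u -> state (step K h u).
Proof.
move=> hK h0 cfl hu; split.
  by apply: (ranged_step Psi0 Psi_nd L0 Psi_lip M0) => //; case: hu.
have Pi := state_Psi_integrable hu; case: hu => hu ui.
have Pb := ranged_Psi_bound Psi0 Psi_nd L0 Psi_lip hu.
have ci := convol_integrable hK (mPsi hu) Pb Pi.
have i1 := integrableB measurableT ci (integrableZl measurableT (mass K) Pi).
have i2 := integrableD measurableT ui (integrableZl measurableT h i1).
by apply: eq_integrable i2 => // x _ /=; rewrite /step /=.
Qed.

(** Jumps move mass without creating any. *)
Lemma step_mass K h u : jump_kernel K -> state u ->
  \int[mu]_x step K h u x = \int[mu]_x u x.
Proof.
move=> hK hu; have Pi := state_Psi_integrable hu; case: hu => hu ui.
have Pb := ranged_Psi_bound Psi0 Psi_nd L0 Psi_lip hu.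
have ci := convol_integrable hK (mPsi hu) Pb Pi.
have Pi' := integrableZl measurableT (mass K) Pi.
have i1 := integrableB measurableT ci Pi'.
rewrite /step RintegralD//; last exact: (integrableZl measurableT h i1).
rewrite RintegralZl// RintegralB// (Rintegral_convol hK (mPsi hu) Pb Pi) RintegralZl//.
by rewrite subrr mulr0 addr0.
Qed.

Lemma L1dist_Psi u v w : state u -> state v ->
  L1dist (Psi \o u) (Psi \o v) w <= L * L1dist u v w.
Proof.
move=> hu hv; have [_ ui] := hu; have [_ vi] := hv.
have uvi := L1dist_integrable w ui vi.
rewrite /L1dist -RintegralZl//; apply: le_Rintegral => //.
- by apply: L1dist_integrable; exact: state_Psi_integrable.
- exact: (integrableZl measurableT L uvi).
- by move=> x _; exact: Psi_lip.
Qed.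

Lemma L1dist_Psi_le u v w : state u -> state v ->
  L1dist (Psi \o u) (Psi \o v) w <= L * (\int[mu]_x u x + \int[mu]_x v x).
Proof.
move=> hu hv; rewrite mulrDr.
rewrite (le_trans (L1dist_le _ (state_Psi_integrable hu) (state_Psi_integrable hv) _ _))//.
- by move=> x; apply: Psi_ge0 Psi0 Psi_nd _ _; exact: state_ge0.
- by move=> x; apply: Psi_ge0 Psi0 Psi_nd _ _; exact: state_ge0.
- by apply: lerD; exact: state_Psi_mass.
Qed.

(** Integrate [step_comparison] along y = x + w. The K1 terms cancel on both
    sides by translation invariance, and the k term becomes a convolution in
    the shift w. *)
Lemma step_L1dist (K1 K2 k : V -> R) h u v w :
  jump_kernel K1 -> jump_kernel K2 -> jump_kernel k ->
  (forall z, K2 z = K1 z + k z) -> 0 <= h -> h * mass K2 * L <= 1 ->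
  state u -> state v ->
  L1dist (step K1 h u) (step K2 h v) w + h * mass k * L1dist (Psi \o u) (Psi \o v) w <=
  L1dist u v w + h * convol k (L1dist (Psi \o u) (Psi \o v)) w.
Proof.
move=> hK1 hK2 hk K2E h0 cfl hu hv.
have mK := massD hK1 hk K2E.
have cfl1 : h * mass K1 * L <= 1.
  rewrite (le_trans _ cfl)// ler_wpM2r// ler_wpM2l// mK lerDl.
  exact: mass_ge0 hk.
have su := state_step hK1 h0 cfl1 hu; have sv := state_step hK2 h0 cfl hv.
have Pu := state_Psi_integrable hu; have Pv := state_Psi_integrable hv.
have [ru ui] := hu; have [rv vi] := hv.
have mPu := mPsi ru; have mPv := mPsi rv.
have bPu := ranged_Psi_bound Psi0 Psi_nd L0 Psi_lip ru.
have bPv := ranged_Psi_bound Psi0 Psi_nd L0 Psi_lip rv.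
set F := L1dist (Psi \o u) (Psi \o v).
have F0 z : 0 <= F z by exact: L1dist_ge0.
have mF : measurable_fun setT F by exact: measurable_L1dist.
have Fb z : `|F z| <= L * (\int[mu]_x u x + \int[mu]_x v x).
  by rewrite ger0_norm//; exact: L1dist_Psi_le.
have diff_bound (a b : R) : 0 <= a <= L * M -> 0 <= b <= L * M -> 0 <= `|a - b| <= L * M.
  move=> /andP[a0 a1] /andP[b0 b1]; rewrite normr_ge0/= ler_norml.
  by apply/andP; split; lra.
suff : L1dist (step K1 h u) (step K2 h v) w + h * mass K2 * F w <=
    L1dist u v w + h * (mass K1 * F w) + h * convol k F w.
  by rewrite mK; lra.
pose G x := `|Psi (u x) - Psi (v (x + w))|.
have mG : measurable_fun setT G.
  apply: measurableT_comp => //; apply: measurable_funB => //.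
  exact: (measurableT_comp mPv (measurable_rV_addr w)).
have bG x : 0 <= G x <= L * M by apply: diff_bound; [exact: bPu|exact: bPv].
have iG : mu.-integrable setT (EFin \o G) by exact: (L1dist_integrable w Pu Pv).
have iG1 := convol_integrable hK1 mG bG iG.
pose H x := kint k (fun z => `|Psi (u x) - Psi (v (x + w + z))|).
have HE x : ((H x)%:E =
    \int[mu]_z (k z * `|Psi (u x) - Psi (v (x + w + z)%R)|)%:E)%E.
  apply: (kintE hk (B := L * M)).
    apply: measurableT_comp => //; apply: measurable_funB => //.
    exact: (measurable_shiftl (x + w) mPv).
  move=> z; rewrite normr_id.
  by have /andP[_] := diff_bound _ _ (bPu x) (bPv (x + w + z)).
have mH2 : measurable_fun setT (fun p : V * V =>
    `|Psi (u p.1) - Psi (v (p.1 + w + p.2))|).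
  apply: measurableT_comp => //; apply: measurable_funB.
    exact: measurableT_comp mPu _.
  have -> : (fun p : V * V => Psi (v (p.1 + w + p.2))) =
      (fun p : V * V => (Psi \o v) (p.1 + p.2)) \o (fun p : V * V => (p.1 + w, p.2)).
    by [].
  apply: measurableT_comp; first exact: measurable_shift2.
  by apply: measurable_fun_pair => //; exact: (measurableT_comp (measurable_rV_addr w) _).
have H0 x : 0 <= H x by apply: (kint_ge0 hk).
have intH : (\int[mu]_x (H x)%:E = (convol k F w)%:E)%E.
  rewrite (kintE hk (measurable_shiftl w mF) (fun z => Fb _)).
  under eq_integral do rewrite HE.
  have [mk k0 _ _] := hk.
  rewrite (fubini_tonelli (fun p : V * V =>
    (k p.2 * `|Psi (u p.1) - Psi (v (p.1 + w + p.2)%R)|)%:E))/=; last 2 first.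
  - by apply/measurable_EFinP/measurable_funM => //; exact: measurableT_comp mk _.
  - by move=> p; rewrite lee_fin mulr_ge0.
  apply: eq_integral => z _.
  rewrite EFinM (L1distE _ Pu Pv) -ge0_integralZl_EFin//.
  - by apply: eq_integral => x _; rewrite -EFinM /= addrA.
  - apply/measurable_EFinP; apply: measurableT_comp => //; apply: measurable_funB => //.
    exact: (measurableT_comp mPv (measurable_rV_addr (w + z))).
have iH : mu.-integrable setT (EFin \o H).
  apply/integrableP; split.
    apply/measurable_EFinP; apply: (measurable_kint hk (B := L * M)
      (g := fun p : V * V => `|Psi (u p.1) - Psi (v (p.1 + w + p.2))|)) => //.
    move=> p; rewrite normr_id.
    by have /andP[_] := diff_bound _ _ (bPu p.1) (bPv (p.1 + w + p.2)).
  under eq_integral do rewrite /= ger0_norm//.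
  by rewrite intH ltry.
have HR : \int[mu]_x H x = convol k F w by rewrite /Rintegral intH.
have GR : \int[mu]_x convol K1 G x = mass K1 * F w by exact: Rintegral_convol mG bG iG.
have iGZ := integrableZl measurableT (h * mass K2) iG.
have iG1Z := integrableZl measurableT h iG1.
have iHZ := integrableZl measurableT h iH.
have iuv := L1dist_integrable w ui vi.
have iss := L1dist_integrable w su.2 sv.2.
have iD := integrableD measurableT iuv iG1Z.
have -> : L1dist (step K1 h u) (step K2 h v) w + h * mass K2 * F w =
    \int[mu]_x (`|step K1 h u x - step K2 h v (x + w)| + h * mass K2 * G x).
  by rewrite (RintegralD measurableT iss iGZ) (RintegralZl _ measurableT iG).
have -> : L1dist u v w + h * (mass K1 * F w) + h * convol k F w =
    \int[mu]_x (`|u x - v (x + w)| + h * convol K1 G x + h * H x).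
  rewrite (RintegralD measurableT iD iHZ) (RintegralD measurableT iuv iG1Z).
  by rewrite (RintegralZl _ measurableT iG1) (RintegralZl _ measurableT iH) HR GR.
apply: le_Rintegral => //.
- exact: (integrableD measurableT iss iGZ).
- exact: (integrableD measurableT iD iHZ).
move=> x _.
have h1 := step_comparison Psi0 Psi_nd L0 Psi_lip hK1 hK2 hk K2E x (x + w) h0 cfl ru rv.
apply: (le_trans h1); rewrite lerD2r lerD2l ler_wpM2l// le_eqVlt.
apply/orP; left; apply/eqP; apply: eq_Rintegral => z _.
by rewrite /G addrAC.
Qed.

End integrated_comparison.

(** * Doubling of variables *)

Section kuznetsov.
Context {R : realType} {d : nat}.
Local Notation V := 'rV[R]_d.
Local Notation mu := (lebesgue_rV R d).
Variables (Psi : R -> R) (L M : R).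
Hypotheses (Psi0 : Psi 0 = 0) (Psi_nd : {homo Psi : x y / x <= y})
  (L0 : 0 <= L) (Psi_lip : forall a b, `|Psi a - Psi b| <= L * `|a - b|)
  (M0 : 0 <= M).

Local Notation step := (@step R d Psi).
Local Notation state := (@state R d M).

Lemma integrable_mul_bounded (B : R) (a b : V -> R) :
  mu.-integrable setT (EFin \o a) -> measurable_fun setT b ->
  (forall x, `|b x| <= B) -> mu.-integrable setT (EFin \o (fun x => a x * b x)).
Proof.
move=> ai mb bB; have ma : measurable_fun setT a.
  by case/integrableP : ai => /measurable_EFinP.
have ai' := integrable_norm ai.
apply: (@le_integrable _ _ _ mu setT measurableT _ (fun x => B%:E * (`|a x|)%:E)%E).
- by apply/measurable_EFinP; exact: measurable_funM.
- move=> x _ /=; rewrite lee_fin normrM (ger0_norm (_ : 0 <= B * _)).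
    by rewrite mulrC ler_wpM2r.
  by rewrite mulr_ge0// (le_trans _ (bB x)).
- exact: (integrableZl measurableT B ai').
Qed.

(** The nonlinear term P produced on the left by monotonicity absorbs the one
    produced on the right by the kernel; only the defect D survives. *)
Lemma cancel_defect (A B P Q m h D : R) : 0 <= h ->
  A + h * m * P <= B + h * Q -> Q <= m * P + D -> A <= B + h * D.
Proof. by move=> h0 key /(ler_wpM2l h0); lra. Qed.

Lemma jump_kernel0 : jump_kernel ((fun=> 0) : V -> R).
Proof. by split=> //; rewrite integral0 ltry. Qed.

(** The case of a zero additional kernel. *)
Lemma step_contraction K h u v w : jump_kernel K -> 0 <= h ->
  h * mass K * L <= 1 -> state u -> state v ->
  L1dist (step K h u) (step K h v) w <= L1dist u v w.
Proof.
move=> hK h0 cfl hu hv.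
have KE z : K z = K z + ((fun=> 0) : V -> R) z by rewrite addr0.
have := step_L1dist Psi0 Psi_nd L0 Psi_lip M0 w hK hK jump_kernel0 KE h0 cfl hu hv.
have -> : mass ((fun=> 0) : V -> R) = 0.
  by rewrite /mass /Rintegral integral0.
rewrite /convol /kint; under eq_Rintegral do rewrite mul0r.
by rewrite /Rintegral integral0/= !mulr0 mul0r !addr0.
Qed.

Lemma state_iter K h n u : jump_kernel K -> 0 <= h -> h * mass K * L <= 1 ->
  state u -> state (iter n (step K h) u).
Proof.
move=> hK h0 cfl hu; elim: n => // n IH.
by rewrite iterS; apply: (state_step Psi0 Psi_nd L0 Psi_lip M0).
Qed.

Lemma iter_mass K h n u : jump_kernel K -> 0 <= h -> h * mass K * L <= 1 ->
  state u -> \int[mu]_x iter n (step K h) u x = \int[mu]_x u x.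
Proof.
move=> hK h0 cfl hu; elim: n => // n IH.
under eq_Rintegral do rewrite iterS.
rewrite (step_mass (M := M) Psi0 Psi_nd L0 Psi_lip h hK)//.
exact: state_iter.
Qed.

Lemma iter_contraction K h n u v w : jump_kernel K -> 0 <= h ->
  h * mass K * L <= 1 -> state u -> state v ->
  L1dist (iter n (step K h) u) (iter n (step K h) v) w <= L1dist u v w.
Proof.
move=> hK h0 cfl hu hv; elim: n => // n IH.
rewrite !iterS (le_trans _ IH)// step_contraction//; exact: state_iter.
Qed.

Variables (K1 K2 k : V -> R).
Hypotheses (hK1 : jump_kernel K1) (hK2 : jump_kernel K2) (hk : jump_kernel k)
  (K2E : forall z, K2 z = K1 z + k z).
Variables (rho g : V -> R).
Hypotheses (mrho : measurable_fun setT rho) (rho01 : forall w, 0 <= rho w <= 1)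
  (irho : mu.-integrable setT (EFin \o rho))
  (ig : mu.-integrable setT (EFin \o g))
  (rhog : forall w, `|convol k rho w - mass k * rho w| <= g w).

(** The functional of the doubling argument: distances to translates, averaged
    over small shifts. *)
Definition smeared (u v : V -> R) : R := \int[mu]_w (rho w * L1dist u v w).

Lemma L1dist_bound u v w : state u -> state v ->
  `|L1dist u v w| <= \int[mu]_x u x + \int[mu]_x v x.
Proof.
move=> hu hv; rewrite ger0_norm ?L1dist_ge0//; apply: L1dist_le; first exact: hu.2.
- exact: hv.2.
- exact: state_ge0 hu.
- exact: state_ge0 hv.
Qed.

Lemma measurable_state u : state u -> measurable_fun setT u.
Proof. by case=> [[]]. Qed.

Lemma smeared_integrable u v : state u -> state v ->
  mu.-integrable setT (EFin \o (fun w => rho w * L1dist u v w)).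
Proof.
move=> hu hv; apply: (integrable_mul_bounded irho).
  by apply: measurable_L1dist; exact: measurable_state.
by move=> w; exact: L1dist_bound.
Qed.

(** Multiply [step_L1dist] by rho and integrate in w. By symmetry the additional
    kernel k is moved from the distance, of which nothing is known, to rho,
    where it acts up to g as multiplication by its mass; [cancel_defect]
    concludes. *)
Lemma kuznetsov_step h u v C : 0 <= h -> h * mass K2 * L <= 1 ->
  state u -> state v -> L * (\int[mu]_x u x + \int[mu]_x v x) <= C ->
  smeared (step K1 h u) (step K2 h v) <=
  smeared u v + h * (C * \int[mu]_w g w).
Proof.
move=> h0 cfl hu hv HC.
have mK := massD hK1 hk K2E.
have cfl1 : h * mass K1 * L <= 1.
  rewrite (le_trans _ cfl)// ler_wpM2r// ler_wpM2l// mK lerDl.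
  exact: mass_ge0 hk.
have su := state_step Psi0 Psi_nd L0 Psi_lip M0 hK1 h0 cfl1 hu.
have sv := state_step Psi0 Psi_nd L0 Psi_lip M0 hK2 h0 cfl hv.
have Pu := state_Psi_integrable Psi0 Psi_nd L0 Psi_lip hu.
have Pv := state_Psi_integrable Psi0 Psi_nd L0 Psi_lip hv.
have mPu := ranged_Psi Psi_nd hu.1; have mPv := ranged_Psi Psi_nd hv.1.
set F := L1dist (Psi \o u) (Psi \o v).
have mF : measurable_fun setT F by exact: measurable_L1dist.
have F0 w : 0 <= F w by exact: L1dist_ge0.
have FC w : F w <= C.
  by apply: le_trans HC; exact: (L1dist_Psi_le Psi0 Psi_nd L0 Psi_lip w hu hv).
have FC' w : `|F w| <= C by rewrite ger0_norm.
have iF := integrable_mul_bounded irho mF FC'.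
have rho0 w : 0 <= rho w by case/andP: (rho01 w).
have rho1 w : `|rho w| <= 1 by case/andP: (rho01 w) => ? ?; rewrite ger0_norm.
have icF : mu.-integrable setT (EFin \o (fun w => rho w * convol k F w)).
  apply: (@integrable_mul_bounded (mass k * C)) => //.
    exact: (measurable_convol hk mF FC').
  move=> w; rewrite ger0_norm; last by apply: (kint_ge0 hk) => z; exact: F0.
  rewrite -(kint_cst hk); apply: (le_kint hk (B := C)) => //.
  - exact: measurable_shiftl.
  - by move=> _; rewrite ger0_norm// (le_trans (F0 0)).
have adj : \int[mu]_w (rho w * convol k F w) = \int[mu]_w (convol k rho w * F w).
  congr fine; apply: (convol_adjoint hk mrho rho01 mF (B := C)) => w.
  by rewrite F0 FC.
have icr : mu.-integrable setT (EFin \o convol k rho).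
  exact: (convol_integrable hk mrho rho01 irho).
have icF2 : mu.-integrable setT (EFin \o (fun w => convol k rho w * F w)).
  exact: integrable_mul_bounded icr mF FC'.
have i1 := smeared_integrable su sv.
have i2 := smeared_integrable hu hv.
have iFZ := integrableZl measurableT (h * mass k) iF.
have icFZ := integrableZl measurableT h icF.
have key : smeared (step K1 h u) (step K2 h v)
     + h * mass k * \int[mu]_w (rho w * F w) <=
    smeared u v + h * \int[mu]_w (rho w * convol k F w).
  rewrite -(RintegralZl _ measurableT iF) -(RintegralZl _ measurableT icF).
  rewrite /smeared -(RintegralD measurableT i1 iFZ) -(RintegralD measurableT i2 icFZ).
  apply: (le_Rintegral measurableT (integrableD measurableT i1 iFZ)
    (integrableD measurableT i2 icFZ)) => w _.
  have := step_L1dist Psi0 Psi_nd L0 Psi_lip M0 w hK1 hK2 hk K2E h0 cfl hu hv.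
  move=> /(ler_wpM2l (rho0 w)); rewrite -/F; lra.
have ub : \int[mu]_w (convol k rho w * F w) <=
    mass k * \int[mu]_w (rho w * F w) + C * \int[mu]_w g w.
  have iFk := integrableZl measurableT (mass k) iF.
  have igC := integrableZl measurableT C ig.
  rewrite -(RintegralZl _ measurableT iF) -(RintegralZl _ measurableT ig).
  rewrite -(RintegralD measurableT iFk igC).
  apply: (le_Rintegral measurableT icF2 (integrableD measurableT iFk igC)) => w _.
  have := rhog w; rewrite ler_norml => /andP[_ h1].
  have g0 : 0 <= g w by rewrite (le_trans _ (rhog w)).
  have h2 : convol k rho w * F w <= (mass k * rho w + g w) * F w.
    by rewrite ler_wpM2r// -lerBlDl.
  rewrite (le_trans h2)// mulrDl mulrA lerD2l mulrC ler_wpM2r//.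
move: key; rewrite adj => key.
exact: (cancel_defect h0 key ub).
Qed.

Lemma kuznetsov_iter h u n : 0 <= h -> h * mass K2 * L <= 1 -> state u ->
  smeared (iter n (step K1 h) u) (iter n (step K2 h) u) <=
  smeared u u + (n%:R * h) * (2 * L * \int[mu]_x u x * \int[mu]_w g w).
Proof.
move=> h0 cfl hu.
have mK := massD hK1 hk K2E.
have cfl1 : h * mass K1 * L <= 1.
  rewrite (le_trans _ cfl)// ler_wpM2r// ler_wpM2l// mK lerDl.
  exact: mass_ge0 hk.
elim: n => [|n IH]; first by rewrite !mul0r addr0.
rewrite !iterS.
have s1 := state_iter n hK1 h0 cfl1 hu; have s2 := state_iter n hK2 h0 cfl hu.
have HC : L * (\int[mu]_x iter n (step K1 h) u x + \int[mu]_x iter n (step K2 h) u x)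
    <= 2 * L * \int[mu]_x u x.
  by rewrite !iter_mass// le_eqVlt; apply/orP; left; apply/eqP; ring.
rewrite (le_trans (kuznetsov_step h0 cfl s1 s2 HC))//.
by rewrite -(natr1 n) (mulrDl n%:R) mul1r (mulrDl (n%:R * h)) addrA lerD2r.
Qed.

(** Recover the unshifted distance from the smeared one by the triangle
    inequality, translating the second solution onto itself: the contraction
    property bounds that term by the modulus of continuity of the datum. *)
Lemma same_grid_distance h u n (omega : R) : 0 <= h -> h * mass K2 * L <= 1 ->
  state u -> (forall w, rho w != 0 -> L1dist u u w <= omega) ->
  L1dist (iter n (step K1 h) u) (iter n (step K2 h) u) 0 * \int[mu]_w rho w <=
  2 * omega * \int[mu]_w rho w
  + (n%:R * h) * (2 * L * \int[mu]_x u x * \int[mu]_w g w).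
Proof.
move=> h0 cfl hu homega.
have mK := massD hK1 hk K2E.
have cfl1 : h * mass K1 * L <= 1.
  rewrite (le_trans _ cfl)// ler_wpM2r// ler_wpM2l// mK lerDl.
  exact: mass_ge0 hk.
have s1 := state_iter n hK1 h0 cfl1 hu; have s2 := state_iter n hK2 h0 cfl hu.
have rho0 w : 0 <= rho w by case/andP: (rho01 w).
have uu : smeared u u <= omega * \int[mu]_w rho w.
  rewrite -(RintegralZl _ measurableT irho); apply: le_Rintegral => //.
  - exact: smeared_integrable.
  - exact: (integrableZl measurableT omega irho).
  move=> w _; have [->|rw0] := eqVneq (rho w) 0; first by rewrite mul0r mulr0.
  by rewrite [leRHS]mulrC ler_wpM2l// homega.
have H := kuznetsov_iter n h0 cfl hu.
set a := iter n (step K1 h) u in s1 H *; set b := iter n (step K2 h) u in s2 H *.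
have bb : smeared b b <= smeared u u.
  apply: le_Rintegral => //; try exact: smeared_integrable.
  by move=> w _; rewrite ler_wpM2l//; exact: iter_contraction.
have ab : L1dist a b 0 * \int[mu]_w rho w <= smeared a b + smeared b b.
  have i1 := smeared_integrable s1 s2; have i2 := smeared_integrable s2 s2.
  rewrite -(RintegralZl _ measurableT irho) /smeared -(RintegralD measurableT i1 i2).
  apply: (le_Rintegral measurableT (integrableZl measurableT _ irho)
    (integrableD measurableT i1 i2)) => w _; rewrite -mulrDr mulrC ler_wpM2l//.
  by apply: L1dist_triangle_shift; [exact: s1.2|exact: s2.2].
rewrite (le_trans ab)// (le_trans (lerD H bb))// addrAC lerD2r.
have -> : 2 * omega * \int[mu]_w rho w =
  omega * \int[mu]_w rho w + omega * \int[mu]_w rho w by ring.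
exact: (lerD uu uu).
Qed.

End kuznetsov.

(** * Refinement of the time step *)

Section time_refinement.
Context {R : realType} {d : nat}.
Local Notation V := 'rV[R]_d.
Local Notation mu := (lebesgue_rV R d).
Variables (Psi : R -> R) (L M : R).
Hypotheses (Psi0 : Psi 0 = 0) (Psi_nd : {homo Psi : x y / x <= y})
  (L0 : 0 <= L) (Psi_lip : forall a b, `|Psi a - Psi b| <= L * `|a - b|)
  (M0 : 0 <= M).

Local Notation step := (@step R d Psi).
Local Notation state := (@state R d M).

Variable K : V -> R.
Hypothesis hK : jump_kernel K.

Let B := 2 * mass K * L.

(** The right hand side of the evolution, a Lipschitz map on L1. *)
Definition jump (u : V -> R) (x : V) : R := convol K (Psi \o u) x - mass K * Psi (u x).

Lemma jump_integrable u : state u -> mu.-integrable setT (EFin \o jump u).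
Proof.
move=> hu; have Pi := state_Psi_integrable Psi0 Psi_nd L0 Psi_lip hu.
have mPu := ranged_Psi Psi_nd hu.1.
have bPu := ranged_Psi_bound Psi0 Psi_nd L0 Psi_lip hu.1.
exact: (integrableB measurableT (convol_integrable hK mPu bPu Pi)
  (integrableZl measurableT (mass K) Pi)).
Qed.

Lemma jump_dist u v : state u -> state v ->
  L1dist (jump u) (jump v) 0 <= B * L1dist u v 0.
Proof.
move=> hu hv.
have Pu := state_Psi_integrable Psi0 Psi_nd L0 Psi_lip hu.
have Pv := state_Psi_integrable Psi0 Psi_nd L0 Psi_lip hv.
have mPu := ranged_Psi Psi_nd hu.1; have mPv := ranged_Psi Psi_nd hv.1.
have bPu := ranged_Psi_bound Psi0 Psi_nd L0 Psi_lip hu.1.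
have bPv := ranged_Psi_bound Psi0 Psi_nd L0 Psi_lip hv.1.
have nPu := ranged_Psi_norm Psi0 Psi_nd L0 Psi_lip hu.1.
have nPv := ranged_Psi_norm Psi0 Psi_nd L0 Psi_lip hv.1.
pose G x := `|Psi (u x) - Psi (v x)|.
have mG : measurable_fun setT G.
  by apply: measurableT_comp => //; exact: measurable_funB.
have bG x : 0 <= G x <= L * M.
  rewrite normr_ge0/= ler_norml; move: (bPu x) (bPv x) => /= /andP[a0 a1] /andP[b0 b1].
  by apply/andP; split; lra.
have GE : \int[mu]_x G x = L1dist (Psi \o u) (Psi \o v) 0.
  by apply: eq_Rintegral => x _; rewrite addr0.
have iG : mu.-integrable setT (EFin \o G).
  apply: eq_integrable (L1dist_integrable 0 Pu Pv) => // x _ /=.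
  by rewrite addr0.
have icG := convol_integrable hK mG bG iG.
have iGZ := integrableZl measurableT (mass K) iG.
have le1 : L1dist (jump u) (jump v) 0 <= \int[mu]_x (convol K G x + mass K * G x).
  apply: (le_Rintegral measurableT
    (L1dist_integrable 0 (jump_integrable hu) (jump_integrable hv))
    (integrableD measurableT icG iGZ)) => x _.
  rewrite addr0 /jump.
  have -> : convol K (Psi \o u) x - mass K * Psi (u x) -
      (convol K (Psi \o v) x - mass K * Psi (v x)) =
    (convol K (Psi \o u) x - convol K (Psi \o v) x) - mass K * (Psi (u x) - Psi (v x)).
    by ring.
  rewrite (le_trans (ler_normB _ _))// lerD//; last first.
    by rewrite normrM (ger0_norm (mass_ge0 hK)).
  have msu := measurable_shiftl x mPu; have msv := measurable_shiftl x mPv.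
  rewrite /convol -(kintB hK msu (fun z => nPu (x + z)) msv (fun z => nPv (x + z))).
  apply: (normr_kint hK (B := L * M)); first exact: measurable_funB.
  by move=> z; have /andP[] := bG (x + z).
rewrite (le_trans le1)// (RintegralD measurableT icG iGZ).
rewrite (Rintegral_convol hK mG bG iG) (RintegralZl _ measurableT iG) GE /B.
have -> : mass K * L1dist (Psi \o u) (Psi \o v) 0 + mass K * L1dist (Psi \o u) (Psi \o v) 0
  = 2 * mass K * L1dist (Psi \o u) (Psi \o v) 0 by ring.
rewrite -[leRHS]mulrA; apply: ler_wpM2l; first by rewrite mulr_ge0// (mass_ge0 hK).
exact: (L1dist_Psi Psi0 Psi_nd L0 Psi_lip 0 hu hv).
Qed.

Lemma state0 : state (fun=> 0).
Proof.
split; first by split=> // x; rewrite lexx.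
by apply: eq_integrable (integrable0 mu setT).
Qed.

Lemma Rintegral_L1dist0 u : state u -> L1dist u (fun=> 0) 0 = \int[mu]_x u x.
Proof.
move=> hu; apply: eq_Rintegral => x _.
by rewrite subr0 ger0_norm// (state_ge0 hu).
Qed.

(** The step vanishes at the zero state, so this is the Lipschitz bound of
    [jump_dist] against 0. *)
Lemma step_move h u : 0 <= h -> state u ->
  L1dist (step K h u) u 0 <= h * B * \int[mu]_x u x.
Proof.
move=> h0 hu.
have ji := integrable_norm (jump_integrable hu).
have -> : L1dist (step K h u) u 0 = h * L1dist (jump u) (jump (fun=> 0)) 0.
  have -> : L1dist (jump u) (jump (fun=> 0)) 0 = \int[mu]_x `|jump u x|.
    apply: eq_Rintegral => x _; congr `|_|.
    rewrite {2}/jump /convol /= Psi0 mulr0 subr0.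
    by rewrite (kint_cst hK) mulr0 subr0.
  rewrite -(RintegralZl _ measurableT ji); apply: eq_Rintegral => x _.
  by rewrite /step addr0 addrAC subrr add0r normrM (ger0_norm h0).
rewrite -[leRHS]mulrA; apply: ler_wpM2l => //.
by rewrite -(Rintegral_L1dist0 hu) jump_dist//; exact: state0.
Qed.

Lemma iter_move h u j : 0 <= h -> h * mass K * L <= 1 -> state u ->
  L1dist (iter j (step K h) u) u 0 <= j%:R * (h * B * \int[mu]_x u x).
Proof.
move=> h0 cfl hu; elim: j => [|j IH].
  rewrite mul0r /L1dist/=; under eq_Rintegral do rewrite addr0 subrr normr0.
  by rewrite /Rintegral integral0.
have sj := state_iter Psi0 Psi_nd L0 Psi_lip M0 j hK h0 cfl hu.
have sj1 := state_iter Psi0 Psi_nd L0 Psi_lip M0 j.+1 hK h0 cfl hu.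
rewrite (le_trans (L1dist_triangle 0 sj1.2 sj.2 hu.2))//.
rewrite -(natr1 j) (mulrDl j%:R) mul1r addrC lerD// iterS.
rewrite (le_trans (step_move h0 sj))//.
by rewrite (iter_mass Psi0 Psi_nd L0 Psi_lip M0).
Qed.

(** N small steps differ from a large one because the right hand side is
    evaluated at intermediate states; these are close to u by [iter_move],
    hence an error quadratic in the length of the step. *)
Lemma refine_one h u N : 0 <= h -> N%:R * h * mass K * L <= 1 -> state u ->
  L1dist (iter N (step K h) u) (step K (N%:R * h) u) 0 <=
  (N%:R * h * B) ^+ 2 * \int[mu]_x u x.
Proof.
case: N => [|N] h0 cflN hu.
  rewrite /= !mul0r expr0n/= mul0r /L1dist.
  under eq_Rintegral do rewrite /step mul0r !addr0 subrr normr0.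
  by rewrite /Rintegral integral0.
have I0 : 0 <= \int[mu]_x u x by apply: Rintegral_ge0 => x _; exact: state_ge0 hu x.
have mK0 := mass_ge0 hK.
have B0 : 0 <= B by rewrite !mulr_ge0.
have cfl j : (j <= N.+1)%N -> j%:R * h * mass K * L <= 1.
  move=> jN; rewrite (le_trans _ cflN)// !ler_wpM2r// ler_nat//.
have cfl1 : h * mass K * L <= 1 by rewrite -[h]mul1r; exact: (cfl 1%N).
have hb : 0 <= h * B by rewrite mulr_ge0.
suff H j : (j <= N.+1)%N -> L1dist (iter j (step K h) u) (step K (j%:R * h) u) 0 <=
    j%:R * (N.+1%:R * (h * B) ^+ 2 * \int[mu]_x u x).
  rewrite (le_trans (H _ (leqnn _)))// le_eqVlt; apply/orP; left; apply/eqP; ring.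
elim: j => [_|j IH jN].
  rewrite /= !mul0r /L1dist; under eq_Rintegral do rewrite /step mul0r !addr0 subrr normr0.
  by rewrite /Rintegral integral0.
have sj := state_iter Psi0 Psi_nd L0 Psi_lip M0 j hK h0 cfl1 hu.
have sj1 := state_iter Psi0 Psi_nd L0 Psi_lip M0 j.+1 hK h0 cfl1 hu.
have jh0 i : 0 <= i%:R * h by rewrite mulr_ge0.
have st := state_step Psi0 Psi_nd L0 Psi_lip M0 hK (jh0 j) (cfl j (ltnW jN)) hu.
have st1 := state_step Psi0 Psi_nd L0 Psi_lip M0 hK (jh0 j.+1) (cfl j.+1 jN) hu.
have d1 := L1dist_integrable 0 sj.2 st.2.
have d2 := L1dist_integrable 0 (jump_integrable sj) (jump_integrable hu).
have d2Z := integrableZl measurableT h d2.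
have le1 : L1dist (iter j.+1 (step K h) u) (step K (j.+1%:R * h) u) 0 <=
    L1dist (iter j (step K h) u) (step K (j%:R * h) u) 0
    + h * L1dist (jump (iter j (step K h) u)) (jump u) 0.
  rewrite -(RintegralZl _ measurableT d2) -(RintegralD measurableT d1 d2Z).
  apply: (le_Rintegral measurableT (L1dist_integrable 0 sj1.2 st1.2)
    (integrableD measurableT d1 d2Z)) => x _.
  rewrite !addr0 iterS.
  set a := iter j _ u.
  rewrite /step -!/(jump _ x) -(natr1 j) (mulrDl j%:R) mul1r.
  have -> : a x + h * jump a x - (u x + (j%:R * h + h) * jump u x) =
    (a x - (u x + j%:R * h * jump u x)) + h * (jump a x - jump u x) by ring.
  by rewrite (le_trans (ler_normD _ _))// normrM (ger0_norm h0).
rewrite (le_trans le1)// -(natr1 j) (mulrDl j%:R) mul1r lerD ?IH// 1?ltnW//.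
have h1 : h * L1dist (jump (iter j (step K h) u)) (jump u) 0 <=
    h * (B * (j%:R * (h * B * \int[mu]_x u x))).
  by rewrite ler_wpM2l// (le_trans (jump_dist sj hu))// ler_wpM2l// iter_move.
rewrite (le_trans h1)//.
have -> : h * (B * (j%:R * (h * B * \int[mu]_x u x))) =
  j%:R * (h * B) ^+ 2 * \int[mu]_x u x by ring.
by rewrite ler_wpM2r// ler_wpM2r ?exprn_ge0// ler_nat ltnW.
Qed.

(** The errors of [refine_one] add up because the scheme is a contraction. *)
Lemma refine_iter h u N n : 0 <= h -> N%:R * h * mass K * L <= 1 -> (0 < N)%N ->
  state u ->
  L1dist (iter (n * N) (step K h) u) (iter n (step K (N%:R * h)) u) 0 <=
  n%:R * ((N%:R * h * B) ^+ 2 * \int[mu]_x u x).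
Proof.
move=> h0 cflN N0 hu.
have Nh0 : 0 <= N%:R * h by rewrite mulr_ge0.
have mK0 := mass_ge0 hK.
have cfl1 : h * mass K * L <= 1.
  by rewrite (le_trans _ cflN)// !ler_wpM2r// -[leLHS]mul1r ler_wpM2r// ler1n.
elim: n => [|n IH].
  rewrite mul0r /L1dist/=; under eq_Rintegral do rewrite addr0 subrr normr0.
  by rewrite /Rintegral integral0.
rewrite mulSn iterD iterS.
have sa := state_iter Psi0 Psi_nd L0 Psi_lip M0 (n * N) hK h0 cfl1 hu.
have sb := state_iter Psi0 Psi_nd L0 Psi_lip M0 n hK Nh0 cflN hu.
have mb := iter_mass Psi0 Psi_nd L0 Psi_lip M0 n hK Nh0 cflN hu.
set a := iter (n * N) _ u in IH sa *; set b := iter n _ u in IH sb mb *.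
have sNa := state_iter Psi0 Psi_nd L0 Psi_lip M0 N hK h0 cfl1 sa.
have sNb := state_iter Psi0 Psi_nd L0 Psi_lip M0 N hK h0 cfl1 sb.
have s1b := state_step Psi0 Psi_nd L0 Psi_lip M0 hK Nh0 cflN sb.
rewrite (le_trans (L1dist_triangle 0 sNa.2 sNb.2 s1b.2))//.
rewrite -(natr1 n) (mulrDl n%:R) mul1r lerD//.
- by rewrite (le_trans _ IH)//; exact: (iter_contraction Psi0 Psi_nd L0 Psi_lip M0).
- by rewrite (le_trans (refine_one h0 cflN sb))// mb.
Qed.

(** The remaining r < N small steps, less than one large step, account for the
    last term. *)
Lemma refine_time h u N n r : 0 <= h -> N%:R * h * mass K * L <= 1 -> (r < N)%N ->
  state u ->
  L1dist (iter (n * N + r) (step K h) u) (iter n (step K (N%:R * h)) u) 0 <=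
  (n%:R * (N%:R * h * B) ^+ 2 + N%:R * h * B) * \int[mu]_x u x.
Proof.
move=> h0 cflN rN hu.
have N0 : (0 < N)%N by exact: leq_ltn_trans rN.
have Nh0 : 0 <= N%:R * h by rewrite mulr_ge0.
have mK0 := mass_ge0 hK.
have I0 : 0 <= \int[mu]_x u x by apply: Rintegral_ge0 => x _; exact: state_ge0 hu x.
have B0 : 0 <= B by rewrite !mulr_ge0.
have cfl1 : h * mass K * L <= 1.
  by rewrite (le_trans _ cflN)// !ler_wpM2r// -[leLHS]mul1r ler_wpM2r// ler1n.
have sa := state_iter Psi0 Psi_nd L0 Psi_lip M0 (n * N) hK h0 cfl1 hu.
have ma := iter_mass Psi0 Psi_nd L0 Psi_lip M0 (n * N) hK h0 cfl1 hu.
have sb := state_iter Psi0 Psi_nd L0 Psi_lip M0 n hK Nh0 cflN hu.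
have sra := state_iter Psi0 Psi_nd L0 Psi_lip M0 r hK h0 cfl1 sa.
have H1 := refine_iter n h0 cflN N0 hu.
rewrite addnC iterD (le_trans (L1dist_triangle 0 sra.2 sa.2 sb.2))//.
rewrite addrC mulrDl lerD//; first by rewrite -mulrA.
rewrite (le_trans (iter_move r h0 cfl1 sa))// ma !mulrA.
by rewrite !ler_wpM2r// ler_nat ltnW.
Qed.

End time_refinement.

(** * Continuity of translations in L1 *)

Section translation_continuity.
Context {R : realType}.
Local Notation leb := (@lebesgue_measure R).

Lemma ge0_integral_leb_shift (c : R) (f : R -> \bar R) :
  measurable_fun setT f -> (forall r, 0 <= f r)%E ->
  (\int[leb]_r f (r + c)%R = \int[leb]_r f r)%E.
Proof.
move=> mf f0; have e1 : ((1 : R) == 1) || ((1 : R) == -1) by rewrite eqxx.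
rewrite -(ge0_integral_lebesgue_affine c e1 mf f0).
by apply: eq_integral => x _; rewrite mul1r.
Qed.

(** A segment is compact. *)
Lemma continuous_segment_bounded (g : R -> R) (a b : R) : continuous g ->
  exists C, forall x, a <= x <= b -> `|g x| <= C.
Proof.
move=> cg; have [ab|ab] := leP a b; last first.
  by exists 0 => x /andP[/le_trans h /h]; rewrite leNgt ab.
have cng : {within `[a, b], continuous (fun x => `|g x|)}.
  apply: continuous_subspaceT => x; apply: (@continuous_comp _ _ _ g Num.norm).
    exact: cg.
  exact: norm_continuous.
have [c _ cmax] := EVT_max ab cng.
by exists (`|g c|) => x xab; apply: cmax; rewrite in_itv.
Qed.

Lemma cvge0_le (F : nat -> \bar R) : (forall k, 0 <= F k)%E ->
  (forall e : R, 0 < e -> \forall k \near \oo, (F k <= e%:E)%E) ->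
  (F @ \oo --> 0)%E.
Proof.
move=> F0 Fe; have Ffin e k : (F k <= e%:E)%E -> F k \is a fin_num.
  by move=> Fk; rewrite ge0_fin_numE// (le_lt_trans Fk)// ltry.
apply/fine_cvgP; split.
  by apply: filterS (Fe 1 ltr01) => k; exact: Ffin.
apply/cvgrPdist_le => e e0; apply: filterS (Fe e e0) => k Fk /=.
have Fk' := Ffin _ _ Fk.
by rewrite sub0r normrN ger0_norm ?fine_ge0// -lee_fin fineK.
Qed.

(** Approximate f in L1 by a continuous function, for which bounded
    convergence applies. *)
Lemma translation_continuity_1d (f : R -> R) (B r : R) (t : R^nat) :
  measurable_fun setT f -> (forall a, `|f a| <= B) ->
  (forall a, r < `|a| -> f a = 0) -> 0 <= r ->
  t @ \oo --> (0 : R) ->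
  (\int[leb]_a (`|f (a + t k) - f a|)%:E @[k --> \oo] --> 0)%E.
Proof.
move=> mf fB fr r0 t0.
have B0 : 0 <= B by rewrite (le_trans _ (fB 0)).
pose E2 := `[- (r + 2), r + 2]%classic; pose E1 := `[- (r + 1), r + 1]%classic.
have mE2 : measurable E2 by exact: measurable_itv.
have mE1 : measurable E1 by exact: measurable_itv.
have fin (c : R) : (leb `[(- c)%R, c]%classic < +oo)%E.
  rewrite lebesgue_measure_itv/=; case: ifP => _; last exact: ltry.
  by rewrite -EFinB ltry.
have fi : leb.-integrable E2 (EFin \o f).
  apply: measurable_bounded_integrable => //; first exact: fin.
    exact: measurable_funTS.
  exists B; split; first exact: num_real.
  by move=> x Bx a _ /=; rewrite (le_trans (fB a))// ltW.
have [g [cg gi gf]] := approximation_continuous_integrable mE2 (fin _) fi.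
pose D n a := `|f a - g n a| * \1_E2 a.
have mg n : measurable_fun setT (g n) by exact: continuous_measurable_fun.
have mD n : measurable_fun setT (D n).
  apply: measurable_funM; last exact: measurable_indic.
  by apply: measurableT_comp => //; exact: measurable_funB.
have D0 n a : 0 <= D n a by rewrite mulr_ge0.
pose t' k := if `|t k| <= 1 then t k else 0.
have t'1 k : `|t' k| <= 1 by rewrite /t'; case: ifP => //; rewrite normr0.
have tt' : \forall k \near \oo, t' k = t k.
  move/cvgr0Pnorm_le : t0 => /(_ 1 ltr01); apply: filterS => k tk.
  by rewrite /t' tk.
have t'0 : t' @ \oo --> (0 : R).
  apply: cvg_trans t0; apply: near_eq_cvg.
  by apply: filterS tt' => k ->.
pose G n k a := `|g n (a + t' k) - g n a| * \1_E1 a.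
have mG n k : measurable_fun setT (G n k).
  apply: measurable_funM; last exact: measurable_indic.
  apply: measurableT_comp => //; apply: measurable_funB => //.
  by apply: measurableT_comp => //; exact: measurable_funD.
have G0 n k a : 0 <= G n k a by rewrite mulr_ge0.
have shift_in a u : `|u| <= 1 -> E1 a -> E2 (a + u).
  rewrite /E1 /E2 /= !in_itv/= -!ler_norml => u1 a1.
  by rewrite (le_trans (ler_normD _ _))// (le_trans (lerD a1 u1))// -addrA.
have E12 a : E1 a -> E2 a.
  by move=> h; rewrite -(addr0 a); apply: shift_in => //; rewrite normr0.
have pointwise n k a : `|f (a + t' k) - f a| <= D n (a + t' k) + D n a + G n k a.
  have [aE|aE] := pselect (E1 a); last first.
    have r1 : r + 1 < `|a|.
      by rewrite ltNge ler_norml; apply/negP => h; apply: aE; rewrite /E1/= in_itv.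
    rewrite !fr ?subrr ?normr0 ?addr_ge0//; first by rewrite (lt_trans _ r1)// ltrDl.
    rewrite -(ltrD2r 1) (lt_le_trans r1)//.
    rewrite -[X in `|X|](addrK (t' k) a) (le_trans (ler_normB _ _))//.
    by rewrite lerD2l.
  rewrite /D /G !indicE !mem_set ?mulr1//; last by apply: shift_in.
    have -> : f (a + t' k) - f a = (f (a + t' k) - g n (a + t' k)) - (f a - g n a)
       + (g n (a + t' k) - g n a) by ring.
    by rewrite (le_trans (ler_normD _ _))// lerD2r (le_trans (ler_normB _ _)).
  exact: E12.
have intG n : (\int[leb]_a (G n k a)%:E @[k --> \oo] --> 0)%E.
  have [C gC] := continuous_segment_bounded (- (r + 2)) (r + 2) (cg n).
  have C0 : 0 <= C by rewrite (le_trans _ (gC 0 _))//; apply/andP; split; lra.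
  have := @dominated_convergence _ _ _ leb setT measurableT
    (fun k a => (G n k a)%:E) (fun=> 0%E) (fun a => ((C + C) * \1_E1 a)%:E).
  rewrite integral0; case=> //.
  - by move=> k; apply/measurable_EFinP; exact: mG.
  - apply: aeW => a _; apply: cvg_EFin; first exact: nearW.
    rewrite [X in _ --> X](_ : _ = `|g n (a + 0) - g n a| * \1_E1 a); last first.
      by rewrite addr0 subrr normr0 mul0r.
    apply: cvgM; last exact: cvg_cst.
    apply: cvg_norm; apply: cvgB; last exact: cvg_cst.
    apply: continuous_cvg; first exact: cg.
    by apply: cvgD => //; exact: cvg_cst.
  - have iE1 := @integrable_indic_itv R (- (r + 1)) (r + 1) true false.
    exact: (integrableZl measurableT (C + C) iE1).
  - apply: aeW => a k _; rewrite lee_fin ger0_norm// /G indicE.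
    have [aE|aE] := pselect (E1 a); last by rewrite memNset// !mulr0.
    rewrite mem_set// !mulr1 (le_trans (ler_normB _ _))// lerD//; apply: gC.
      by have := shift_in a _ (t'1 k) aE; rewrite /E2/= in_itv.
    by have := E12 a aE; rewrite /E2/= in_itv.
apply: cvge0_le => [k|e e0]; first by apply: integral_ge0 => a _; rewrite lee_fin.
have e3 : 0 < e / 3 by rewrite divr_gt0.
have [n intD] : exists n, (\int[leb]_a (D n a)%:E <= (e / 3)%:E)%E.
  move/fine_cvgP : gf => [gfin /cvgr0Pnorm_le/(_ _ e3) gle].
  have [n [nfin nle]] : exists n,
      (\int[leb]_(z in E2) `|(f z - g n z)%:E|)%E \is a fin_num /\
      `|fine (\int[leb]_(z in E2) `|(f z - g n z)%:E|)%E| <= e / 3.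
    near \oo => n; exists n; split; near: n; [exact: gfin|exact: gle].
  exists n.
  have DE : (\int[leb]_a (D n a)%:E = \int[leb]_(z in E2) `|(f z - g n z)%:E|)%E.
    rewrite [RHS]integral_mkcond; apply: eq_integral => a _.
    by rewrite /D patchE indicE; case: ifP => _; rewrite ?mulr1 ?mulr0.
  by rewrite DE -(fineK nfin) lee_fin (le_trans (ler_norm _)).
have /fine_cvgP[Gfin /cvgr0Pnorm_le/(_ _ e3) Gle] := intG n.
near=> k.
have tk : t' k = t k by near: k.
rewrite -tk.
have mt : measurable_fun setT (fun a : R => a + t' k) by exact: measurable_funD.
have mS : measurable_fun setT (fun a : R => D n (a + t' k) + D n a + G n k a).
  apply: measurable_funD; last exact: mG.
  by apply: measurable_funD; [exact: (measurableT_comp (mD n) mt)|exact: mD].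
apply: (@le_trans _ _ (\int[leb]_a (D n (a + t' k) + D n a + G n k a)%:E)%E).
  apply: ge0_le_integral => //.
  - apply/measurable_EFinP; apply: measurableT_comp => //; apply: measurable_funB => //.
    exact: (measurableT_comp mf mt).
  - by apply/measurable_EFinP; exact: mS.
  - by move=> a _; rewrite lee_fin pointwise.
have mDt : measurable_fun setT (fun a : R => (D n (a + t' k))%:E).
  by apply/measurable_EFinP; exact: (measurableT_comp (mD n) mt).
have mDe : measurable_fun setT (fun a : R => (D n a)%:E) by exact/measurable_EFinP.
have mGe : measurable_fun setT (fun a : R => (G n k a)%:E).
  by apply/measurable_EFinP; exact: mG.
have mDD : measurable_fun setT (fun a : R => (D n (a + t' k) + D n a)%:E).
  by apply/measurable_EFinP; apply: measurable_funD;
    [exact: (measurableT_comp (mD n) mt)|exact: mD].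
have De0 u : (forall x : R, setT x -> 0 <= (D n (x + u))%:E)%E.
  by move=> x _; rewrite lee_fin.
have De0' : (forall x : R, setT x -> 0 <= (D n x)%:E)%E.
  by move=> x _; rewrite lee_fin.
have DDe0 : (forall x : R, setT x -> 0 <= (D n (x + t' k) + D n x)%:E)%E.
  by move=> x _; rewrite lee_fin addr_ge0.
have Ge0 : (forall x : R, setT x -> 0 <= (G n k x)%:E)%E.
  by move=> x _; rewrite lee_fin.
rewrite (ge0_integralD leb measurableT DDe0 mDD Ge0 mGe).
rewrite (ge0_integralD leb measurableT (De0 (t' k)) mDt De0' mDe).
rewrite (ge0_integral_leb_shift (t' k) mDe); last by move=> x; rewrite lee_fin.
have Gk : (\int[leb]_a (G n k a)%:E <= (e / 3)%:E)%E.
  have Gfk : (\int[leb]_a (G n k a)%:E)%E \is a fin_num by near: k.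
  rewrite -(fineK Gfk) lee_fin (le_trans (ler_norm _))//.
  by near: k.
rewrite (le_trans (leeD (leeD intD intD) Gk))// -!EFinD lee_fin.
lra.
Unshelve. all: by end_near. Qed.

Lemma ge0_integral_slices n (f : 'rV[R]_n.+1 -> R) :
  measurable_fun setT f -> (forall x, 0 <= f x) ->
  (\int[lebesgue_rV R n.+1]_x (f x)%:E =
   \int[lebesgue_rV R n]_y \int[leb]_a (f (cons_rV (a, y)))%:E)%E.
Proof.
move=> mf f0.
rewrite (ge0_integral_rVS (f := fun x => (f x)%:E))//; last exact/measurable_EFinP.
pose l : {sigma_finite_measure set _ -> \bar R} := leb.
apply: (fubini_tonelli (m1 := l) (m2 := lebesgue_rV R n)
  (fun p => (f (cons_rV p))%:E)) => //.
  by apply/measurable_EFinP; exact: (measurableT_comp mf (@measurable_cons_rV R n)).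
by move=> p; rewrite lee_fin.
Qed.

Lemma integral_normr_box n (f : 'rV[R]_n -> R) (B r : R) : 0 <= r ->
  measurable_fun setT f -> (forall x, `|f x| <= B) ->
  (forall x, ~ box r x -> f x = 0) ->
  (\int[lebesgue_rV R n]_x (`|f x|)%:E <= (B * (r *+ 2) ^+ n)%:E)%E.
Proof.
move=> r0 mf fB fr; have B0 : 0 <= B by rewrite (le_trans _ (fB 0)).
apply: (@le_trans _ _ (\int[lebesgue_rV R n]_x (B%:E * (\1_(box r) x)%:E))%E).
  apply: ge0_le_integral => //.
  - by apply/measurable_EFinP; exact: measurableT_comp.
  - by apply: measurable_funeM; apply/measurable_EFinP/measurable_indic; exact: measurable_box.
  - move=> x _; rewrite -EFinM lee_fin indicE.
    have [bx|bx] := pselect (box r x); first by rewrite mem_set// mulr1.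
    by rewrite memNset// mulr0 fr// normr0.
rewrite ge0_integralZl_EFin//; last first.
  by apply/measurable_EFinP/measurable_indic; exact: measurable_box.
rewrite integral_indic//; last exact: measurable_box.
rewrite setIT EFinM; apply: lee_wpmul2l; first by rewrite lee_fin.
by rewrite le_eqVlt; apply/orP; left; apply/eqP; exact: lebesgue_rV_boxr.
Qed.

Lemma integral_normr_itv (f : R -> R) (B r : R) : 0 <= r ->
  measurable_fun setT f -> (forall x, `|f x| <= B) ->
  (forall x, r < `|x| -> f x = 0) ->
  (\int[leb]_x (`|f x|)%:E <= (B * (r *+ 2))%:E)%E.
Proof.
move=> r0 mf fB fr; have B0 : 0 <= B by rewrite (le_trans _ (fB 0)).
have mI : measurable_fun setT (\1_(`[- r, r]%classic) : R -> R).
  exact: measurable_indic.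
apply: (@le_trans _ _ (\int[leb]_x (B%:E * (\1_(`[- r, r]%classic) x)%:E))%E).
  apply: ge0_le_integral => //.
  - by apply/measurable_EFinP; exact: measurableT_comp.
  - by apply: measurable_funeM; apply/measurable_EFinP.
  - move=> x _; rewrite -EFinM lee_fin indicE mem_setE in_itv/= -ler_norml.
    have [bx|bx] := leP `|x| r; first by rewrite mulr1.
    by rewrite mulr0 fr// normr0.
rewrite ge0_integralZl_EFin//; last exact/measurable_EFinP.
rewrite integral_indic// setIT EFinM; apply: lee_wpmul2l; first by rewrite lee_fin.
apply: (@le_trans _ _ (@lebesgue_measure R `[(- r)%R, r]%classic)) => //.
rewrite lebesgue_measure_itv/=; case: ifP => _; last by rewrite lee_fin mulrn_wge0.
by rewrite -EFinB lee_fin opprK mulr2n.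
Qed.

Lemma integral_shift_diff_rV n (f : 'rV[R]_n -> R) w : measurable_fun setT f ->
  (\int[lebesgue_rV R n]_x (`|f (x + w) - f x|)%:E <=
   2%:E * \int[lebesgue_rV R n]_x (`|f x|)%:E)%E.
Proof.
move=> mf; have mfw := measurableT_comp mf (measurable_rV_addr w).
have mn : measurable_fun setT (fun x : 'rV[R]_n => (`|f x|)%:E).
  by apply/measurable_EFinP; exact: measurableT_comp.
have mnw : measurable_fun setT (fun x : 'rV[R]_n => (`|f (x + w)|)%:E).
  by apply/measurable_EFinP; exact: measurableT_comp mfw.
apply: (@le_trans _ _ (\int[lebesgue_rV R n]_x ((`|f (x + w)|)%:E + (`|f x|)%:E))%E).
  apply: ge0_le_integral => //.
  - by apply/measurable_EFinP; apply: measurableT_comp => //; exact: measurable_funB.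
  - exact: emeasurable_funD.
  - by move=> x _; rewrite -EFinD lee_fin ler_normB.
rewrite ge0_integralD//.
rewrite (ge0_integral_rV_shift w mn); last by move=> x; rewrite lee_fin.
by rewrite -mule2n -mule_natl.
Qed.

Lemma integral_shift_diff_leb (f : R -> R) w : measurable_fun setT f ->
  (\int[leb]_x (`|f (x + w) - f x|)%:E <= 2%:E * \int[leb]_x (`|f x|)%:E)%E.
Proof.
move=> mf.
have mw : measurable_fun setT (fun a : R => a + w) by exact: measurable_funD.
have mfw := measurableT_comp mf mw.
have mn : measurable_fun setT (fun x : R => (`|f x|)%:E).
  by apply/measurable_EFinP; exact: measurableT_comp.
have mnw : measurable_fun setT (fun x : R => (`|f (x + w)|)%:E).
  by apply/measurable_EFinP; exact: measurableT_comp mfw.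
apply: (@le_trans _ _ (\int[leb]_x ((`|f (x + w)|)%:E + (`|f x|)%:E))%E).
  apply: ge0_le_integral => //.
  - by apply/measurable_EFinP; apply: measurableT_comp => //; exact: measurable_funB.
  - exact: emeasurable_funD.
  - by move=> x _; rewrite -EFinD lee_fin ler_normB.
rewrite ge0_integralD//.
rewrite (ge0_integral_leb_shift w mn); last by move=> x; rewrite lee_fin.
by rewrite -mule2n -mule_natl.
Qed.

Lemma measurable_cons_rVl n (y : 'rV[R]_n) :
  measurable_fun setT (fun a : R => cons_rV (a, y)).
Proof.
apply: measurable_fun_rVP => i; under eq_fun do rewrite mxE.
by case: (unlift ord0 i) => [j|] /=; [exact: measurable_cst|exact: measurable_id].
Qed.

Lemma integrable_box n (r : R) : 0 <= r ->
  (lebesgue_rV R n).-integrable setT (EFin \o \1_(box r)).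
Proof.
move=> r0; apply/integrableP; split.
  by apply/measurable_EFinP/measurable_indic; exact: measurable_box.
rewrite (eq_integral (fun x => (\1_(box r) x)%:E)); last first.
  by move=> x _ /=; rewrite ger0_norm.
rewrite integral_indic//; last exact: measurable_box.
rewrite setIT (le_lt_trans (y := ((r *+ 2) ^+ n)%:E)) ?ltry//.
by rewrite le_eqVlt; apply/orP; left; apply/eqP; exact: lebesgue_rV_boxr.
Qed.

(** Move one coordinate at a time. The first coordinate is the one-dimensional
    statement on each line, integrated by dominated convergence; the others
    follow by induction on the dimension. *)
Lemma translation_continuity n (f : 'rV[R]_n -> R) (B r : R) (w : nat -> 'rV[R]_n) :
  0 <= r -> measurable_fun setT f -> (forall x, `|f x| <= B) ->
  (forall x, ~ box r x -> f x = 0) ->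
  (forall i, w k ord0 i @[k --> \oo] --> (0 : R)) ->
  (\int[lebesgue_rV R n]_x (`|f (x + w k) - f x|)%:E @[k --> \oo] --> 0)%E.
Proof.
move=> r0; elim: n f w => [|n IH] f w mf fB fr w0.
  rewrite (_ : (fun k => _) = fun=> 0%E); first exact: cvg_cst.
  apply/funext => k; rewrite (eq_integral (fun=> 0%E)) ?integral0// => x _.
  by rewrite (_ : x + w k = x) ?subrr ?normr0//; apply/rowP => -[].
have B0 : 0 <= B by rewrite (le_trans _ (fB 0)).
pose t k := (uncons_rV (w k)).1; pose v k := (uncons_rV (w k)).2.
have wE k : w k = cons_rV (t k, v k) by rewrite -surjective_pairing uncons_rVK.
have t0 : t @ \oo --> (0 : R) by exact: w0.
have v0 i : v k ord0 i @[k --> \oo] --> (0 : R).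
  by rewrite /v /=; under eq_fun do rewrite mxE; exact: w0.
have consD a b (x y : 'rV[R]_n) : cons_rV (a, x) + cons_rV (b, y) = cons_rV (a + b, x + y).
  by have := cons_rV_add 1 a b x y; rewrite !scale1r mul1r.
pose f1 a y := f (cons_rV (a, y)).
have mf1 a : measurable_fun setT (f1 a) := measurableT_comp mf (measurable_cons_rVr a).
have mf2 y : measurable_fun setT (f1^~ y).
  exact: (measurableT_comp mf (measurable_cons_rVl y)).
have f1r a y : r < `|a| -> f1 a y = 0.
  move=> ra; apply: fr => /(_ ord0); rewrite mxE unlift_none/=.
  by rewrite leNgt ra.
have f1b a y : ~ box r y -> f1 a y = 0.
  move=> yb; apply: fr => ab; apply: yb => i.
  by have := ab (lift ord0 i); rewrite mxE liftK.
have f1B a y : `|f1 a y| <= B by exact: fB.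
have mf12 : measurable_fun setT (fun p : R * 'rV[R]_n => f1 p.1 p.2).
  have -> : (fun p : R * 'rV[R]_n => f1 p.1 p.2) = f \o @cons_rV R n.
    by apply/funext => -[].
  exact: (measurableT_comp mf (@measurable_cons_rV R n)).
have mft k : measurable_fun setT
    (fun p : R * 'rV[R]_n => (`|f1 (p.1 + t k) p.2 - f1 p.1 p.2|)%:E).
  apply/measurable_EFinP; apply: measurableT_comp => //; apply: measurable_funB => //.
  have -> : (fun p : R * 'rV[R]_n => f1 (p.1 + t k) p.2) =
    (fun p : R * 'rV[R]_n => f1 p.1 p.2) \o (fun p => (p.1 + t k, p.2)) by [].
  apply: measurableT_comp => //; apply: measurable_fun_pair => //.
  by apply: measurable_funD => //.
have mfv k : measurable_fun setT
    (fun p : R * 'rV[R]_n => (`|f1 p.1 (p.2 + v k) - f1 p.1 p.2|)%:E).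
  apply/measurable_EFinP; apply: measurableT_comp => //; apply: measurable_funB => //.
  have -> : (fun p : R * 'rV[R]_n => f1 p.1 (p.2 + v k)) =
    (fun p : R * 'rV[R]_n => f1 p.1 p.2) \o (fun p => (p.1, p.2 + v k)) by [].
  apply: measurableT_comp => //; apply: measurable_fun_pair => //.
  exact: (measurableT_comp (measurable_rV_addr (v k)) _).
pose l : {sigma_finite_measure set _ -> \bar R} := leb.
have A0 : (\int[lebesgue_rV R n]_y \int[leb]_a (`|f1 (a + t k) y - f1 a y|)%:E
    @[k --> \oo] --> 0)%E.
  have := @dominated_convergence _ _ _ (lebesgue_rV R n) setT measurableT
    (fun k y => \int[leb]_a (`|f1 (a + t k) y - f1 a y|)%:E)%E (fun=> 0%E)
    (fun y => ((2 * (B * (r *+ 2))) * \1_(box r) y)%:E).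
  rewrite integral0; case=> //.
  - move=> k; have := @measurable_fun_fubini_tonelli_G _ _ _ _ R l _ (mft k).
    by apply=> p; rewrite lee_fin.
  - apply: aeW => y _.
    exact: (translation_continuity_1d (mf2 y) (fun a => f1B a y) (fun a => @f1r a y) r0 t0).
  - apply: (integrableZl measurableT (2 * (B * (r *+ 2))) (f := EFin \o \1_(box r))).
    exact: integrable_box.
  - apply: aeW => y k _; rewrite gee0_abs; last by apply: integral_ge0 => a _; rewrite lee_fin.
    rewrite indicE; have [yb|yb] := pselect (box r y).
      rewrite mem_set// mulr1 (le_trans (integral_shift_diff_leb (t k) (mf2 y)))//.
      rewrite EFinM; apply: lee_wpmul2l => //.
      exact: (integral_normr_itv r0 (mf2 y) (fun a => f1B a y) (fun a => @f1r a y)).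
    rewrite memNset// mulr0 (eq_integral (fun=> 0%E)) ?integral0// => a _.
    by rewrite !f1b// subrr normr0.
have B0' : (\int[leb]_a \int[lebesgue_rV R n]_y (`|f1 a (y + v k) - f1 a y|)%:E
    @[k --> \oo] --> 0)%E.
  have := @dominated_convergence _ _ _ leb setT measurableT
    (fun k a => \int[lebesgue_rV R n]_y (`|f1 a (y + v k) - f1 a y|)%:E)%E (fun=> 0%E)
    (fun a => ((2 * (B * (r *+ 2) ^+ n)) * \1_(`[- r, r]%classic) a)%:E).
  rewrite integral0; case=> //.
  - move=> k; have := @measurable_fun_fubini_tonelli_F _ _ _ _ R (lebesgue_rV R n) _ (mfv k).
    by apply=> p; rewrite lee_fin.
  - apply: aeW => a _.
    exact: (IH (f1 a) v (mf1 a) (f1B a) (f1b a) v0).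
  - have iI := @integrable_indic_itv R (- r) r true false.
    exact: (integrableZl measurableT (2 * (B * (r *+ 2) ^+ n)) iI).
  - apply: aeW => a k _; rewrite gee0_abs; last by apply: integral_ge0 => y _; rewrite lee_fin.
    rewrite indicE mem_setE in_itv/= -ler_norml; have [ar|ar] := leP `|a| r.
      rewrite mulr1 (le_trans (integral_shift_diff_rV (v k) (mf1 a)))//.
      rewrite EFinM; apply: lee_wpmul2l => //.
      exact: (integral_normr_box r0 (mf1 a) (f1B a) (f1b a)).
    rewrite mulr0 (eq_integral (fun=> 0%E)) ?integral0// => y _.
    by rewrite !f1r// subrr normr0.
have AB0 := cvgeD (erefl : (0 +? 0)%E) A0 B0'; rewrite adde0 in AB0.
apply: (@squeeze_cvge _ _ _ _ (cst 0%E) _ (fun k =>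
   \int[lebesgue_rV R n]_y \int[leb]_a (`|f1 (a + t k) y - f1 a y|)%:E +
   \int[leb]_a \int[lebesgue_rV R n]_y (`|f1 a (y + v k) - f1 a y|)%:E)%E);
  [apply: nearW => k|exact: cvg_cst|exact: AB0].
apply/andP; split; first by apply: integral_ge0 => x _; rewrite lee_fin.
pose z k := cons_rV (0 : R, v k); pose tz k := cons_rV (t k, 0 : 'rV[R]_n).
have wzt : w k = tz k + z k by rewrite wE consD addr0 add0r.
have mfz (c : 'rV[R]_n.+1) : measurable_fun setT (fun x : 'rV[R]_n.+1 => f (x + c)).
  exact: (measurableT_comp mf (measurable_rV_addr c)).
have mdiff (c : 'rV[R]_n.+1) : measurable_fun setT
    (fun x : 'rV[R]_n.+1 => `|f (x + c) - f x|).
  by apply: measurableT_comp => //; exact: measurable_funB.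
have mP : measurable_fun setT (fun x : 'rV[R]_n.+1 => (`|f (x + tz k) - f x|)%:E).
  by apply/measurable_EFinP; exact: mdiff.
have mQ : measurable_fun setT (fun x : 'rV[R]_n.+1 => (`|f (x + z k) - f x|)%:E).
  by apply/measurable_EFinP; exact: mdiff.
have mPz : measurable_fun setT
    (fun x : 'rV[R]_n.+1 => (`|f (x + z k + tz k) - f (x + z k)|)%:E).
  exact: (measurableT_comp mP (measurable_rV_addr (z k))).
apply: (@le_trans _ _ (\int[lebesgue_rV R n.+1]_x
    ((`|f (x + z k + tz k)%R - f (x + z k)%R|)%:E + (`|f (x + z k)%R - f x|)%:E))%E).
  apply: ge0_le_integral => //.
  - by apply/measurable_EFinP; exact: mdiff.
  - exact: emeasurable_funD.
  - move=> x _; rewrite -EFinD lee_fin wzt (addrC (tz k)) addrA.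
    by rewrite (le_trans _ (ler_normD _ _))// addrA subrK.
rewrite ge0_integralD//.
rewrite (ge0_integral_rV_shift (z k) mP); last by move=> x; rewrite lee_fin.
apply: leeD; rewrite le_eqVlt; apply/orP; left; apply/eqP.
- etransitivity; first exact: (ge0_integral_slices (mdiff (tz k)) (fun=> normr_ge0 _)).
  apply: eq_integral => y _.
  by apply: eq_integral => a _; rewrite consD addr0.
- etransitivity.
    by apply: (ge0_integral_rVS mQ) => x; rewrite lee_fin.
  apply: eq_integral => a _.
  by apply: eq_integral => y _; rewrite consD addr0.
Qed.

End translation_continuity.

(** * Moduli of continuity and differences of kernels *)

Section cauchy_ingredients.
Context {R : realType} {d : nat}.
Local Notation V := 'rV[R]_d.
Local Notation mu := (lebesgue_rV R d).

Lemma Rintegral_box (c r : R) : 0 <= r ->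
  \int[mu]_x (c * \1_(box r) x) = c * (r *+ 2) ^+ d.
Proof.
move=> r0; rewrite (RintegralZl _ measurableT (integrable_box d r0)); congr (_ * _).
rewrite /Rintegral integral_indic//; last exact: measurable_box.
by rewrite setIT [X in fine X](@lebesgue_rV_boxr R d r r0).
Qed.

Lemma mollifier_integrable (e : R) : 0 <= e -> e <= 1 ->
  mu.-integrable setT (EFin \o @mollifier R d e).
Proof.
move=> e0 e1; apply: le_integrable (integrable_box d (@ler01 R)) => //.
- by apply/measurable_EFinP; exact: measurable_mollifier.
- move=> x _ /=; rewrite lee_fin !ger0_norm ?mollifier_ge0// indicE.
  have [x1|x1] := pselect (box 1 x); first by rewrite mem_set// mollifier_le1.
  rewrite memNset// mollifier_eq0// leNgt; apply/negP => xe; apply: x1.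
  by apply: enorm_box; exact: le_trans (ltW xe) e1.
Qed.

Lemma enorm_sqr_box (r : R) (x : V) : box r x -> enorm x ^+ 2 <= d%:R * r ^+ 2.
Proof.
move=> bx; rewrite enorm_sqr mulr_natl -[X in r ^+ 2 *+ X](card_ord d) -sumr_const.
apply: ler_sum => i _; rewrite -(real_normK (num_real (x ord0 i))).
by rewrite lerXn2r ?nnegrE//; exact: le_trans (bx i).
Qed.

(** On the box of radius e / (2 (d + 1)), inside the ball of radius e / sqrt
    2, the bump is at least (e^2 / 2)^2. *)
Lemma mollifier_mass_gt0 (e : R) : 0 < e -> e <= 1 -> 0 < \int[mu]_x mollifier e x.
Proof.
move=> e0 e1; pose r := e / (2 * d.+1%:R).
have r0 : 0 < r by rewrite divr_gt0// mulr_gt0.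
pose c := (e ^+ 2 / 2) ^+ 2.
have c0 : 0 < c by rewrite exprn_gt0// divr_gt0// exprn_gt0.
have h : c * (r *+ 2) ^+ d <= \int[mu]_x mollifier e x.
  rewrite -(Rintegral_box c (ltW r0)); apply: le_Rintegral => //.
  - exact: (integrableZl measurableT c (integrable_box d (ltW r0))).
  - exact: mollifier_integrable (ltW e0) e1.
  move=> x _; rewrite indicE.
  have [bx|bx] := pselect (box r x); last by rewrite memNset// mulr0 mollifier_ge0.
  rewrite mem_set// mulr1 /c /mollifier.
  have xr := enorm_sqr_box bx.
  have h1 : d%:R * r ^+ 2 <= e ^+ 2 / 2.
    rewrite /r expr_div_n mulrA ler_pdivrMr ?exprn_gt0 ?mulr_gt0//.
    have d1 : (d%:R : R) <= d.+1%:R ^+ 2.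
      by rewrite (@le_trans _ _ d.+1%:R) ?ler_nat// -[leLHS]expr1 ler_weXn2l ?ler1n.
    have e2 : 0 <= e ^+ 2 by rewrite sqr_ge0.
    have D0 : 0 <= d.+1%:R ^+ 2 :> R by rewrite sqr_ge0.
    have h2 := ler_wpM2l e2 d1; have h3 := mulr_ge0 e2 D0.
    rewrite exprMn mulrC; lra.
  rewrite lerXn2r ?nnegrE ?le_max ?lexx//; first by rewrite divr_ge0 ?sqr_ge0.
  by apply/orP; right; lra.
by apply: (lt_le_trans _ h); rewrite mulr_gt0// exprn_gt0// mulr2n addr_gt0.
Qed.

Variable s : R.
Hypotheses (s0 : 0 < s) (s1 : s < 1).
Local Notation kern := (@kern R d s).

Lemma kern_diff_kernel e e' : 0 < e -> e <= e' -> e' <= 1 ->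
  jump_kernel (fun z => kern e z - kern e' z).
Proof.
move=> e0 ee' e1.
have [mk _ _ _] := @kern_kernel R d s s0 s1 e e0 (le_trans ee' e1).
have ke := kernel_integrable (@kern_kernel R d s s0 s1 e e0 (le_trans ee' e1)).
have [mk' _ _ _] := @kern_kernel R d s s0 s1 e' (lt_le_trans e0 ee') e1.
split.
- exact: measurable_funB.
- by move=> z; rewrite subr_ge0 le_kern.
- have /integrableP[_] : mu.-integrable setT (EFin \o (fun z => kern e z - kern e' z)).
    apply: le_integrable ke => //.
      by apply/measurable_EFinP; exact: measurable_funB.
    move=> z _ /=; rewrite lee_fin !ger0_norm ?kern_ge0 ?subr_ge0 ?le_kern//.
    by rewrite lerBlDr lerDl kern_ge0.
  congr (_ < _)%E; apply: eq_integral => z _ /=.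
  by rewrite ger0_norm// subr_ge0 le_kern.
- by move=> z; rewrite !kernN.
Qed.

(** On the annulus e < |z| <= e2 <= 1, where the difference lives, min(1,
    |z|^2) is |z|^2. *)
Lemma kern_diff_near_levy e e' z : 0 < e -> e <= e' -> e' <= 1 ->
  (kern e z - kern e' z) * enorm z ^+ 2 <= near_levy s e' z.
Proof.
move=> e0 ee' e1; rewrite /near_levy /kern.
have [ze|ze] := leP (enorm z) e'; last first.
  by rewrite (le_lt_trans ee' ze) /= subrr mul0r mulr0.
rewrite /= mul0r subr0 mulr1 /levy min_r; last first.
  by rewrite exprn_ile1 ?enorm_ge0// (le_trans ze).
rewrite mulrC ler_wpM2l ?sqr_ge0// ler_piMl ?invr_ge0 ?powR_ge0//.
by rewrite lern1 leq_b1.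
Qed.

(** Otherwise some sequence of shifts tends to 0 while the distances stay
    above eps, against [translation_continuity]. *)
Lemma modulus_small (v : V -> R) (B r eps : R) : 0 <= r -> 0 < eps ->
  measurable_fun setT v -> (forall x, `|v x| <= B) ->
  (forall x, ~ box r x -> v x = 0) ->
  exists2 eta : R, 0 < eta <= 1 & forall w, enorm w < eta -> L1dist v v w <= eps.
Proof.
move=> r0 eps0 mv vB vr; apply/not_exists2P => H.
have Hn k : exists w : V, enorm w < k.+1%:R^-1 /\ eps < L1dist v v w.
  have [|h] := H (k.+1%:R^-1).
    by case; rewrite invr_gt0 ltr0Sn invf_le1// ler1n.
  move/existsNP : h => [w /not_implyP[wk /negP]]; rewrite -ltNge => ew.
  by exists w.
have [w hw] := choice Hn.
have w0 i : w k ord0 i @[k --> \oo] --> (0 : R).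
  apply/cvgr0Pnorm_le => e e0; near=> k.
  rewrite (le_trans (coord_le_enorm _ _))// (le_trans (ltW (hw k).1))//.
  by apply: ltW; near: k; exact: (near_infty_natSinv_lt (PosNum e0)).
have := translation_continuity r0 mv vB vr w0.
move=> /fine_cvgP[fin /cvgr0Pnorm_le/(_ _ eps0) le].
near \oo => k.
have finE : (\int[mu]_x (`|v (x + w k) - v x|)%:E)%E = (L1dist v v (w k))%:E.
  have f : (\int[mu]_x (`|v (x + w k) - v x|)%:E)%E \is a fin_num by near: k.
  rewrite -(fineK f); congr EFin; congr fine; apply: eq_integral => x _.
  by rewrite distrC.
have : `|fine (\int[mu]_x (`|v (x + w k) - v x|)%:E)%E| <= eps by near: k; exact: le.
rewrite finE/= ger0_norm ?L1dist_ge0// leNgt => /negP; apply.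
exact: (hw k).2.
Unshelve. all: by end_near. Qed.

End cauchy_ingredients.

(** * The approximate evolutions form a Cauchy sequence *)

Section cauchy.
Context {R : realType} {d : nat}.
Local Notation V := 'rV[R]_d.
Local Notation mu := (lebesgue_rV R d).
Variables (Psi : R -> R) (L M : R).
Hypotheses (Psi0 : Psi 0 = 0) (Psi_nd : {homo Psi : x y / x <= y})
  (L0 : 0 <= L) (Psi_lip : forall a b, `|Psi a - Psi b| <= L * `|a - b|)
  (M0 : 0 <= M).
Variable s : R.
Hypotheses (s0 : 0 < s) (s1 : s < 1).

Local Notation state := (@state R d M).
Local Notation N := (@levy_mass R d s).

Definition level_kern (p : nat) : V -> R := kern s (2 ^- p).
(** The kernel of level p has mass of order 4^p, at most; the step 32^-p makes
    the product of the step with the mass, and with its square, at most of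
    order 2^-p. *)
Definition tstep (p : nat) : R := 32 ^- p.
Definition tindex (p : nat) (t : R) : nat := Num.truncn (t * 32 ^+ p).

Definition euler (v0 : V -> R) (p n : nat) : V -> R :=
  iter n (step Psi (level_kern p) (tstep p)) v0.

Definition evol (v0 : V -> R) (p : nat) (t : R) : V -> R := euler v0 p (tindex p t).

Lemma pow2_gt0 p : 0 < 2 ^- p :> R. Proof. by rewrite invr_gt0 exprn_gt0. Qed.

Lemma pow2_le1 p : 2 ^- p <= 1 :> R.
Proof. by rewrite invf_le1 ?exprn_gt0// exprn_ege1// ler1n. Qed.

Lemma le_pow2 p q : (p <= q)%N -> 2 ^- q <= 2 ^- p :> R.
Proof.
by move=> pq; rewrite lef_pV2 ?posrE ?exprn_gt0// ler_weXn2l// ler1n.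
Qed.

Lemma tstep_gt0 p : 0 < tstep p. Proof. by rewrite invr_gt0 exprn_gt0. Qed.

Lemma tstep_ge0 p : 0 <= tstep p. Proof. exact/ltW/tstep_gt0. Qed.

Lemma level_kernel p : jump_kernel (level_kern p).
Proof. exact: (@kern_kernel R d s s0 s1 _ (pow2_gt0 p) (pow2_le1 p)). Qed.

Lemma level_kern_mass p : mass (level_kern p) <= 4 ^+ p * N.
Proof.
rewrite (le_trans (@kern_mass R d s s0 s1 _ (pow2_gt0 p) (pow2_le1 p)))//.
rewrite ler_wpM2r ?levy_mass_ge0// exprVn invrK -exprM mulnC exprM.
by rewrite -[X in X ^+ p]natrX.
Qed.

Lemma tstep_mass p : tstep p * mass (level_kern p) <= 2 ^- p * N.
Proof.
rewrite (le_trans (ler_wpM2l (tstep_ge0 p) (level_kern_mass p)))// mulrA.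
rewrite ler_wpM2r ?levy_mass_ge0// /tstep mulrC ler_pdivrMr ?exprn_gt0//.
rewrite mulrC ler_pdivlMr ?exprn_gt0// -!exprMn lerXn2r ?nnegrE//.
by rewrite -natrM ler_nat.
Qed.

Lemma tstep_mass2 p : tstep p * mass (level_kern p) ^+ 2 <= 2 ^- p * N ^+ 2.
Proof.
have N0 := @levy_mass_ge0 R d s.
have mK0 := mass_ge0 (level_kernel p).
have : mass (level_kern p) ^+ 2 <= (4 ^+ p * N) ^+ 2.
  by rewrite lerXn2r ?nnegrE ?mulr_ge0 ?exprn_ge0// level_kern_mass.
move=> /(ler_wpM2l (tstep_ge0 p)) h; rewrite (le_trans h)// exprMn mulrA.
rewrite ler_wpM2r ?sqr_ge0// /tstep mulrC ler_pdivrMr ?exprn_gt0//.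
rewrite mulrC ler_pdivlMr ?exprn_gt0// -exprM mulnC exprM -!exprMn lerXn2r ?nnegrE ?mulr_ge0//.
by rewrite -natrX -natrM ler_nat.
Qed.

Lemma cfl_eventually : exists p0, forall p, (p0 <= p)%N ->
  tstep p * mass (level_kern p) * L <= 1.
Proof.
exists (Num.bound (N * L)) => p hp.
rewrite (le_trans (ler_wpM2r L0 (tstep_mass p)))// -mulrA mulrC ler_pdivrMr ?exprn_gt0//.
by rewrite mul1r ltW// upper_nthrootP.
Qed.

(** Nested grids: up to r < 32^(q - p) small steps, the time is a multiple of
    the large step. *)
Lemma tindex_refine p q t : (p <= q)%N -> 0 <= t ->
  exists2 r, (r < 32 ^ (q - p))%N & tindex q t = (tindex p t * 32 ^ (q - p) + r)%N.
Proof.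
move=> pq t0; set m := (32 ^ (q - p))%N.
have m0 : (0 < m)%N by rewrite expn_gt0.
have E : t * 32 ^+ q = t * 32 ^+ p * m%:R.
  by rewrite -mulrA natrX -exprD subnKC.
have tp0 : 0 <= t * 32 ^+ p by rewrite mulr_ge0 ?exprn_ge0.
have tq0 : 0 <= t * 32 ^+ q by rewrite mulr_ge0 ?exprn_ge0.
have /andP[a1 a2] := truncn_itv tp0; have /andP[b1 b2] := truncn_itv tq0.
have m0' : 0 < m%:R :> R by rewrite ltr0n.
have low : (tindex p t * m <= tindex q t)%N.
  rewrite -ltnS -(ltr_nat R) natrM (le_lt_trans _ b2)// E ler_wpM2r//.
have up : (tindex q t < (tindex p t).+1 * m)%N.
  rewrite -(ltr_nat R) natrM (le_lt_trans b1)// E ltr_pM2r//.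
exists (tindex q t - tindex p t * m)%N; last by rewrite subnKC.
by rewrite ltn_subLR// -mulSnr.
Qed.

Lemma tindex_le p t : 0 <= t -> (tindex p t)%:R * tstep p <= t.
Proof.
move=> t0; rewrite /tstep ler_pdivrMr ?exprn_gt0//.
have tp0 : 0 <= t * 32 ^+ p by rewrite mulr_ge0 ?exprn_ge0.
by have /andP[] := truncn_itv tp0.
Qed.

Lemma tstepM p q : (p <= q)%N -> tstep p = (32 ^ (q - p))%:R * tstep q.
Proof.
move=> pq; by rewrite /tstep natrX -{2}(subnKC pq) exprD invfM mulrCA mulfV ?mulr1.
Qed.

Section one_datum.
Variables (v0 : V -> R) (p0 : nat).
Hypothesis hv0 : state v0.
Hypothesis cfl : forall p, (p0 <= p)%N -> tstep p * mass (level_kern p) * L <= 1.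

Lemma state_euler p n : (p0 <= p)%N -> state (euler v0 p n).
Proof.
move=> pp; apply: (state_iter Psi0 Psi_nd L0 Psi_lip M0) => //.
- exact: level_kernel.
- exact: tstep_ge0.
- exact: cfl.
Qed.

Let I := \int[mu]_x v0 x.
Let I0 : 0 <= I. Proof. by apply: Rintegral_ge0 => x _; exact: state_ge0 hv0 x. Qed.
Let N0 : 0 <= N. Proof. exact: levy_mass_ge0. Qed.

(** Constant of the error due to the refinement of the time step. *)
Definition time_const (T : R) := (T * (2 * N * L) ^+ 2 + 2 * N * L) * I.

(** Constant of the error due to the short jumps, at scale eta of the bump; it
    degenerates as eta tends to 0, which is why [tail] has to be made small
    afterwards. *)
Definition space_const (T eta : R) :=
  T * (2 * L * I * (@mollifier_C R d * (2 *+ 2) ^+ d)) / \int[mu]_w mollifier eta w.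

(** Insert the scheme with kernel of level p and step of level q:
    [refine_time] compares it with level p, [same_grid_distance] with level q. *)
Lemma evol_cauchy_bound p q t T eta omega :
  (p0 <= p)%N -> (p <= q)%N -> 0 <= t -> t <= T -> 0 < eta -> eta <= 1 ->
  (forall w, enorm w < eta -> L1dist v0 v0 w <= omega) ->
  L1dist (evol v0 p t) (evol v0 q t) 0 <=
  2 ^- p * time_const T + 2 * omega + @tail R d s (2 ^- p) * space_const T eta.
Proof.
move=> pp pq t0 tT eta0 eta1 Hom.
have T0 : 0 <= T := le_trans t0 tT.
have qq : (p0 <= q)%N := leq_trans pp pq.
have [r rN nE] := tindex_refine pq t0.
set m := (32 ^ (q - p))%N in rN nE.
have hpE : tstep p = m%:R * tstep q by exact: tstepM.
have hq0 := tstep_ge0 q; have hp0 := tstep_ge0 p.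
have kp := level_kernel p; have kq := level_kernel q.
have mKp := mass_ge0 kp.
(* kernel of level p, time step of level q *)
pose mid := iter (tindex q t) (step Psi (level_kern p) (tstep q)) v0.
have cflpq : tstep q * mass (level_kern p) * L <= 1.
  rewrite (le_trans _ (cfl pp))// !ler_wpM2r// hpE -[leLHS]mul1r ler_wpM2r//.
  by rewrite ler1n expn_gt0.
have smid : state mid by exact: (state_iter Psi0 Psi_nd L0 Psi_lip M0).
have sp := state_euler (tindex p t) pp; have sq := state_euler (tindex q t) qq.
have t1 : L1dist (evol v0 p t) mid 0 <= 2 ^- p * time_const T.
  rewrite L1dist0C /mid nE /evol /euler hpE.
  have cflm : m%:R * tstep q * mass (level_kern p) * L <= 1 by rewrite -hpE; exact: cfl.
  have H := refine_time Psi0 Psi_nd L0 Psi_lip M0 kp (tindex p t) hq0 cflm rN hv0.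
  rewrite (le_trans H)// -hpE /time_const [leRHS]mulrA ler_wpM2r//.
  have a1 := tindex_le p t0; have a2 := tstep_mass p; have a3 := tstep_mass2 p.
  rewrite mulrDr lerD//.
    have -> : (tindex p t)%:R * (tstep p * (2 * mass (level_kern p) * L)) ^+ 2 =
      (tindex p t)%:R * tstep p * ((2 * L) ^+ 2 * (tstep p * mass (level_kern p) ^+ 2)) by ring.
    have -> : 2 ^- p * (T * (2 * N * L) ^+ 2) =
       T * ((2 * L) ^+ 2 * (2 ^- p * N ^+ 2)) by ring.
    apply: ler_pM => //.
    - by rewrite mulr_ge0.
    - by rewrite mulr_ge0 ?sqr_ge0// mulr_ge0 ?sqr_ge0.
    - exact: le_trans tT.
    - by rewrite ler_wpM2l ?sqr_ge0.
  have -> : tstep p * (2 * mass (level_kern p) * L) = 2 * L * (tstep p * mass (level_kern p)) by ring.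
  have -> : 2 ^- p * (2 * N * L) = 2 * L * (2 ^- p * N) by ring.
  by rewrite ler_wpM2l// mulr_ge0.
have t2 : L1dist mid (evol v0 q t) 0 <=
    2 * omega + @tail R d s (2 ^- p) * space_const T eta.
  have ee := le_pow2 pq.
  have hk := @kern_diff_kernel R d s s0 s1 _ _ (pow2_gt0 q) ee (pow2_le1 p).
  have K2E z : level_kern q z = level_kern p z + (kern s (2 ^- q) z - kern s (2 ^- p) z).
    by rewrite /level_kern addrC subrK.
  have irho := @mollifier_integrable R d eta (ltW eta0) eta1.
  have rho01 (w : V) : 0 <= mollifier eta w <= 1.
    by rewrite mollifier_ge0 mollifier_le1// ltW.
  have rho1 (w : V) : `|mollifier eta w| <= 1.
    by have /andP[? ?] := rho01 w; rewrite ger0_norm.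
  have C0 : 0 <= @mollifier_C R d.
    by rewrite addr_ge0// mulr_ge0// sqr_ge0.
  have tl0 := @tail_ge0 R d s (2 ^- p).
  have rhog := second_diff_convol s0 s1 hk (ltW (pow2_gt0 p)) (pow2_le1 p)
    (fun z => kern_diff_near_levy s z (pow2_gt0 q) ee (pow2_le1 p))
    (@measurable_mollifier R d eta) rho1 C0
    (second_diff_mollifier (ltW eta0) eta1).
  have ig := integrableZl measurableT (@mollifier_C R d * @tail R d s (2 ^- p))
    (integrable_box d (ler0n R 2)).
  have hom w : mollifier eta w != 0 -> L1dist v0 v0 w <= omega.
    move=> h; apply: Hom; rewrite ltNge; apply: contra h => we.
    by rewrite mollifier_eq0// ltW.
  have H := same_grid_distance Psi0 Psi_nd L0 Psi_lip M0 kp kq hk K2E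
    (@measurable_mollifier R d eta) rho01 irho ig rhog (tindex q t) hq0 (cfl qq) hv0 hom.
  rewrite Rintegral_box// in H.
  have mr := @mollifier_mass_gt0 R d eta eta0 eta1.
  rewrite -(ler_pM2r mr) (le_trans H)// [leRHS]mulrDl lerD2l /space_const.
  rewrite -[leRHS]mulrA divfK ?gt_eqF//.
  have hnT : (tindex q t)%:R * tstep q <= T by exact: le_trans (tindex_le q t0) tT.
  set P := (2 *+ 2 : R) ^+ d.
  have P0 : 0 <= P by rewrite exprn_ge0.
  move: (@mollifier_C R d) C0 => C C0.
  have -> : (tindex q t)%:R * tstep q * (2 * L * I * (C * @tail R d s (2 ^- p) * P)) =
    (tindex q t)%:R * tstep q * (@tail R d s (2 ^- p) * (2 * L * I * (C * P))) by ring.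
  have -> : @tail R d s (2 ^- p) * (T * (2 * L * I * (C * P))) =
    T * (@tail R d s (2 ^- p) * (2 * L * I * (C * P))) by ring.
  by rewrite ler_wpM2r// !mulr_ge0.
have := L1dist_triangle 0 sp.2 smid.2 sq.2.
rewrite -/(evol v0 p t) -/(evol v0 q t) => h.
by rewrite (le_trans h)// -addrA lerD.
Qed.

End one_datum.
End cauchy.

(** * Iterated integrals of dominated functions *)

Section dominated_iterated.
Context {R : realType} {d : nat}.
Local Notation V := 'rV[R]_d.
Local Notation mu := (lebesgue_rV R d).
Local Notation leb := (@lebesgue_measure R).

(** A fixed integrable majorant in space, uniform in time: all that is needed
    to integrate over a bounded time interval. *)
Definition dominated (H : V -> R) (F : V * R -> R) :=
  measurable_fun setT F /\ forall x t, `|F (x, t)| <= H x.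

Variable H : V -> R.
Hypothesis iH : mu.-integrable setT (EFin \o H).

Let mH : measurable_fun setT H.
Proof. by case/integrableP : iH => /measurable_EFinP. Qed.

Lemma measurable_slice (F : V * R -> R) t : measurable_fun setT F ->
  measurable_fun setT (fun x => F (x, t)).
Proof. by move=> mF; exact: (measurable_fun_pair1 t mF). Qed.

Lemma dominated_slice F t : dominated H F ->
  mu.-integrable setT (EFin \o (fun x => F (x, t))).
Proof.
move=> [mF FH]; apply: le_integrable iH => //.
- by apply/measurable_EFinP; exact: measurable_slice.
- by move=> x _ /=; rewrite lee_fin (le_trans (FH x t))// ler_norm.
Qed.

Lemma dominated_inner_le F t : dominated H F ->
  `|\int[mu]_x F (x, t)| <= \int[mu]_x H x.
Proof.
move=> hF; rewrite (le_trans (le_normr_Rintegral _ (dominated_slice t hF)))//.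
apply: le_Rintegral => //; first exact: (integrable_norm (dominated_slice t hF)).
by move=> x _; exact: hF.2.
Qed.

Lemma measurable_inner F : dominated H F ->
  measurable_fun setT (fun t => \int[mu]_x F (x, t)).
Proof.
move=> hF; have [mF FH] := hF.
have -> : (fun t => \int[mu]_x F (x, t)) =
    (fun t => \int[mu]_x (F (x, t) + H x) - \int[mu]_x H x).
  apply/funext => t; rewrite RintegralD ?addrK//.
  exact: dominated_slice.
apply: measurable_funB => //; apply: measurableT_comp => //.
have := @measurable_fun_fubini_tonelli_G _ _ V (measurableTypeR R) R mu
  (fun p => (F p + H p.1)%:E).
apply.
  apply/measurable_EFinP; apply: measurable_funD => //.
  exact: measurableT_comp mH _.
move=> [x t]; rewrite lee_fin -lerBlDr sub0r.
by have := FH x t; rewrite ler_norml => /andP[].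
Qed.

Variable T : R.
Let D := `[0, T]%classic.
Let mD : measurable D. Proof. exact: measurable_itv. Qed.

Let fin_D : (leb D < +oo)%E.
Proof. by rewrite lebesgue_measure_itv/=; case: ifP => _; rewrite -?EFinB ltry. Qed.

Lemma dominated_outer F : dominated H F ->
  leb.-integrable D (EFin \o (fun t => \int[mu]_x F (x, t))).
Proof.
move=> hF; apply: measurable_bounded_integrable => //.
  by apply: measurable_funTS; exact: measurable_inner.
exists (\int[mu]_x H x); split; first exact: num_real.
by move=> y Hy t _ /=; rewrite (le_trans (dominated_inner_le t hF))// ltW.
Qed.

(** Dominated convergence on one time slice. *)
Lemma slice_cvg F (G : nat -> V * R -> R) t :
  dominated H F -> (forall k, dominated H (G k)) ->
  {ae mu, forall x, G k (x, t) @[k --> \oo] --> F (x, t)} ->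
  \int[mu]_x G k (x, t) @[k --> \oo] --> \int[mu]_x F (x, t).
Proof.
move=> hF hG GF.
have := @dominated_convergence _ _ _ mu setT measurableT
  (fun k x => (G k (x, t))%:E) (fun x => (F (x, t))%:E) (EFin \o H).
case.
- by move=> k; apply/measurable_EFinP; apply: measurable_slice; exact: (hG k).1.
- by apply/measurable_EFinP; apply: measurable_slice; exact: hF.1.
- apply: filterS GF => x Gx _; apply: cvg_EFin Gx; exact: nearW.
- exact: iH.
- by apply: aeW => x k _; rewrite lee_fin; exact: (hG k).2.
move=> _ _ h; apply: fine_cvg; rewrite fineK; first exact: h.
exact: (integrable_fin_num measurableT (dominated_slice t hF)).
Qed.

(** Dominated convergence twice: in space by the majorant, then in time by its
    integral. *)
Lemma iterated_cvg F (G : nat -> V * R -> R) :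
  dominated H F -> (forall k, dominated H (G k)) ->
  (forall t, D t -> {ae mu, forall x, G k (x, t) @[k --> \oo] --> F (x, t)}) ->
  \int[leb]_(t in D) \int[mu]_x G k (x, t) @[k --> \oo] -->
  \int[leb]_(t in D) \int[mu]_x F (x, t).
Proof.
move=> hF hG GF.
have := @dominated_convergence _ _ _ leb D mD
  (fun k t => (\int[mu]_x G k (x, t))%:E) (fun t => (\int[mu]_x F (x, t))%:E)
  (fun=> (\int[mu]_x H x)%:E).
case.
- by move=> k; apply/measurable_EFinP; apply: measurable_funTS; exact: measurable_inner.
- by apply/measurable_EFinP; apply: measurable_funTS; exact: measurable_inner.
- apply: aeW => t Dt; apply: cvg_EFin; first exact: nearW.
  by apply: slice_cvg => //; exact: GF.
- apply: (measurable_bounded_integrable (f := fun=> \int[mu]_x H x)) => //.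
  exact: bounded_cst.
- by apply: aeW => t k Dt; rewrite lee_fin; exact: dominated_inner_le.
move=> _ _ h; apply: fine_cvg; rewrite fineK; first exact: h.
exact: (@integrable_fin_num _ (measurableTypeR R) R leb D mD _ (dominated_outer hF)).
Qed.

Lemma dominated_time F x : dominated H F ->
  leb.-integrable D (EFin \o (fun t => F (x, t))).
Proof.
move=> [mF FH]; apply: measurable_bounded_integrable => //.
  by apply: measurable_funTS; exact: (measurable_fun_pair2 x mF).
exists (H x); split; first exact: num_real.
by move=> y Hy t _ /=; rewrite (le_trans (FH x t))// ltW.
Qed.

Let l : {sigma_finite_measure set _ -> \bar R} := leb.

Let cut (F : V * R -> R) (p : V * measurableTypeR R) : R := F p * \1_D p.2.

Lemma dominated_product F : dominated H F ->
  (mu \x l)%E.-integrable setT (EFin \o cut F).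
Proof.
move=> hF; have [mF FH] := hF; pose FD := cut F.
have mFD : measurable_fun setT FD.
  apply: measurable_funM => //.
  by apply: measurableT_comp; [exact: measurable_indic|exact: measurable_snd].
have H0 x : 0 <= H x by rewrite (le_trans _ (FH x 0)).
apply/integrable12ltyP; first exact/measurable_EFinP.
apply: (@le_lt_trans _ _ (\int[mu]_x ((leb D) * (H x)%:E))%E).
  apply: ge0_le_integral => //.
  - by move=> x _; apply: integral_ge0.
  - apply: (measurable_fun_fubini_tonelli_F (m2 := l) (fun p => `|(FD p)%:E|%E)) => //.
    by apply: measurableT_comp => //; exact/measurable_EFinP.
  - by apply: measurable_funeM; exact/measurable_EFinP.
  move=> x _.
  apply: (@le_trans _ _ (\int[l]_t ((H x)%:E * (\1_D t)%:E))%E).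
    apply: ge0_le_integral => //.
    - apply: measurableT_comp => //; apply/measurable_EFinP.
      exact: (measurable_fun_pair2 x mFD).
    - by apply: measurable_funeM; apply/measurable_EFinP; exact: measurable_indic.
    - by move=> t _; rewrite -EFinM lee_fin normrM ler_pM// ger0_norm.
  rewrite ge0_integralZl_EFin//; last by apply/measurable_EFinP; exact: measurable_indic.
  by rewrite integral_indic// setIT muleC.
rewrite ge0_integralZl//; last 2 first.
- by apply/measurable_EFinP.
- by move=> x _; rewrite lee_fin.
apply: lte_mul_pinfty => //; first by rewrite ge0_fin_numE.
exact: (integrable_lty measurableT iH).
Qed.

Let cut_time F x : dominated H F ->
  (\int[l]_t (cut F (x, t))%:E = (\int[leb]_(t in D) F (x, t))%:E)%E.
Proof.
move=> hF; rewrite fineK; last first.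
  exact: (@integrable_fin_num _ (measurableTypeR R) R leb D mD _ (dominated_time x hF)).
rewrite [RHS]integral_mkcond; apply: eq_integral => t _.
by rewrite /cut /= patchE indicE; case: ifP => _; rewrite ?mulr1 ?mulr0.
Qed.

Lemma time_integral_integrable F : dominated H F ->
  mu.-integrable setT (EFin \o (fun x => \int[leb]_(t in D) F (x, t))).
Proof.
move=> hF; apply: eq_integrable (integrable_fubini_F (dominated_product hF)) => //.
by move=> x _; exact: (cut_time x hF).
Qed.

(** Cutting F off outside the time interval makes it integrable on the
    product. *)
Lemma iterated_Fubini F : dominated H F ->
  \int[leb]_(t in D) \int[mu]_x F (x, t) = \int[mu]_x \int[leb]_(t in D) F (x, t).
Proof.
move=> hF; have FE := Fubini (dominated_product hF).
have E2 t : (\int[mu]_x (cut F (x, t))%:E = ((\int[mu]_x F (x, t)) * \1_D t)%:E)%E.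
  have [tD|tD] := boolP (t \in D); last first.
    rewrite indicE (negbTE tD) mulr0 (eq_integral (fun=> 0%E)) ?integral0// => x _.
    by rewrite /cut /= indicE (negbTE tD) mulr0.
  rewrite indicE tD mulr1 fineK; last first.
    exact: (integrable_fin_num measurableT (dominated_slice t hF)).
  by apply: eq_integral => x _; rewrite /cut /= indicE tD mulr1.
rewrite /Rintegral -/(Rintegral _ _ _); congr fine.
transitivity (\int[l]_t \int[mu]_x (cut F (x, t))%:E)%E.
  rewrite integral_mkcond; apply: eq_integral => t _.
  by rewrite E2 patchE indicE; case: ifP => _; rewrite ?mulr1 ?mulr0.
by rewrite -FE; apply: eq_integral => x _; rewrite (cut_time x hF).
Qed.

End dominated_iterated.

(** * The scheme tested against a function *)

Section weak_form_of_scheme.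
Context {R : realType} {d : nat}.
Local Notation V := 'rV[R]_d.
Local Notation mu := (lebesgue_rV R d).
Local Notation leb := (@lebesgue_measure R).

Lemma truncn_measurable : measurable_fun setT (fun t : R => (Num.truncn t)%:R : R).
Proof.
apply: nondecreasing_measurable => // x y xy.
by have := le_truncn xy; rewrite -(ler_nat R).
Qed.

Variables (Psi : R -> R) (L M : R).
Hypotheses (Psi0 : Psi 0 = 0) (Psi_nd : {homo Psi : x y / x <= y})
  (L0 : 0 <= L) (Psi_lip : forall a b, `|Psi a - Psi b| <= L * `|a - b|)
  (M0 : 0 <= M).
Variable s : R.
Hypotheses (s0 : 0 < s) (s1 : s < 1).

Local Notation state := (@state R d M).
Local Notation N := (@levy_mass R d s).
Local Notation level_kern := (@level_kern R d s).
Local Notation euler := (@euler R d Psi s).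
Local Notation evol := (@evol R d Psi s).
Local Notation jump := (@jump R d Psi).
Local Notation tail := (@tail R d s).

(** What a test function contributes to the weak formulation. The last clause
    says that Lam is, up to the constant, the fractional Laplacian of f, with
    the rate at which the truncated operators converge to it. Functions are
    defined for all times so that no restriction to [0, T] is carried along. *)
Definition test_data (T C r : R) (f ft Lam : V * R -> R) :=
  [/\ [/\ measurable_fun setT f, measurable_fun setT ft & measurable_fun setT Lam],
      [/\ 0 <= C, 0 <= r, 0 <= T,
          forall x t, `|f (x, t)| <= C * \1_(box r) x &
          forall x t, `|ft (x, t)| <= C * \1_(box r) x],
      forall x a b, 0 <= a -> a <= b -> b <= T ->
        \int[leb]_(t in `[a, b]) ft (x, t) = f (x, b) - f (x, a) &
      forall p x t,
        `|Lam (x, t) + (convol (level_kern p) (fun y => f (y, t)) x - mass (level_kern p) * f (x, t))|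
          <= C * tail (2 ^- p) * \1_(box r) x].

Lemma jump_bound K u x : jump_kernel K -> state u -> `|jump K u x| <= mass K * (L * M).
Proof.
move=> hK hu; have mK := mass_ge0 hK.
have bP := ranged_Psi_bound Psi0 Psi_nd L0 Psi_lip hu.1.
have nP := ranged_Psi_norm Psi0 Psi_nd L0 Psi_lip hu.1.
have mP := ranged_Psi Psi_nd hu.1.
have c0 : 0 <= convol K (Psi \o u) x.
  by apply: (kint_ge0 hK) => z; case/andP: (bP (x + z)).
have LM0 : 0 <= L * M by rewrite mulr_ge0.
have c1 : convol K (Psi \o u) x <= mass K * (L * M).
  rewrite -(kint_cst hK); apply: (le_kint hK (B := L * M)) => //.
  - exact: measurable_shiftl.
  - by move=> _; rewrite ger0_norm.
  - by move=> z; case/andP: (bP (x + z)).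
have := bP x; rewrite /= => /andP[h0 h1].
have m0 : 0 <= mass K * Psi (u x) by rewrite mulr_ge0.
have m1 : mass K * Psi (u x) <= mass K * (L * M) by rewrite ler_wpM2l.
by rewrite /jump ler_norml; apply/andP; split; lra.
Qed.

Lemma leb_itv_lty (a b : R) (x y : bool) :
  (leb [set` Interval (BSide x a) (BSide y b)] < +oo)%E.
Proof. by rewrite lebesgue_measure_itv/=; case: ifP => _; rewrite -?EFinB ltry. Qed.

Lemma Rintegral_cst_itv (c a b : R) (x y : bool) : a <= b ->
  \int[leb]_(t in [set` Interval (BSide x a) (BSide y b)]) c = c * (b - a).
Proof.
move=> ab; rewrite Rintegral_cst//; congr (c * _).
transitivity (fine (@lebesgue_measure R
  [set` Interval (BSide x a) (BSide y b)])) => //.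
rewrite lebesgue_measure_itv/= lte_fin; case: ltP => [_|ba]; first by rewrite -EFinB.
by have -> : a = b; [apply/eqP; rewrite eq_le ab|rewrite subrr].
Qed.

Lemma Rintegral_bound (phi : R -> R) (a b B : R) : a <= b ->
  measurable_fun setT phi -> (forall t, `|phi t| <= B) ->
  `|\int[leb]_(t in `[a, b[) phi t| <= B * (b - a).
Proof.
move=> ab mphi phiB.
have fin : (leb `[a, b[%classic < +oo)%E by exact: leb_itv_lty.
have iphi : leb.-integrable `[a, b[%classic (EFin \o phi).
  apply: measurable_bounded_integrable => //; first exact: measurable_funTS.
  by exists B; split; [exact: num_real|move=> y By t _ /=; rewrite (le_trans (phiB t))// ltW].
rewrite (le_trans (le_normr_Rintegral _ iphi))//.
apply: (@le_trans _ _ (\int[leb]_(t in `[a, b[) B)).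
  apply: le_Rintegral => //; first exact: integrable_norm.
  apply: (measurable_bounded_integrable (f := fun=> B)) => //; exact: bounded_cst.
by rewrite Rintegral_cst_itv.
Qed.

Variables (v0 : V -> R) (p0 : nat).
Hypothesis hv0 : state v0.
Hypothesis cfl : forall p, (p0 <= p)%N -> tstep p * mass (level_kern p) * L <= 1.

Let euler_state p n (pp : (p0 <= p)%N) : state (euler v0 p n) :=
  state_euler Psi0 Psi_nd L0 Psi_lip M0 s0 s1 hv0 cfl n pp.

Lemma measurable_evol p : (p0 <= p)%N ->
  measurable_fun setT (fun q : V * R => evol v0 p q.2 q.1).
Proof.
move=> pp _ Y mY; rewrite setTI.
pose tau (t : R) : R := (tindex p t)%:R.
have mtau : measurable_fun setT tau.
  have -> : tau = (fun t : R => (Num.truncn t)%:R : R) \o (fun t => t * 32 ^+ p) by [].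
  by apply: measurableT_comp; [exact: truncn_measurable|exact: measurable_funM].
rewrite (_ : _ @^-1` Y = \bigcup_n ((euler v0 p n @^-1` Y) `*` (tau @^-1` [set n%:R]))).
  apply: bigcupT_measurable => n; apply: measurableX.
    rewrite -[X in measurable X]setTI; have [[me _] _] := euler_state n pp.
    exact: me.
  by rewrite -[X in measurable X]setTI; exact: mtau.
apply/seteqP; split => [[x t] /= h|[x t] [n _ [/= h1 h2]]].
  by exists (tindex p t).
by move: h1; rewrite /evol; move/eqP: h2; rewrite /tau eqr_nat => /eqP ->.
Qed.

Lemma tindex_itv p j (t : R) : j%:R * tstep p <= t -> t < j.+1%:R * tstep p ->
  tindex p t = j.
Proof.
rewrite /tstep /tindex ler_pdivrMr ?exprn_gt0// ltr_pdivlMr ?exprn_gt0// => h1 h2.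
by apply: truncn_def; rewrite h1.
Qed.

Section test.
Variables (T C r : R) (f ft Lam : V * R -> R).
Hypothesis test : test_data T C r f ft Lam.

Let mf : measurable_fun setT f. Proof. by case: test => -[]. Qed.
Let mft : measurable_fun setT ft. Proof. by case: test => -[]. Qed.
Let C0 : 0 <= C. Proof. by case: test => _ []. Qed.
Let r0 : 0 <= r. Proof. by case: test => _ []. Qed.
Let T0 : 0 <= T. Proof. by case: test => _ []. Qed.
Let fC x t : `|f (x, t)| <= C * \1_(box r) x. Proof. by case: test => _ []. Qed.
Let ftC x t : `|ft (x, t)| <= C * \1_(box r) x. Proof. by case: test => _ []. Qed.
Let ftc x a b : 0 <= a -> a <= b -> b <= T ->
        \int[leb]_(t in `[a, b]) ft (x, t) = f (x, b) - f (x, a).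
Proof. by case: test => _ _ + _; apply. Qed.

Let indic_le1 (x : V) : C * \1_(box r) x <= C.
Proof. by rewrite ler_piMr// indicE lern1 leq_b1. Qed.

Let fC' x t : `|f (x, t)| <= C. Proof. exact: le_trans (fC x t) (indic_le1 x). Qed.
Let ftC' x t : `|ft (x, t)| <= C. Proof. exact: le_trans (ftC x t) (indic_le1 x). Qed.

Let mft_time x : measurable_fun setT (fun t => ft (x, t)).
Proof. exact: (measurable_fun_pair2 x mft). Qed.
Let mf_time x : measurable_fun setT (fun t => f (x, t)).
Proof. exact: (measurable_fun_pair2 x mf). Qed.

Let bounded_integrable (phi : R -> R) (a b B : R) : measurable_fun setT phi ->
  (forall t, `|phi t| <= B) -> leb.-integrable `[a, b[%classic (EFin \o phi).
Proof.
move=> mphi phiB; apply: measurable_bounded_integrable => //.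
- exact: leb_itv_lty.
- exact: measurable_funTS.
by exists B; split; [exact: num_real|move=> y By t _ /=; rewrite (le_trans (phiB t))// ltW].
Qed.

Let ftc_o x a b : 0 <= a -> a <= b -> b <= T ->
  \int[leb]_(t in `[a, b[) ft (x, t) = f (x, b) - f (x, a).
Proof.
move=> a0 ab bT; rewrite -(ftc x a0 ab bT) Rintegral_itv_bndo_bndc//.
exact: (bounded_integrable a b (mft_time x) (ftC' x)).
Qed.

Let f_lip x a b : 0 <= a -> a <= b -> b <= T -> `|f (x, a) - f (x, b)| <= C * (b - a).
Proof.
move=> a0 ab bT; rewrite distrC -(ftc_o x a0 ab bT).
exact: Rintegral_bound ab (mft_time x) (ftC' x).
Qed.

Section level.
Variable p : nat.
Hypothesis pp : (p0 <= p)%N.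

Let h : R := tstep p.
Let h0 : 0 < h. Proof. exact: tstep_gt0. Qed.
Let J := mass (level_kern p) * (L * M).
Let J0 : 0 <= J.
Proof. by rewrite !mulr_ge0// (mass_ge0 (@level_kernel R d s s0 s1 p)). Qed.

(** The integrand in time of the scheme tested against f: between grid times u
    is constant and the jump is spread uniformly over the step. *)
Definition flux (q : V * R) : R :=
  evol v0 p q.2 q.1 * ft q + jump (level_kern p) (evol v0 p q.2) q.1 * f q.

Let euler_b j x : `|euler v0 p j x| <= M.
Proof.
have [[_ /(_ x)/andP[e0 e1]] _] := euler_state j pp.
by rewrite ger0_norm.
Qed.

Let jump_b j x : `|jump (level_kern p) (euler v0 p j) x| <= J.
Proof. by apply: jump_bound; [exact: level_kernel|exact: euler_state]. Qed.

Lemma measurable_flux : measurable_fun setT flux.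
Proof.
have kK := @level_kernel R d s s0 s1 p; have [mK _ _ _] := kK.
have ma := measurable_evol pp.
have mPa : measurable_fun setT (fun q : V * R => Psi (evol v0 p q.2 q.1)).
  by apply: measurableT_comp => //; exact: (measurable_Psi Psi_nd).
apply: measurable_funD; apply: measurable_funM => //.
apply: measurable_funB; last by apply: measurable_funM => //.
have mg : measurable_fun setT
    (fun q : (V * R) * V => Psi (evol v0 p q.1.2 (q.1.1 + q.2))).
  have -> : (fun q : (V * R) * V => Psi (evol v0 p q.1.2 (q.1.1 + q.2))) =
    (fun q : V * R => Psi (evol v0 p q.2 q.1)) \o
    (fun q : (V * R) * V => (q.1.1 + q.2, q.1.2)) by [].
  apply: measurableT_comp => //; apply: measurable_fun_pair.
    have -> : (fun q : (V * R) * V => q.1.1 + q.2) =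
      (fun q : V * V => q.1 + q.2) \o (fun q : (V * R) * V => (q.1.1, q.2)) by [].
    apply: measurableT_comp; first exact: measurable_rV_add.
    apply: measurable_fun_pair; last exact: measurable_snd.
    by apply: measurableT_comp; [exact: measurable_fst|exact: measurable_fst].
  by apply: measurableT_comp; [exact: measurable_snd|exact: measurable_fst].
apply: (@measurable_kint _ _ _ kK _ _ (L * M) _ mg) => q.
exact: (ranged_Psi_norm Psi0 Psi_nd L0 Psi_lip (euler_state _ pp).1).
Qed.

Lemma flux_le x t : `|flux (x, t)| <= (M + J) * C * \1_(box r) x.
Proof.
rewrite (le_trans (ler_normD _ _))// !normrM mulrDl mulrDl lerD//.
  by rewrite -mulrA ler_pM//; exact: euler_b.
by rewrite -mulrA ler_pM//; exact: jump_b.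
Qed.

Let flux_time x : measurable_fun setT (fun t => flux (x, t)).
Proof. exact: (measurable_fun_pair2 x measurable_flux). Qed.

Let flux_b x t : `|flux (x, t)| <= (M + J) * C.
Proof.
rewrite (le_trans (flux_le x t))// ler_piMr//; first by rewrite mulr_ge0// addr_ge0.

Qed.

Let piece x j b : j%:R * h <= b -> b <= j.+1%:R * h -> b <= T ->
  \int[leb]_(t in `[j%:R * h, b[) flux (x, t) =
  euler v0 p j x * (f (x, b) - f (x, j%:R * h)) +
  jump (level_kern p) (euler v0 p j) x * \int[leb]_(t in `[j%:R * h, b[) f (x, t).
Proof.
move=> jb bj bT.
have i1 := bounded_integrable (j%:R * h) b (mft_time x) (ftC' x).
have i2 := bounded_integrable (j%:R * h) b (mf_time x) (fC' x).
have jh0 : 0 <= j%:R * h by rewrite mulr_ge0// ltW.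
rewrite -(ftc_o x jh0 jb bT) -RintegralZl// -[X in _ + X]RintegralZl//.
rewrite -RintegralD//; last 2 first.
- exact: (integrableZl _ _ i1).
- exact: (integrableZl _ _ i2).
apply: eq_Rintegral => t; rewrite inE/= in_itv/= => /andP[jt tb].
by rewrite /flux /= /evol (@tindex_itv p j t)// (lt_le_trans tb).
Qed.

Let split x a b : 0 <= a -> a <= b ->
  \int[leb]_(t in `[0, b[) flux (x, t) =
  \int[leb]_(t in `[0, a[) flux (x, t) + \int[leb]_(t in `[a, b[) flux (x, t).
Proof.
move=> a0 ab.
have E : `[0, b[%classic = `[0, a[%classic `|` `[a, b[%classic :> set R.
  by rewrite -itv_bndbnd_setU// bnd_simp.
rewrite E Rintegral_setU//.
- by rewrite -E; exact: (bounded_integrable _ _ (flux_time x) (flux_b x)).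
- apply/disj_setPS => t []/=; rewrite !in_itv/= => /andP[_ ta] /andP[+ _].
  by rewrite leNgt ta.
Qed.

(** Summation by parts over the steps. On each step, f differs from its value
    at the right end by at most C h, whence an error of order h^2 per step. *)
Lemma grid_identity x j : j%:R * h <= T ->
  `|\int[leb]_(t in `[0, j%:R * h[) flux (x, t)
    - euler v0 p j x * f (x, j%:R * h) + v0 x * f (x, 0)| <= j%:R * (h * C * h * J).
Proof.
elim: j => [_|j IH jT].
  rewrite !mul0r set_itv_ge ?bnd_simp ?ltxx// Rintegral_set0 /= sub0r addrC.
  by rewrite subrr normr0.
have hj : j%:R * h <= j.+1%:R * h by rewrite ler_wpM2r ?ler_nat// ltW.
have jh0 : 0 <= j%:R * h by rewrite mulr_ge0// ltW.
have jT' : j%:R * h <= T by exact: le_trans hj jT.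
have i2 := bounded_integrable (j%:R * h) (j.+1%:R * h) (mf_time x) (fC' x).
rewrite (split x jh0 hj) (piece x hj (lexx _) jT).
have hE : j.+1%:R * h - j%:R * h = h.
  by rewrite -(natr1 j) (mulrDl j%:R) mul1r addrAC subrr add0r.
have E : \int[leb]_(t in `[j%:R * h, j.+1%:R * h[) f (x, t) =
    \int[leb]_(t in `[j%:R * h, j.+1%:R * h[) (f (x, t) - f (x, j.+1%:R * h))
    + h * f (x, j.+1%:R * h).
  have ic : leb.-integrable `[j%:R * h, j.+1%:R * h[%classic
      (EFin \o (fun=> f (x, j.+1%:R * h))).
    apply: (@bounded_integrable (fun=> f (x, j.+1%:R * h)) _ _ C); first exact: measurable_cst.
    by move=> t; exact: fC'.
  by rewrite RintegralB// Rintegral_cst_itv// hE [h * _]mulrC subrK.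
set I' := \int[leb]_(t in _) (f (x, t) - _) in E.
have I'b : `|I'| <= C * h * h.
  rewrite /I'; apply: (@le_trans _ _ (C * h * (j.+1%:R * h - j%:R * h))); last by rewrite hE.
  pose w t := (f (x, t) - f (x, j.+1%:R * h)) * \1_(`[j%:R * h, j.+1%:R * h[%classic) t.
  have -> : \int[leb]_(t in `[j%:R * h, j.+1%:R * h[) (f (x, t) - f (x, j.+1%:R * h))
      = \int[leb]_(t in `[j%:R * h, j.+1%:R * h[) w t.
    by apply: eq_Rintegral => t tI; rewrite /w indicE tI mulr1.
  apply: Rintegral_bound => //.
    by apply: measurable_funM; [exact: measurable_funB|exact: measurable_indic].
  move=> t; rewrite /w indicE mem_setE in_itv/=.
  have [/andP[jt tj]|_] := boolP (_ <= t < _); last first.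
    by rewrite mulr0 normr0 !mulr_ge0// ltW.
  rewrite mulr1 (le_trans (f_lip x (le_trans jh0 jt) (ltW tj) jT))// ler_wpM2l//.
  by rewrite -[leRHS]hE lerD2l lerN2.
have uE : euler v0 p j.+1 x = euler v0 p j x + h * jump (level_kern p) (euler v0 p j) x.
  by rewrite /euler iterS.
rewrite uE E; move: (IH jT') (jump_b j x).
set A := \int[leb]_(t in _) _; set u := euler v0 p j x; set m := jump _ _ _.
set a := f (x, j%:R * h); set b := f (x, j.+1%:R * h).
move=> IHj mJ.
have -> : A + (u * (b - a) + m * (I' + h * b)) - (u + h * m) * b + v0 x * f (x, 0) =
  (A - u * a + v0 x * f (x, 0)) + m * I' by ring.
rewrite (le_trans (ler_normD _ _))// -(natr1 j) (mulrDl j%:R) mul1r lerD//.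
rewrite normrM (le_trans (ler_pM _ _ mJ I'b))// le_eqVlt; apply/orP; left; apply/eqP; ring.
Qed.

(** The last, incomplete step is treated separately: it costs one more error
    term of order h. *)
Lemma euler_pointwise x :
  `|\int[leb]_(t in `[0, T]) flux (x, t) - evol v0 p T x * f (x, T)
    + v0 x * f (x, 0)| <= (T + 1) * (C * (h * J)) * \1_(box r) x.
Proof.
have [bx|bx] := pselect (box r x); last first.
  have fz t : f (x, t) = 0.
    by apply/eqP; rewrite -normr_le0 (le_trans (fC x t))// indicE memNset// mulr0.
  rewrite indicE memNset// mulr0 !fz !mulr0 subr0 addr0.
  rewrite (_ : \int[leb]_(t in _) _ = 0) ?normr0//.
  rewrite /Rintegral (eq_integral (fun=> 0%E)) ?integral0// => t _.
  apply: congr1; apply/eqP; rewrite -normr_le0 (le_trans (flux_le x t))//.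
  by rewrite indicE memNset// mulr0.
rewrite indicE mem_set// mulr1.
set n := tindex p T.
have Th0 : 0 <= T * 32 ^+ p by rewrite mulr_ge0 ?exprn_ge0.
have nT : n%:R * h <= T by exact: tindex_le.
have Tn : T <= n.+1%:R * h.
  rewrite /h /tstep ler_pdivlMr ?exprn_gt0//.
  by have /andP[_ /ltW] := truncn_itv Th0.
have nh0 : 0 <= n%:R * h by rewrite mulr_ge0// ltW.
have iF := bounded_integrable 0 T (flux_time x) (flux_b x).
rewrite -Rintegral_itv_bndo_bndc// (split x nh0 nT) (piece x nT Tn (lexx _)).
have I := grid_identity x nT.
have B := Rintegral_bound nT (mf_time x) (fC' x).
move: I B (jump_b n x); rewrite /evol -/n.
set A := \int[leb]_(t in _) flux _; set D := \int[leb]_(t in _) f _.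
set u := euler v0 p n x; set m := jump _ _ _.
set a := f (x, n%:R * h); set b := f (x, T).
move=> I B mJ.
have -> : A + (u * (b - a) + m * D) - u * b + v0 x * f (x, 0) =
  (A - u * a + v0 x * f (x, 0)) + m * D by ring.
rewrite (le_trans (ler_normD _ _))// (mulrDl T) mul1r lerD//.
  rewrite (le_trans I)//.
  have -> : n%:R * (h * C * h * J) = n%:R * h * (C * (h * J)) by ring.
  by rewrite ler_wpM2r// mulr_ge0// mulr_ge0// ltW.
rewrite normrM.
have Dh : `|D| <= C * h.
  rewrite (le_trans B)// ler_wpM2l// lerBlDr.
  by rewrite (le_trans Tn)// -(natr1 n) (mulrDl n%:R) mul1r addrC.
rewrite (le_trans (ler_pM _ _ mJ Dh))// le_eqVlt; apply/orP; left; apply/eqP; ring.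
Qed.

End level.
End test.
End weak_form_of_scheme.

(** * The weak formulation up to an error *)

Section integrated_weak_form.
Context {R : realType} {d : nat}.
Local Notation V := 'rV[R]_d.
Local Notation mu := (lebesgue_rV R d).
Local Notation leb := (@lebesgue_measure R).
Variables (Psi : R -> R) (L M : R).
Hypotheses (Psi0 : Psi 0 = 0) (Psi_nd : {homo Psi : x y / x <= y})
  (L0 : 0 <= L) (Psi_lip : forall a b, `|Psi a - Psi b| <= L * `|a - b|)
  (M0 : 0 <= M).
Variable s : R.
Hypotheses (s0 : 0 < s) (s1 : s < 1).

Local Notation state := (@state R d M).
Local Notation N := (@levy_mass R d s).
Local Notation level_kern := (@level_kern R d s).
Local Notation evol := (@evol R d Psi s).
Local Notation jump := (@jump R d Psi).
Local Notation tail := (@tail R d s).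
Local Notation test_data := (@test_data R d s).

(** Self-adjointness of the jump operator; f is shifted by C to make it
    nonnegative. *)
Lemma jump_adjoint K u (f : V -> R) C r : jump_kernel K -> state u ->
  measurable_fun setT f -> (forall x, `|f x| <= C * \1_(box r) x) -> 0 <= C ->
  \int[mu]_x (jump K u x * f x) = \int[mu]_x (Psi (u x) * (convol K f x - mass K * f x)).
Proof.
move=> hK hu mf fC C0.
have fC' x : `|f x| <= C.
  by rewrite (le_trans (fC x))// ler_piMr// indicE lern1 leq_b1.
have Pi := state_Psi_integrable Psi0 Psi_nd L0 Psi_lip hu.
have mP := ranged_Psi Psi_nd hu.1.
have bP := ranged_Psi_bound Psi0 Psi_nd L0 Psi_lip hu.1.
have nP := ranged_Psi_norm Psi0 Psi_nd L0 Psi_lip hu.1.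
pose g x := f x + C.
have mg : measurable_fun setT g by exact: measurable_funD.
have bg x : 0 <= g x <= C + C.
  have := fC' x; rewrite ler_norml => /andP[f1 f2].
  by rewrite /g lerD2r f2 andbT -lerBlDr sub0r.
have adj : \int[mu]_x ((Psi \o u) x * convol K g x) = \int[mu]_x (convol K (Psi \o u) x * g x).
  by congr fine; exact: (convol_adjoint hK mP bP mg bg).
have cvg x : convol K g x = convol K f x + mass K * C.
  have cC (z : V) : `|cst (- C) z| <= C by rewrite normrN ger0_norm.
  have E := kintB hK (measurable_shiftl x mf) (fun z => fC' (x + z))
    (@measurable_cst _ _ _ _ _ (- C)) cC.
  have c1 : kint K (cst (- C)) = mass K * - C := kint_cst hK (- C).
  rewrite /convol (_ : kint K (fun z => g (x + z)) = kint K (fun z => f (x + z) - cst (- C) z)).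
    by rewrite E c1 mulrN opprK.
  by apply: eq_Rintegral => z _; rewrite opprK.
have cf_b x : `|convol K f x| <= mass K * C.
  rewrite (le_trans (normr_kint hK (measurable_shiftl x mf) (fun z => fC' (x + z))))//.
  rewrite -(kint_cst hK); apply: (le_kint hK (B := C)) => //.
  - by apply: measurableT_comp => //; exact: measurable_shiftl.
  - by move=> z; rewrite normr_id.
  - by move=> _; rewrite ger0_norm.
have mcf : measurable_fun setT (convol K f) by exact: (measurable_convol hK mf fC').
have cPi := convol_integrable hK mP bP Pi.
have i1 := integrable_mul_bounded Pi mcf cf_b.
have i2 := integrable_mul_bounded cPi mf fC'.
have i3 := integrable_mul_bounded Pi mf fC'.
have i3Z := integrableZl measurableT (mass K) i3.
have PZ := integrableZl measurableT (mass K * C) Pi.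
have cPZ := integrableZl measurableT C cPi.
have e1 : \int[mu]_x ((Psi \o u) x * convol K g x) =
    \int[mu]_x ((Psi \o u) x * convol K f x) + mass K * C * \int[mu]_x (Psi \o u) x.
  rewrite -(RintegralZl _ measurableT Pi) -(RintegralD measurableT i1 PZ).
  by apply: eq_Rintegral => x _; rewrite cvg; ring.
have e2 : \int[mu]_x (convol K (Psi \o u) x * g x) =
    \int[mu]_x (convol K (Psi \o u) x * f x) + C * \int[mu]_x convol K (Psi \o u) x.
  rewrite -(RintegralZl _ measurableT cPi) -(RintegralD measurableT i2 cPZ).
  by apply: eq_Rintegral => x _; rewrite /g; ring.
have e3 : \int[mu]_x convol K (Psi \o u) x = mass K * \int[mu]_x (Psi \o u) x.
  exact: (Rintegral_convol hK mP bP Pi).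
have e4 : \int[mu]_x ((Psi \o u) x * convol K f x) = \int[mu]_x (convol K (Psi \o u) x * f x).
  move: adj; rewrite e1 e2 e3 mulrA (mulrC C) => /addIr; exact.
have -> : \int[mu]_x (jump K u x * f x) =
    \int[mu]_x (convol K (Psi \o u) x * f x) - mass K * \int[mu]_x ((Psi \o u) x * f x).
  rewrite -(RintegralZl _ measurableT i3) -(RintegralB measurableT i2 i3Z).
  by apply: eq_Rintegral => x _; rewrite /jump /=; ring.
rewrite -e4 -(RintegralZl _ measurableT i3) -(RintegralB measurableT i1 i3Z).
by apply: eq_Rintegral => x _ /=; ring.
Qed.

Section test.
Variables (T C r : R) (f ft Lam : V * R -> R).
Hypothesis test : test_data T C r f ft Lam.

Let mf : measurable_fun setT f. Proof. by case: test => -[]. Qed.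
Let mft : measurable_fun setT ft. Proof. by case: test => -[]. Qed.
Let mLam : measurable_fun setT Lam. Proof. by case: test => -[]. Qed.
Let C0 : 0 <= C. Proof. by case: test => _ []. Qed.
Let r0 : 0 <= r. Proof. by case: test => _ []. Qed.
Let T0 : 0 <= T. Proof. by case: test => _ []. Qed.
Let fC x t : `|f (x, t)| <= C * \1_(box r) x. Proof. by case: test => _ []. Qed.
Let ftC x t : `|ft (x, t)| <= C * \1_(box r) x. Proof. by case: test => _ []. Qed.
Let LamE p x t :
  `|Lam (x, t) + (convol (level_kern p) (fun y => f (y, t)) x - mass (level_kern p) * f (x, t))|
          <= C * tail (2 ^- p) * \1_(box r) x.
Proof. by case: test. Qed.

Let indic01 (x : V) : 0 <= (\1_(box r) x : R) <= 1.
Proof. by rewrite indicE ler0n lern1 leq_b1. Qed.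

Let mbox1 : measurable_fun setT (\1_(box r) : V -> R).
Proof. by apply: measurable_indic; exact: measurable_box. Qed.

Let ibox (c : R) : mu.-integrable setT (EFin \o (fun x : V => c * \1_(box r) x)).
Proof. exact: (integrableZl measurableT c (integrable_box d r0)). Qed.

Let fC' x t : `|f (x, t)| <= C.
Proof. by rewrite (le_trans (fC x t))// ler_piMr//; case/andP: (indic01 x). Qed.

(** An integrable majorant of Lam: compare with the operator of level 0, whose
    kernel is integrable. *)
Definition Lam_dom (x : V) : R :=
  C * convol (level_kern 0) (\1_(box r)) x + (mass (level_kern 0) * C + C * tail 1) * \1_(box r) x.

Let kK := @level_kernel R d s s0 s1.

(** Convolution with an integrable kernel preserves integrability. *)
Lemma Lam_dom_integrable : mu.-integrable setT (EFin \o Lam_dom).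
Proof.
have ci := convol_integrable (kK 0) mbox1 indic01 (integrable_box d r0).
have i1 := integrableZl measurableT C ci.
exact: (integrableD measurableT i1 (ibox (mass (level_kern 0) * C + C * tail 1))).
Qed.

Lemma Lam_le x t : `|Lam (x, t)| <= Lam_dom x.
Proof.
have mft0 : measurable_fun setT (fun y => f (y, t)) by exact: measurable_slice.
set A := convol (level_kern 0) (fun y => f (y, t)) x.
have A1 : `|A| <= C * convol (level_kern 0) (\1_(box r)) x.
  have mb := measurable_shiftl x mbox1.
  have nb z : `|\1_(box r) (x + z)| <= 1 :> R.
    by have /andP[? ?] := indic01 (x + z); rewrite ger0_norm.
  rewrite (le_trans (normr_kint (kK 0) (measurable_shiftl x mft0) (fun z => fC' (x + z) t)))//.
  rewrite /convol -(kintZ (kK 0) _ mb nb).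
  apply: (le_kint (kK 0) (B := C)).
  - apply: measurableT_comp => //.
    exact: (measurable_shiftl (f := fun y => f (y, t)) x mft0).
  - by move=> z; rewrite normr_id; exact: fC'.
  - exact: measurable_funM.
  - by move=> z; rewrite normrM (ger0_norm C0) ler_piMr.
  - by move=> z; exact: fC.
have := LamE 0 x t; rewrite expr0 invr1 -/A => h.
have hB : `|mass (level_kern 0) * f (x, t)| <= mass (level_kern 0) * (C * \1_(box r) x).
  by rewrite normrM (ger0_norm (mass_ge0 (kK 0))) ler_wpM2l// (mass_ge0 (kK 0)).
set m := mass (level_kern 0) * f (x, t) in h hB *.
have -> : Lam (x, t) = (Lam (x, t) + (A - m)) - A + m by ring.
move: (Lam (x, t) + (A - m)) h => X h.
have n1 := ler_normD (X - A) m; have n2 := ler_normB X A.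
rewrite /Lam_dom (le_trans n1)// (le_trans (lerD n2 (lexx _)))//.
rewrite (le_trans (lerD (lerD h A1) hB))// le_eqVlt; apply/orP; left; apply/eqP; ring.
Qed.

(** The difference between the two sides of the weak formulation. *)
Definition weak_defect (v : V -> R) (U : V * R -> R) : R :=
  \int[leb]_(t in `[0, T]) \int[mu]_x (U (x, t) * ft (x, t))
  - \int[leb]_(t in `[0, T]) \int[mu]_x (Psi (U (x, t)) * Lam (x, t))
  - \int[mu]_x (U (x, T) * f (x, T)) + \int[mu]_x (v x * f (x, 0)).

Definition rangedT (U : V * R -> R) :=
  measurable_fun setT U /\ forall q, 0 <= U q <= M.

Lemma rangedT_Psi U q : rangedT U -> `|Psi (U q)| <= L * M.
Proof.
move=> [_ /(_ q)/andP[U0 U1]]; rewrite ger0_norm ?(Psi_ge0 Psi0 Psi_nd)//.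
by rewrite (le_trans (Psi_le Psi0 Psi_nd Psi_lip U0))// ler_wpM2l.
Qed.

Lemma dominated_ft U : rangedT U ->
  dominated (fun x => M * C * \1_(box r) x) (fun q => U q * ft q).
Proof.
move=> [mU U01]; split; first exact: measurable_funM.
move=> x t; rewrite normrM -mulrA ler_pM//.
by have /andP[? ?] := U01 (x, t); rewrite ger0_norm.
Qed.

Lemma dominated_f U : rangedT U ->
  dominated (fun x => M * C * \1_(box r) x) (fun q => U q * f q).
Proof.
move=> [mU U01]; split; first exact: measurable_funM.
move=> x t; rewrite normrM -mulrA ler_pM//.
by have /andP[? ?] := U01 (x, t); rewrite ger0_norm.
Qed.

Lemma dominated_Lam U : rangedT U ->
  dominated (fun x => L * M * Lam_dom x) (fun q => Psi (U q) * Lam q).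
Proof.
move=> hU; split.
  apply: measurable_funM => //; apply: measurableT_comp; last by case: hU.
  exact: (measurable_Psi Psi_nd).
by move=> x t; rewrite normrM ler_pM//; [exact: rangedT_Psi|exact: Lam_le].
Qed.

Variables (v0 : V -> R) (p0 : nat).
Hypothesis hv0 : state v0.
Hypothesis cfl : forall p, (p0 <= p)%N -> tstep p * mass (level_kern p) * L <= 1.

Let evol_state p t (pp : (p0 <= p)%N) : state (evol v0 p t) :=
  state_euler Psi0 Psi_nd L0 Psi_lip M0 s0 s1 hv0 cfl (tindex p t) pp.

Lemma rangedT_evol p : (p0 <= p)%N -> rangedT (fun q => evol v0 p q.2 q.1).
Proof.
move=> pp; split.
  exact: (measurable_evol Psi0 Psi_nd L0 Psi_lip M0 s0 s1 hv0 cfl pp).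
by move=> [x t]; have [[_ h] _] := evol_state t pp; exact: h.
Qed.

(** Integrate [euler_pointwise] in x, move the jump operator onto f by
    [jump_adjoint], and replace it by Lam at the cost [tail] at 2^-p. *)
Lemma evol_weak_defect p : (p0 <= p)%N ->
  `|weak_defect v0 (fun q => evol v0 p q.2 q.1)| <=
  2 ^- p * ((T + 1) * C * (N * (L * M)) * (r *+ 2) ^+ d)
  + tail (2 ^- p) * (T * (L * M * C * (r *+ 2) ^+ d)).
Proof.
move=> pp; have hU := rangedT_evol pp; have mK := mass_ge0 (kK p).
set U := fun q => evol v0 p q.2 q.1 in hU *.
have LM0 : 0 <= L * M by rewrite mulr_ge0.
have h0 := @tstep_ge0 R p.
pose F1 q := U q * ft q; pose F2 q := jump (level_kern p) (evol v0 p q.2) q.1 * f q.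
pose F3 q := Psi (U q) * Lam q.
pose J := mass (level_kern p) * (L * M).
have J0 : 0 <= J by rewrite mulr_ge0.
have dFl : dominated (fun x => (M + J) * C * \1_(box r) x) (flux Psi s v0 f ft p).
  split; first exact: (measurable_flux Psi0 Psi_nd L0 Psi_lip M0 s0 s1 hv0 cfl test pp).
  exact: (flux_le Psi0 Psi_nd L0 Psi_lip M0 s0 s1 hv0 cfl test pp).
have dF1 := dominated_ft hU; have dF3 := dominated_Lam hU.
have dF2 : dominated (fun x => J * C * \1_(box r) x) F2.
  split.
    have -> : F2 = (fun q => flux Psi s v0 f ft p q - F1 q).
      by apply/funext => q; rewrite /flux /F1 /U addrAC subrr add0r.
    by apply: measurable_funB; [exact: dFl.1|exact: dF1.1].
  move=> x t; rewrite /F2 /= normrM -[leRHS]mulrA; apply: ler_pM => //.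
  exact: (jump_bound Psi0 Psi_nd L0 Psi_lip M0 x (kK p) (evol_state t pp)).
have iMC := ibox (M * C); have iJC := ibox (J * C); have iMJC := ibox ((M + J) * C).
have iLam := integrableZl measurableT (L * M) Lam_dom_integrable.
have swap := iterated_Fubini iMJC T dFl.
have o1 := dominated_outer iMC T dF1; have o2 := dominated_outer iJC T dF2.
have o3 := dominated_outer iLam T dF3.
have mD : @measurable _ (measurableTypeR R) `[0, T]%classic by exact: measurable_itv.
have sumF : \int[leb]_(t in `[0, T]) \int[mu]_x flux Psi s v0 f ft p (x, t) =
    \int[leb]_(t in `[0, T]) \int[mu]_x F1 (x, t)
    + \int[leb]_(t in `[0, T]) \int[mu]_x F2 (x, t).
  rewrite -(RintegralD _ o1 o2)//; apply: eq_Rintegral => t _.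
  rewrite -RintegralD//; first exact: (dominated_slice iMC t dF1).
  exact: (dominated_slice iJC t dF2).
have adj t : `|\int[mu]_x F2 (x, t) + \int[mu]_x F3 (x, t)| <=
    L * M * C * tail (2 ^- p) * (r *+ 2) ^+ d.
  have mft0 : measurable_fun setT (fun y => f (y, t)) by exact: measurable_slice.
  have E2 := jump_adjoint (kK p) (evol_state t pp) mft0 (fun x => fC x t) C0.
  have i3 := dominated_slice iLam t dF3.
  pose A x := convol (level_kern p) (fun y => f (y, t)) x - mass (level_kern p) * f (x, t).
  have iP := state_Psi_integrable Psi0 Psi_nd L0 Psi_lip (evol_state t pp).
  have mA : measurable_fun setT A.
    apply: measurable_funB; last exact: measurable_funM.
    exact: (measurable_convol (kK p) mft0 (fun x => fC' x t)).
  have bA x : `|A x| <= Lam_dom x + C * tail (2 ^- p) * \1_(box r) x.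
    have -> : A x = (Lam (x, t) + A x) - Lam (x, t) by ring.
    rewrite [leRHS]addrC (le_trans (ler_normB _ _))// lerD ?Lam_le//.
    exact: LamE.
  have i2 : mu.-integrable setT (EFin \o (fun x => Psi (evol v0 p t x) * A x)).
    have iLt := integrableZl measurableT (L * M)
      (integrableD measurableT Lam_dom_integrable (ibox (C * tail (2 ^- p)))).
    apply: le_integrable iLt => //.
      apply/measurable_EFinP; apply: measurable_funM => //.
      by case/integrableP : iP => /measurable_EFinP.
    move=> x _ /=; rewrite lee_fin normrM [leRHS]normrM ler_pM//.
      rewrite (ger0_norm LM0); exact: (rangedT_Psi (x, t) hU).
    by rewrite (le_trans (bA x))// ler_norm.
  rewrite /F2 /= E2 /F3 /U /= -(RintegralD measurableT i2 i3).
  have iAL := integrableD measurableT i2 i3.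
  rewrite (le_trans (le_normr_Rintegral _ iAL))// -Rintegral_box//.
  apply: le_Rintegral => //; first exact: (integrable_norm iAL).
  move=> x _; rewrite -mulrDr normrM -!mulrA mulrA ler_pM//.
    exact: (rangedT_Psi (x, t) hU).
  by rewrite addrC mulrA LamE.
have diff : `|\int[leb]_(t in `[0, T]) \int[mu]_x F2 (x, t)
    + \int[leb]_(t in `[0, T]) \int[mu]_x F3 (x, t)| <=
    L * M * C * tail (2 ^- p) * (r *+ 2) ^+ d * T.
  have o23 := integrableD mD o2 o3.
  rewrite -(RintegralD mD o2 o3) (le_trans (le_normr_Rintegral mD o23))//.
  apply: (@le_trans _ _ (\int[leb]_(t in `[0, T])
      (L * M * C * tail (2 ^- p) * (r *+ 2) ^+ d))).
    apply: (le_Rintegral mD (integrable_norm o23)) => //.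
    apply: (measurable_bounded_integrable
      (f := fun=> L * M * C * tail (2 ^- p) * (r *+ 2) ^+ d)) => //.
      - exact: leb_itv_lty.
      - exact: bounded_cst.
    by move=> t _; exact: adj.
  rewrite -[in leRHS](subr0 T) le_eqVlt; apply/orP; left; apply/eqP.
  exact: (Rintegral_cst_itv _ true false T0).
have iT := dominated_slice iMC T (dominated_f hU).
have iv0 : mu.-integrable setT (EFin \o (fun x => v0 x * f (x, 0))).
  have mf0 : measurable_fun setT (fun y => f (y, 0)) by exact: measurable_slice.
  exact: (integrable_mul_bounded hv0.2 mf0 (fun x => fC' x 0)).
have iflux : mu.-integrable setT
    (EFin \o (fun x => \int[leb]_(t in `[0, T]) flux Psi s v0 f ft p (x, t))).
  exact: (time_integral_integrable iMJC T dFl).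
have main : `|\int[mu]_x (\int[leb]_(t in `[0, T]) flux Psi s v0 f ft p (x, t))
    - \int[mu]_x (U (x, T) * f (x, T)) + \int[mu]_x (v0 x * f (x, 0))| <=
    (T + 1) * (C * (tstep p * J)) * (r *+ 2) ^+ d.
  have i1 := integrableB measurableT iflux iT.
  have i2 := integrableD measurableT i1 iv0.
  rewrite -(RintegralB measurableT iflux iT) -(RintegralD measurableT i1 iv0).
  rewrite (le_trans (le_normr_Rintegral _ i2))// -Rintegral_box//.
  apply: (le_Rintegral measurableT (integrable_norm i2) (ibox _)) => x _.
  exact: (euler_pointwise Psi0 Psi_nd L0 Psi_lip M0 s0 s1 hv0 cfl test pp x).
have -> : weak_defect v0 U =
   (\int[mu]_x (\int[leb]_(t in `[0, T]) flux Psi s v0 f ft p (x, t))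
    - \int[mu]_x (U (x, T) * f (x, T)) + \int[mu]_x (v0 x * f (x, 0)))
   - (\int[leb]_(t in `[0, T]) \int[mu]_x F2 (x, t)
    + \int[leb]_(t in `[0, T]) \int[mu]_x F3 (x, t)).
  by rewrite /weak_defect -swap sumF; ring.
rewrite (le_trans (ler_normB _ _))// lerD//.
  rewrite (le_trans main)//.
  have e1 := ler_wpM2r LM0 (@tstep_mass R d s s0 s1 p).
  have c0 : 0 <= (T + 1) * C * (r *+ 2) ^+ d.
    by rewrite mulr_ge0 ?exprn_ge0 ?mulrn_wge0// mulr_ge0// addr_ge0.
  have := ler_wpM2l c0 e1; rewrite /J.
  set P := (r *+ 2) ^+ d => e2.
  have -> : (T + 1) * (C * (tstep p * (mass (level_kern p) * (L * M)))) * P =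
    (T + 1) * C * P * (tstep p * mass (level_kern p) * (L * M)) by ring.
  by rewrite (le_trans e2)// le_eqVlt; apply/orP; left; apply/eqP; ring.
rewrite (le_trans diff)// le_eqVlt; apply/orP; left; apply/eqP; ring.
Qed.

End test.
End integrated_weak_form.

(** * Stability of the weak formulation *)

Section limits.
Context {R : realType} {d : nat}.
Local Notation V := 'rV[R]_d.
Local Notation mu := (lebesgue_rV R d).
Local Notation leb := (@lebesgue_measure R).
Variables (Psi : R -> R) (L M : R).
Hypotheses (Psi0 : Psi 0 = 0) (Psi_nd : {homo Psi : x y / x <= y})
  (L0 : 0 <= L) (Psi_lip : forall a b, `|Psi a - Psi b| <= L * `|a - b|)
  (M0 : 0 <= M).
Variable s : R.
Hypotheses (s0 : 0 < s) (s1 : s < 1).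

Local Notation state := (@state R d M).
Local Notation level_kern := (@level_kern R d s).
Local Notation evol := (@evol R d Psi s).
Local Notation tail := (@tail R d s).
Local Notation test_data := (@test_data R d s).
Local Notation rangedT := (@rangedT R d M).

Lemma Psi_cvg (u : R^nat) l : u k @[k --> \oo] --> l -> Psi (u k) @[k --> \oo] --> Psi l.
Proof.
move=> ul; apply/cvgrPdist_le => e e0.
have L1 : 0 < L + 1 by rewrite ltr_wpDl.
have eL : 0 < e / (L + 1) by rewrite divr_gt0.
move/cvgrPdist_le : ul => /(_ _ eL); apply: filterS => k h.
rewrite (le_trans (Psi_lip _ _))// (@le_trans _ _ ((L + 1) * `|l - u k|))//.
  by rewrite ler_wpM2r// lerDl.
by rewrite mulrC -ler_pdivlMr.
Qed.

(** Each of the four terms is dominated independently of k. *)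
Lemma weak_defect_cvg T C r f ft Lam (U_ : nat -> V * R -> R) U
    (v_ : nat -> V -> R) (v : V -> R) :
  test_data T C r f ft Lam ->
  (forall k, rangedT (U_ k)) -> rangedT U ->
  (forall k, measurable_fun setT (v_ k)) -> measurable_fun setT v ->
  (forall k x, `|v_ k x| <= M) -> (forall x, `|v x| <= M) ->
  (forall x, v_ k x @[k --> \oo] --> v x) ->
  (forall t, 0 <= t -> {ae mu, forall x, U_ k (x, t) @[k --> \oo] --> U (x, t)}) ->
  weak_defect Psi T f ft Lam (v_ k) (U_ k) @[k --> \oo] -->
  weak_defect Psi T f ft Lam v U.
Proof.
move=> test hU_ hU mv_ mv v_M vM v_v U_U.
have [[mf _ _] [C0 r0 T0 fC _] _ _] := test.
have ibox (c : R) : mu.-integrable setT (EFin \o (fun x : V => c * \1_(box r) x)).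
  exact: (integrableZl measurableT c (integrable_box d r0)).
have iLam := integrableZl measurableT (L * M) (Lam_dom_integrable s0 s1 test).
apply: cvgD; first apply: cvgB; first apply: cvgB.
- apply: (iterated_cvg (ibox (M * C)) (F := fun q => U q * ft q)
    (G := fun k q => U_ k q * ft q)).
  + exact: (dominated_ft test hU).
  + by move=> k; exact: (dominated_ft test (hU_ k)).
  + move=> t; rewrite /= in_itv/= => /andP[t0 _].
    by apply: filterS (U_U t t0) => x h; apply: cvgM => //; exact: cvg_cst.
- apply: (iterated_cvg iLam (F := fun q => Psi (U q) * Lam q)
    (G := fun k q => Psi (U_ k q) * Lam q)).
  + exact: (dominated_Lam Psi0 Psi_nd L0 Psi_lip s0 s1 test hU).
  + by move=> k; exact: (dominated_Lam Psi0 Psi_nd L0 Psi_lip s0 s1 test (hU_ k)).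
  + move=> t; rewrite /= in_itv/= => /andP[t0 _].
    by apply: filterS (U_U t t0) => x h; apply: cvgM; [exact: Psi_cvg|exact: cvg_cst].
- apply: (slice_cvg (ibox (M * C)) (F := fun q => U q * f q)
    (G := fun k q => U_ k q * f q)).
  + exact: (dominated_f test hU).
  + by move=> k; exact: (dominated_f test (hU_ k)).
  + by apply: filterS (U_U T T0) => x h; apply: cvgM => //; exact: cvg_cst.
- have dv (w : V -> R) : measurable_fun setT w -> (forall x : V, `|w x| <= M) ->
      dominated (fun x => M * C * \1_(box r) x) (fun q => w q.1 * f q).
    move=> mw wM; split; first by apply: measurable_funM => //; exact: measurableT_comp mw _.
    by move=> x t; rewrite normrM -mulrA ler_pM.
  apply: (slice_cvg (ibox (M * C)) (F := fun q => v q.1 * f q)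
    (G := fun k q => v_ k q.1 * f q) (t := 0)).
  + exact: dv.
  + by move=> k; exact: dv.
  + by apply: aeW => x; apply: cvgM; [exact: v_v|exact: cvg_cst].
Qed.

(** The upper limit is measurable and agrees with the limit where it exists;
    clipping keeps it in [0, M] everywhere. *)
Lemma rangedT_limit (a : nat -> V * R -> R) : (forall k, rangedT (a k)) ->
  exists2 U, rangedT U & forall q, cvgn (a ^~ q) -> a k q @[k --> \oo] --> U q.
Proof.
move=> ha; exists (fun q => Num.max 0 (Num.min M (limn_sup (a ^~ q)))).
  split.
    apply: measurable_maxr => //; apply: measurable_minr => //.
    apply: measurable_fun_limn_sup.
    - by move=> q _; exists M => _ [k _ <-]; have [_ /(_ q)/andP[]] := ha k.
    - by move=> q _; exists 0 => _ [k _ <-]; have [_ /(_ q)/andP[]] := ha k.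
    - by move=> k; case: (ha k).
  by move=> q; rewrite le_max lexx/= ge_max M0 ge_min lexx.
move=> q cq; rewrite (cvg_limn_supE cq).
have l0 : 0 <= limn (a ^~ q).
  by apply: limr_ge => //; apply: nearW => k; have [_ /(_ q)/andP[]] := ha k.
have lM : limn (a ^~ q) <= M.
  by apply: limr_le => //; apply: nearW => k; have [_ /(_ q)/andP[]] := ha k.
by rewrite (min_r lM) (max_r l0).
Qed.

(** The sum of the increments is integrable, hence finite almost everywhere. *)
Lemma ae_cvg_of_summable (g : nat -> V -> R) (K : nat) :
  (forall k, mu.-integrable setT (EFin \o g k)) ->
  (forall k, (K <= k)%N -> L1dist (g k) (g k.+1) 0 <= 2 ^- k) ->
  {ae mu, forall x, cvgn (g ^~ x)}.
Proof.
move=> ig gK.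
have mg k : measurable_fun setT (g k).
  by have /integrableP[/measurable_EFinP] := ig k.
pose D k x := `|g (k + K)%N x - g (k + K).+1 x|.
have mD k : measurable_fun setT (fun x => (D k x)%:E).
  by apply/measurable_EFinP; apply: measurableT_comp => //; exact: measurable_funB.
have D0 k x : (0 <= (D k x)%:E)%E by rewrite lee_fin normr_ge0.
pose S x := (\sum_(0 <= k <oo) (D k x)%:E)%E.
have mS : measurable_fun setT S by exact: ge0_emeasurable_sum.
have S0 x : (0 <= S x)%E by apply: nneseries_ge0 => k _ _; exact: D0.
have iS : mu.-integrable setT S.
  apply/integrableP; split => //.
  under eq_integral do rewrite gee0_abs//.
  rewrite integral_nneseries//.
  have le k : (\int[mu]_x (D k x)%:E <= (1 * (2^-1) ^+ k)%:E)%E.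
    rewrite mul1r exprVn (@le_trans _ _ (L1dist (g (k + K)%N) (g (k + K).+1) 0)%:E)//.
      rewrite L1distE// le_eqVlt; apply/orP; left; apply/eqP.
      by apply: eq_integral => x _; rewrite addr0.
    rewrite lee_fin (le_trans (gK _ (leq_addl _ _)))//.
    by rewrite lef_pV2 ?posrE ?exprn_gt0// ler_weXn2l ?ler1n// leq_addr.
  apply: (@le_lt_trans _ _ (\sum_(0 <= k <oo) (1 * (2^-1) ^+ k)%:E)%E).
    apply: lee_nneseries => [k _|k _].
      by move=> _; apply: integral_ge0 => x _; exact: D0.
    exact: le.
  apply: nneseries_geometric_lty => //.
  by rewrite invr_ge0 ler0n/= invf_lt1// ltr1n.
have := integrable_ae measurableT iS; apply: filterS => x /(_ I) Sx.
pose u k := g (k + K)%N x.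
have cu : cvgn u.
  have : cvgn [normed series (telescope u)].
    apply: nondecreasing_is_cvgn.
      by apply/nondecreasing_seqP => k; rewrite /= !seriesEnat/= big_nat_recr//= lerDl.
    exists (fine (S x)) => _ [k _ <-].
    rewrite /= seriesEnat -lee_fin fineK// -sumEFin.
    have -> : (\sum_(0 <= i < k) (`|telescope u i|)%:E = \sum_(0 <= i < k) (D i x)%:E)%E.
      by apply: eq_bigr => i _; rewrite /D /telescope distrC.
    by rewrite /S; apply: nneseries_lim_ge => i _ _; exact: D0.
  move=> /normed_cvg /cvg_ex[l]; rewrite telescopeK => hl.
  apply/cvg_ex; exists (l + u 0%N).
  have H : (fun k => (u k - u 0%N) + u 0%N) @ \oo --> l + u 0%N.
    exact: (cvgD hl (cvg_cst (u 0%N))).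
  have E : (fun k => (u k - u 0%N) + u 0%N) = u.
    by apply/funext => k; rewrite subrK.
  by rewrite E in H.
move/cvg_ex : cu => [l ul]; apply/cvg_ex; exists l.
by rewrite -(cvg_shiftn K).
Qed.

End limits.

(** * Solutions for bounded nonnegative data *)

Section existence.
Context {R : realType} {d : nat}.
Local Notation V := 'rV[R]_d.
Local Notation mu := (lebesgue_rV R d).
Local Notation leb := (@lebesgue_measure R).
Variables (Psi : R -> R) (L M : R).
Hypotheses (Psi0 : Psi 0 = 0) (Psi_nd : {homo Psi : x y / x <= y})
  (L0 : 0 <= L) (Psi_lip : forall a b, `|Psi a - Psi b| <= L * `|a - b|)
  (M0 : 0 <= M).
Variable s : R.
Hypotheses (s0 : 0 < s) (s1 : s < 1).

Local Notation state := (@state R d M).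
Local Notation level_kern := (@level_kern R d s).
Local Notation evol := (@evol R d Psi s).
Local Notation tail := (@tail R d s).
Local Notation test_data := (@test_data R d s).
Local Notation rangedT := (@rangedT R d M).

Lemma pow2_cvg0 : 2 ^- n @[n --> \oo] --> (0 : R).
Proof.
have : (fun n => (2^-1) ^+ n) @ \oo --> (0 : R).
  by apply: cvg_expr; rewrite ger0_norm ?invr_ge0// invf_lt1// ltr1n.
by rewrite (_ : (fun n => _) = (fun n => 2 ^- n))//; apply/funext => n; rewrite exprVn.
Qed.

Variable p0 : nat.
Hypothesis cfl : forall p, (p0 <= p)%N -> tstep p * mass (level_kern p) * L <= 1.

Lemma evol_le v v' p t : (p0 <= p)%N -> state v -> state v' ->
  (forall x, v x <= v' x) -> forall x, evol v p t x <= evol v' p t x.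
Proof.
move=> pp hv hv' vv'; rewrite /evol; elim: (tindex p t) => [//|n IH] x.
have hu := state_euler Psi0 Psi_nd L0 Psi_lip M0 s0 s1 hv cfl n pp.
have hu' := state_euler Psi0 Psi_nd L0 Psi_lip M0 s0 s1 hv' cfl n pp.
have kp := @level_kernel R d s s0 s1 p.
exact: (step_le Psi0 Psi_nd L0 Psi_lip kp (@tstep_ge0 R p) (cfl pp) hu.1 hu'.1 IH).
Qed.

(** Choose the scale of the bump from the modulus of continuity of v, then let
    p grow. *)
Lemma evol_cauchy v r T eps : state v -> 0 <= r -> (forall x, ~ box r x -> v x = 0) ->
  0 < eps -> exists P, forall p q t, (P <= p)%N -> (p <= q)%N -> 0 <= t -> t <= T ->
    L1dist (evol v p t) (evol v q t) 0 <= eps.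
Proof.
move=> hv r0 vr eps0.
have vM x : `|v x| <= M by have /andP[? ?] := hv.1.2 x; rewrite ger0_norm.
have e4 : 0 < eps / 4 by rewrite divr_gt0.
have [eta /andP[eta0 eta1] Hom] := modulus_small r0 e4 hv.1.1 vM vr.
pose b p := 2 ^- p * @time_const R d L s v T + tail (2 ^- p) * @space_const R d L v T eta.
have b0 : b p @[p --> \oo] --> (0 : R).
  rewrite -[X in _ --> X](addr0 0) -[X in _ --> X + _](mul0r (@time_const R d L s v T)).
  rewrite -[X in _ --> _ + X](mul0r (@space_const R d L v T eta)).
  apply: cvgD; apply: cvgM; [exact: pow2_cvg0|exact: cvg_cst| |exact: cvg_cst].
  exact: tail_cvg0.
have e2 : 0 < eps / 2 by rewrite divr_gt0.
move/cvgrPdist_le : b0 => /(_ _ e2)[P _ HP].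
exists (maxn P p0) => p q t; rewrite geq_max => /andP[Pp pp] pq t0 tT.
rewrite (le_trans (evol_cauchy_bound Psi0 Psi_nd L0 Psi_lip M0 s0 s1 hv cfl pp pq t0 tT
  eta0 eta1 Hom))//.
have := HP p Pp; rewrite /= sub0r normrN => h.
have := le_trans (ler_norm _) h; rewrite /b => {}h.
have E : eps = eps / 2 + 2 * (eps / 4) by field.
by rewrite addrAC [leRHS]E lerD2r.
Qed.

Variable w0 : V -> R.
Hypotheses (mw0 : measurable_fun setT w0) (w0M : forall x, 0 <= w0 x <= M).

Let vn (n : nat) (x : V) : R := w0 x * \1_(box n%:R) x.

Let state_vn n : state (vn n).
Proof.
have mb : measurable_fun setT (vn n).
  by apply: measurable_funM => //; apply: measurable_indic; exact: measurable_box.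
have bd x : 0 <= vn n x <= M * \1_(box n%:R) x.
  have /andP[a b] := w0M x; rewrite /vn mulr_ge0//= ?indicE ?ler0n//.
  by rewrite ler_wpM2r// ler0n.
split.
  split=> // x; have /andP[-> /= h] := bd x; rewrite (le_trans h)// ler_piMr//.
apply: (le_integrable measurableT _ _
   (integrableZl measurableT M (integrable_box d (ler0n R n)))).
  exact/measurable_EFinP.
move=> x _ /=; have /andP[a b] := bd x; rewrite lee_fin ger0_norm//.
by rewrite (le_trans b)// ler_norm.
Qed.

Let vn0 n x : ~ box n%:R x -> vn n x = 0.
Proof. by move=> h; rewrite /vn indicE memNset// mulr0. Qed.

Let vn_le n m x : (n <= m)%N -> vn n x <= vn m x.
Proof.
move=> nm; have /andP[a _] := w0M x; rewrite ler_wpM2l// !indicE ler_nat.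
have [h|h] := pselect (box n%:R x); last by rewrite memNset.
by rewrite !mem_set//; apply: sub_box h; rewrite ler_nat.
Qed.

Let vn_cvg x : vn k x @[k --> \oo] --> w0 x.
Proof.
apply: cvg_near_cst; exists (Num.bound (enorm x)) => // k /= kx.
rewrite /vn indicE mem_set ?mulr1//; apply: enorm_box.
have := archi_boundP (enorm_ge0 x) => /ltW h; rewrite (le_trans h)// ler_nat//.
Qed.

(** A diagonal choice: the level p_ k is good for the first k data up to time
    k, so that one sequence serves all data at all times. *)
Lemma common_levels : exists2 p_ : nat -> nat, (forall k, (p0 <= p_ k)%N /\ (k <= p_ k)%N) &
  forall n t, 0 <= t -> exists K, forall k, (K <= k)%N ->
    L1dist (evol (vn n) (p_ k) t) (evol (vn n) (p_ k.+1) t) 0 <= 2 ^- k.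
Proof.
have /choice[P HP] (nk : nat * nat) : exists P, forall p q t, (P <= p)%N -> (p <= q)%N ->
    0 <= t -> t <= nk.2%:R -> L1dist (evol (vn nk.1) p t) (evol (vn nk.1) q t) 0 <= 2 ^- nk.2.
  have [P HP] := evol_cauchy nk.2%:R (state_vn nk.1) (ler0n R nk.1) (@vn0 nk.1)
    (@pow2_gt0 R nk.2).
  by exists P.
pose th k := (\max_(n < k.+1) P (n : nat, k))%N.
(* p0 ensures stability, k makes the levels tend to infinity, and the running
   maximum makes them monotone and above the thresholds *)
exists (fun k => (p0 + k + \max_(j < k.+1) th j)%N) => [k|n t t0].
  by split; rewrite -addnA ?leq_addr// addnCA leq_addr.
exists (maxn n (Num.bound t)) => k; rewrite geq_max => /andP[nk tk].
apply: (HP (n, k)) => //=.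
- apply: (@leq_trans (th k)).
    by rewrite /th; exact: (leq_bigmax (Ordinal (n:=k.+1) (m:=n) nk)).
  apply: leq_trans (leq_addl _ _).
  exact: (@leq_bigmax _ (fun j : 'I_k.+1 => th j) ord_max).
- apply: leq_add; first by rewrite leq_add2l.
  by rewrite [leqRHS]big_ord_recr/= leq_maxl.
- have := archi_boundP t0 => /ltW h; rewrite (le_trans h)// ler_nat//.
Qed.

(** For data with bounded support the scheme converges along [common_levels];
    monotonicity in the datum then gives convergence as the boxes grow. *)
Lemma solution_exists : exists2 U, rangedT U &
  forall T C r f ft Lam, test_data T C r f ft Lam -> weak_defect Psi T f ft Lam w0 U = 0.
Proof.
have [p_ hp Hp] := common_levels.
pose a n k (q : V * R) := evol (vn n) (p_ k) q.2 q.1.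
have ra n k : rangedT (a n k).
  exact: (rangedT_evol Psi0 Psi_nd L0 Psi_lip M0 s0 s1 (state_vn n) cfl (hp k).1).
have /choice[U_ HU] n : exists Un, rangedT Un /\
    forall q, cvgn ((a n) ^~ q) -> a n k q @[k --> \oo] --> Un q.
  by have [Un ? ?] := rangedT_limit M0 (ra n); exists Un.
have aU n t : 0 <= t -> {ae mu, forall x, a n k (x, t) @[k --> \oo] --> U_ n (x, t)}.
  move=> t0; have [K HK] := Hp n t t0.
  have ig k : mu.-integrable setT (EFin \o (fun x => a n k (x, t))).
    exact: (state_euler Psi0 Psi_nd L0 Psi_lip M0 s0 s1 (state_vn n) cfl
      (tindex (p_ k) t) (hp k).1).2.
  have := ae_cvg_of_summable ig HK; apply: filterS => x h.
  by apply: (HU n).2; exact: h.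
have vM n x : `|vn n x| <= M.
  by have /andP[? ?] := (state_vn n).1.2 x; rewrite ger0_norm.
have Un0 n T C r f ft Lam : test_data T C r f ft Lam ->
    weak_defect Psi T f ft Lam (vn n) (U_ n) = 0.
  move=> test.
  have H := weak_defect_cvg Psi0 Psi_nd L0 Psi_lip s0 s1 test (ra n) (HU n).1
    (fun=> (state_vn n).1.1) (state_vn n).1.1 (fun=> vM n) (vM n)
    (fun x => cvg_cst (vn n x)) (aU n).
  apply/eqP; rewrite -normr_le0; apply/ler_addgt0Pl => e e0; rewrite addr0.
  pose b k := 2 ^- (p_ k) * ((T + 1) * C * (@levy_mass R d s * (L * M)) * (r *+ 2) ^+ d)
    + tail (2 ^- (p_ k)) * (T * (L * M * C * (r *+ 2) ^+ d)).
  have hb k : `|weak_defect Psi T f ft Lam (vn n) (a n k)| <= b k.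
    exact: (evol_weak_defect Psi0 Psi_nd L0 Psi_lip M0 s0 s1 test (state_vn n) cfl (hp k).1).
  have pinf : p_ @ \oo --> \oo.
    move=> A [N _ NA]; exists N => // k /= Nk; apply: NA => /=.
    exact: leq_trans Nk (hp k).2.
  have b0 : b k @[k --> \oo] --> (0 : R).
    rewrite -[X in _ --> X](addr0 0).
    rewrite -[X in _ --> X + _](mul0r ((T + 1) * C * (@levy_mass R d s * (L * M)) * (r *+ 2) ^+ d)).
    rewrite -[X in _ --> _ + X](mul0r (T * (L * M * C * (r *+ 2) ^+ d))).
    apply: cvgD; apply: cvgM; [|exact: cvg_cst| |exact: cvg_cst].
      by apply: (cvg_comp p_ (fun n => 2 ^- n) pinf); exact: pow2_cvg0.
    by apply: (cvg_comp p_ (fun n => tail (2 ^- n)) pinf); exact: tail_cvg0.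
  have le : `|weak_defect Psi T f ft Lam (vn n) (U_ n)| <= 0.
    apply: (ler_cvg_to (f := fun k => `|weak_defect Psi T f ft Lam (vn n) (a n k)|)) b0 _.
      by apply: cvg_norm; exact: H.
    by apply: nearW => k; exact: hb.
  by rewrite (le_trans le)// ltW.
(* the countably many exceptional sets depend on t only, which is enough since the
   weak formulation integrates in x first *)
have UU t : 0 <= t -> {ae mu, forall x, cvgn (U_ ^~ (x, t))}.
  move=> t0.
  have /ae_foralln := fun n => aU n t t0; apply: filterS => x h.
  apply: nondecreasing_is_cvgn.
    apply/nondecreasing_seqP => n; apply: (ler_cvg_to (h n) (h n.+1)).
    apply: nearW => k; rewrite /a /=.
    exact: (evol_le t (hp k).1 (state_vn n) (state_vn n.+1) (fun y => vn_le y (leqnSn n)) x).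
  exists M => _ [n _ <-]; by have [[_ /(_ (x, t))/andP[]]] := HU n.
have [U rU HU'] := rangedT_limit M0 (fun n => (HU n).1).
exists U => // T C r f ft Lam test.
have w0M' x : `|w0 x| <= M by have /andP[? ?] := w0M x; rewrite ger0_norm.
have H : weak_defect Psi T f ft Lam (vn k) (U_ k) @[k --> \oo] -->
    weak_defect Psi T f ft Lam w0 U.
  apply: (weak_defect_cvg Psi0 Psi_nd L0 Psi_lip s0 s1 test (fun n => (HU n).1) rU
    (fun n => (state_vn n).1.1) mw0 vM w0M' vn_cvg).
  by move=> t t0; apply: filterS (UU t t0) => x; exact: HU'.
have E : (fun k => weak_defect Psi T f ft Lam (vn k) (U_ k)) = cst 0.
  by apply/funext => k /=; exact: Un0 test.
rewrite E in H.
have <- := cvg_lim (@norm_hausdorff _ R) H.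
by apply: (cvg_lim (@norm_hausdorff _ R)); exact: cvg_cst.
Qed.

End existence.

(** * The principal value as a limit of jump operators *)

Section principal_value.
Context {R : realType} {d : nat}.
Local Notation V := 'rV[R]_d.
Local Notation mu := (lebesgue_rV R d).
Variable s : R.
Hypotheses (s0 : 0 < s) (s1 : s < 1).
Local Notation tail := (@tail R d s).
Local Notation kern := (@kern R d s).

Lemma integral_shift (F : V -> R) w : measurable_fun setT F ->
  \int[mu]_x F (x + w) = \int[mu]_x F x.
Proof.
move=> mF; congr fine; rewrite integralE [RHS]integralE.
have mE : measurable_fun setT (EFin \o F) by exact/measurable_EFinP.
have Hp := ge0_integral_rV_shift w (f := (EFin \o F)^\+%E) (measurable_funepos mE)
  (funepos_ge0 _).
have Hn := ge0_integral_rV_shift w (f := (EFin \o F)^\-%E) (measurable_funeneg mE)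
  (funeneg_ge0 _).
congr (_ - _)%E.
  by transitivity (\int[mu]_x (EFin \o F)^\+ (x + w)%R)%E;
    [apply: eq_integral => x _; rewrite !funeposE|exact: Hp].
by transitivity (\int[mu]_x (EFin \o F)^\- (x + w)%R)%E;
  [apply: eq_integral => x _; rewrite !funenegE|exact: Hn].
Qed.

(** Letting q tend to infinity preserves the bound. *)
Lemma cvgn_modulus (a b : R^nat) : (forall p q, (p <= q)%N -> `|a q - a p| <= b p) ->
  b n @[n --> \oo] --> (0 : R) -> cvgn a /\ forall p, `|limn a - a p| <= b p.
Proof.
move=> ab b0.
have ca : cvgn a.
  apply/cauchy_cvgP; apply/cauchyP => e e0.
  have /cvgrPdist_lt/(_ _ e0)[p _ Hp] := b0.
  exists (a p); exists p => // q /= pq; rewrite /ball /= distrC.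
  rewrite (le_lt_trans (ab _ _ pq))//.
  by rewrite (le_lt_trans _ (Hp p (leqnn p)))//= sub0r normrN ler_norm.
split=> // p.
have H : (fun q => `|a q - a p|) @ \oo --> `|limn a - a p|.
  by apply: cvg_norm; apply: (cvgB ca); exact: cvg_cst.
apply: (ler_cvg_to H (cvg_cst (b p))).
by exists p => // q /= pq; exact: ab.
Qed.

Section one_function.
Variables (B C r : R) (g : V -> R).
Hypotheses (mg : measurable_fun setT g) (gB : forall x, `|g x| <= B)
  (C0 : 0 <= C) (gC : second_diff C r g).

Definition pv_defect (e : R) (x : V) := mass (kern e) * g x - convol (kern e) g x.

(** Change variables y = x + z. *)
Lemma truncated_integral e x : 0 < e -> e <= 1 ->
  \int[mu]_(y in [set y | e < enorm (x - y)])
     ((g x - g y) / enorm (x - y) `^ (d%:R + 2 * s)) = pv_defect e x.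
Proof.
move=> e0 e1; have hK := @kern_kernel R d s s0 s1 e e0 e1.
pose F y := kern e (y - x) * (g x - g y).
have mF : measurable_fun setT F.
  apply: measurable_funM; last exact: measurable_funB.
  have := measurable_shiftl (- x) (measurable_kern s e).
  by under [X in measurable_fun _ X -> _]eq_fun do rewrite addrC.
have -> : pv_defect e x = \int[mu]_y F y.
  rewrite -(integral_shift x mF) /pv_defect -(kint_cst hK).
  rewrite -(kintB hK (B := B) (@measurable_cst _ _ _ _ _ (g x)) (fun=> gB x)
    (measurable_shiftl x mg) (fun z => gB (x + z))).
  by apply: eq_Rintegral => z _; rewrite /F addrK (addrC z).
rewrite /Rintegral integral_mkcond; congr fine; apply: eq_integral => y _.
rewrite patchE /F /kern -(enormN (x - y)) opprB.
have [h|h] := ltP e (enorm (y - x)).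
  by rewrite mem_set//= -?(enormN (x - y)) ?opprB// mul1r mulrC.
rewrite memNset ?mul0r ?mul0r//= -(enormN (x - y)) opprB => h'.
by move: h; rewrite leNgt h'.
Qed.

(** The two kernels differ by a kernel of short jumps, to which
    [second_diff_convol] applies. *)
Lemma pv_defect_close e e' x : 0 < e -> e <= e' -> e' <= 1 ->
  `|pv_defect e x - pv_defect e' x| <= C * tail e' * \1_(box r) x.
Proof.
move=> e0 ee' e1; have e0' := lt_le_trans e0 ee'; have e1' := le_trans ee' e1.
have hK := @kern_kernel R d s s0 s1 e e0 e1'.
have hK' := @kern_kernel R d s s0 s1 e' e0' e1.
have hk := @kern_diff_kernel R d s s0 s1 _ _ e0 ee' e1.
have KE z : kern e z = kern e' z + (kern e z - kern e' z) by rewrite addrC subrK.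
have mE := massD hK' hk KE.
have cE : convol (kern e) g x = _ :=
  kintD hK' hk KE (measurable_shiftl x mg) (fun z => gB (x + z)).
have := second_diff_convol s0 s1 hk (ltW e0') e1
    (fun z => kern_diff_near_levy s z e0 ee' e1) mg gB C0 gC x.
rewrite /pv_defect mE cE -[kint (kern e') _]/(convol (kern e') g x).
rewrite -[kint _ _]/(convol (fun z => kern e z - kern e' z) g x) -normrN.
set a := convol (fun z => _) _ _; set m := mass (fun z => _).
by have -> : (mass (kern e') + m) * g x - (convol (kern e') g x + a)
  - (mass (kern e') * g x - convol (kern e') g x) = - (a - m * g x) by ring.
Qed.

Let modulus_cvg (x : V) : C * tail (2 ^- p) * \1_(box r) x @[p --> \oo] --> (0 : R).
Proof.
rewrite -(mul0r (\1_(box r) x)) -(mulr0 C).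
apply: cvgM; last exact: cvg_cst.
by apply: cvgM; [exact: cvg_cst|exact: tail_cvg0].
Qed.

(** The limit along dyadic truncations; [fracLapE] identifies it with the
    limit along all of them. *)
Definition pv (x : V) : R := limn (fun p => pv_defect (2 ^- p) x).

Let pv_cauchy x p q : (p <= q)%N ->
  `|pv_defect (2 ^- q) x - pv_defect (2 ^- p) x| <= C * tail (2 ^- p) * \1_(box r) x.
Proof. by move=> pq; apply: pv_defect_close; rewrite ?pow2_gt0 ?pow2_le1 ?le_pow2. Qed.

Lemma pv_is_cvg x : cvgn (fun p => pv_defect (2 ^- p) x).
Proof. by have [] := cvgn_modulus (@pv_cauchy x) (@modulus_cvg x). Qed.

Lemma pv_near p x : `|pv x - pv_defect (2 ^- p) x| <= C * tail (2 ^- p) * \1_(box r) x.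
Proof. by have [_] := cvgn_modulus (@pv_cauchy x) (@modulus_cvg x); exact. Qed.

(** Every truncation at a scale below 2^-p is within C times [tail] at 2^-p of
    the one at scale 2^-p, by [pv_defect_close]. *)
Lemma fracLapE x : fracLap s g x = fracLap_const d s * pv x.
Proof.
rewrite /fracLap; congr (_ * _); apply: cvg_lim => //.
apply/cvgrPdist_le => e e0; have e2 : 0 < e / 2 by rewrite divr_gt0.
have /cvgrPdist_le/(_ _ e2)[p _ Hp] := modulus_cvg x.
near=> eps.
have eps0 : 0 < eps by near: eps; exact: nbhs_right_gt.
have epsp : eps <= 2 ^- p.
  by near: eps; apply: nbhs_right_le; exact: pow2_gt0.
have eps1 : eps <= 1 by rewrite (le_trans epsp)// pow2_le1.
rewrite truncated_integral//.
have h1 := pv_near p x; have h2 := pv_defect_close x eps0 epsp (@pow2_le1 R p).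
have h3 := Hp p (leqnn p).
have h4 : C * tail (2 ^- p) * \1_(box r) x <= e / 2.
  by rewrite (le_trans _ h3)//= sub0r normrN ler_norm.
have -> : pv x - pv_defect eps x = (pv x - pv_defect (2 ^- p) x)
   - (pv_defect eps x - pv_defect (2 ^- p) x) by ring.
rewrite (le_trans (ler_normB _ _))// [leRHS](splitr e) lerD//.
  exact: le_trans h4.
exact: le_trans h4.
Unshelve. all: by end_near. Qed.

End one_function.
End principal_value.

(** * Continuous functions are measurable for the product structure *)

Section continuous_measurable.
Context {R : realType} {d : nat}.
Local Notation V := 'rV[R]_d.

Let cell k (q : V * R) : 'rV[int]_d * int :=
  (\row_i Num.floor (2 ^+ k * q.1 ord0 i), Num.floor (2 ^+ k * q.2)).

Let corner k (c : 'rV[int]_d * int) : V * R :=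
  (\row_i ((c.1 ord0 i)%:~R / 2 ^+ k), c.2%:~R / 2 ^+ k).

Let floor_fiber k (f : V * R -> R) (m : int) : measurable_fun setT f ->
  measurable [set q | Num.floor (2 ^+ k * f q) = m].
Proof.
move=> mf.
have mfl : measurable_fun setT (fun y : R => (Num.floor (2 ^+ k * y))%:~R : R).
  apply: nondecreasing_measurable => // x y xy.
  by rewrite ler_int; apply: le_floor; rewrite ler_wpM2l ?exprn_ge0.
have mg : measurable_fun setT (fun q => (Num.floor (2 ^+ k * f q))%:~R : R).
  exact: (measurableT_comp mfl mf).
rewrite (_ : [set q | _] = setT `&` (fun q => (Num.floor (2 ^+ k * f q))%:~R : R) @^-1`
    [set m%:~R]); first exact: mg.
rewrite setTI; apply/seteqP; split=> q /=; first by move=> ->.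
by move/eqP; rewrite eqr_int => /eqP.
Qed.

Let cell_fiber k c : measurable [set q | cell k q = c].
Proof.
rewrite (_ : [set q | _] = (\bigcap_(i in [set: 'I_d])
   [set q : V * R | Num.floor (2 ^+ k * q.1 ord0 i) = c.1 ord0 i]) `&`
   [set q | Num.floor (2 ^+ k * q.2) = c.2]); last first.
  case: c => c1 c2; apply/seteqP; split=> q /=.
    by move=> [<- <-]; split=> // i _ /=; rewrite mxE.
  by move=> [h1 h2]; congr pair => //; apply/rowP => i; rewrite mxE; exact: h1.
apply: measurableI; last exact: (@floor_fiber k snd c.2 measurable_snd).
apply: fin_bigcap_measurable => // i _.
apply: (@floor_fiber k (fun q => q.1 ord0 i)).
exact: (measurableT_comp (measurable_rV_coord i) measurable_fst).
Qed.

Let corner_cell k q : `|q - corner k (cell k q)| <= 2 ^- k.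
Proof.
have e0 : 0 < 2 ^+ k :> R by rewrite exprn_gt0.
have H (y : R) : `|y - (Num.floor (2 ^+ k * y))%:~R / 2 ^+ k| <= 2 ^- k.
  set n := Num.floor _; have /andP[h1 h2] := floor_itv (2 ^+ k * y).
  have h0 : n%:~R / 2 ^+ k <= y by rewrite ler_pdivrMr// mulrC.
  rewrite ger0_norm ?subr_ge0// lerBlDr -[X in X + _]mul1r -mulrDl ler_pdivlMr// mulrC.
  by rewrite ltW// addrC; rewrite intrD in h2.
rewrite prod_normE ge_max /= H andbT [`|q.1 - _|]mx_normrE.
apply: bigmax_le => [|[i j] _]; first by rewrite invr_ge0 ltW.
by rewrite /= !mxE (ord1 i).
Qed.

(** Round all coordinates down to multiples of 2^-k: the rounded map takes
    countably many values on measurable cells, so its composition with h is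
    measurable, and it converges to h by continuity. *)
Lemma continuous_measurable_rV (h : V * R -> R) : continuous h -> measurable_fun setT h.
Proof.
move=> ch.
apply: (measurable_fun_cvg (h := fun k q => h (corner k (cell k q)))) => [k|q _]; last first.
  apply: continuous_cvg; first exact: ch.
  apply/cvgrPdist_le => e e0; have /cvgrPdist_le/(_ _ e0) := @pow2_cvg0 R.
  apply: filterS => k; rewrite sub0r normrN => hk; rewrite (le_trans (corner_cell k q))//.
  by rewrite (le_trans _ hk)// ler_norm.
pose H (n : nat) : R := oapp (fun c => h (corner k c)) 0 (unpickle n).
rewrite (_ : (fun q => _) = H \o (fun q => pickle (cell k q))); last first.
  by apply/funext => q; rewrite /H /= pickleK.
apply: measurableT_comp => // _ A mA; rewrite setTI.
rewrite (_ : _ @^-1` A = \bigcup_(n in A) [set q | pickle (cell k q) = n]); last first.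
  by apply/seteqP; split=> [q Aq|q [n An /= qn]]; [exists (pickle (cell k q))|rewrite /= qn].
apply: bigcup_measurable => n _.
case E : (@unpickle ('rV[int]_d * int)%type n) => [c|]; last first.
  rewrite (_ : [set q | _] = set0)// -subset0 => q /= qn.
  by move: E; rewrite -qn pickleK.
have [nc|nc] := eqVneq (pickle c) n; last first.
  rewrite (_ : [set q | _] = set0)// -subset0 => q /= qn.
  by move: E nc; rewrite -qn pickleK => -[->]; rewrite eqxx.
rewrite (_ : [set q | _] = [set q | cell k q = c]); first exact: cell_fiber.
apply/seteqP; split=> q /=; last by move=> ->.
by rewrite -nc => /(pcan_inj pickleK).
Qed.

End continuous_measurable.

(** * Calculus along lines *)

Section directional_calculus.
Context {R : realType} {d : nat}.
Local Notation V := 'rV[R]_d.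

Lemma is_derive_line (h : V * R -> R) q w (a : R) :
  (forall p, differentiable h p) ->
  is_derive a 1 (fun b : R => h (q + b *: w)) ('D_w h (q + a *: w)).
Proof.
move=> dh.
have E : (fun x : R => x^-1 *: (((fun b : R => h (q + b *: w)) \o shift a) (x *: 1) -
     h (q + a *: w))) =
   (fun x => x^-1 *: ((h \o shift (q + a *: w)) (x *: w) - h (q + a *: w))).
  apply/funext => x; congr (_ *: (h _ - _)).
  by rewrite /= [x *: 1]mulr1 scalerDl addrCA.
have dw := diff_derivable (v := w) (dh (q + a *: w)).
apply: DeriveDef; first by rewrite /derivable E; exact: dw.
by rewrite /derive E.
Qed.

Lemma mean_value_line (h : V * R -> R) q w (a b : R) :
  (forall p, differentiable h p) -> a <= b ->
  exists2 c : R, a <= c <= b & h (q + b *: w) - h (q + a *: w) = 'D_w h (q + c *: w) * (b - a).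
Proof.
move=> dh ab.
have [|c] := MVT_segment ab (fun x _ => is_derive_line q w x dh).
  apply: continuous_subspaceT => x; apply: differentiable_continuous.
  by apply/derivable1_diffP; have [] := is_derive_line q w x dh.
by rewrite in_itv /= => ? ?; exists c.
Qed.

Definition space_dir (i : 'I_d) : V * R := (delta_mx 0 i, 0).

(** A differential is linear, and z is a combination of the basis directions.
    This turns bounds on finitely many partial derivatives into bounds uniform
    in the direction. *)
Lemma derive_space_dir (h : V * R -> R) p (z : V) : differentiable h p ->
  'D_(z, 0) h p = \sum_i z 0 i * 'D_(space_dir i) h p.
Proof.
move=> dh; rewrite deriveE//.
have -> : (z, 0) = \sum_i z 0 i *: space_dir i :> V * R.
  rewrite [RHS]surjective_pairing; congr pair.
    by rewrite (big_morph fst (id1 := 0) (op1 := +%R))//; exact: row_sum_delta.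
  by rewrite (big_morph snd (id1 := 0) (op1 := +%R))// big1// => i _ /=; rewrite scaler0.
rewrite linear_sum; apply: eq_bigr => i _.
by rewrite linearZ deriveE.
Qed.

(** Compactness of the box times the time interval. *)
Lemma bounded_on_box (h : V * R -> R) (r T : R) : continuous h ->
  exists2 B, 0 <= B & forall x t, box r x -> 0 <= t <= T -> `|h (x, t)| <= B.
Proof.
move=> ch.
have cbox : compact (box r : set V).
  rewrite (_ : box r = [set v : V | forall i, `[- r, r]%classic (v ord0 i)]).
    exact: (@rV_compact R d (fun=> `[- r, r]%classic) (fun=> @segment_compact R (- r) r)).
  apply/seteqP; split=> x Bx i.
    by rewrite /= in_itv/= -ler_norml; exact: Bx.
  by have := Bx i; rewrite /= in_itv/= -ler_norml.
have := compact_setX cbox (@segment_compact R 0 T).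
move=> /(continuous_compact (continuous_subspaceT ch)) /compact_bounded[M [_ HM]].
exists (Num.max 0 (M + 1)) => [|x t bx tT]; first by rewrite le_max lexx.
apply: (HM (Num.max 0 (M + 1))); first by rewrite lt_max ltrDl ltr01 orbT.
by exists (x, t) => //; split => //=; rewrite in_itv.
Qed.

End directional_calculus.

Section slab_test_data.
Context {R : realType} {d : nat}.
Local Notation V := 'rV[R]_d.
Local Notation mu := (lebesgue_rV R d).
Local Notation leb := (@lebesgue_measure R).
Variable s : R.
Hypotheses (s0 : 0 < s) (s1 : s < 1).

Variables (T : R) (phi : V * R -> R).
Hypotheses (T0 : 0 < T) (test : slab_test T phi).

Let phi_diff p : differentiable phi p. Proof. by have [/(_ 1)[]] := test. Qed.
Let phi_cont : continuous phi. Proof. by have [/(_ 0)] := test. Qed.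

Definition time_derivative : V * R -> R := 'D_(0, 1) phi.

Let dt_cont : continuous time_derivative.
Proof. by have [/(_ 1%N)[_ H] _] := test; exact: H. Qed.

Lemma derive1_time x t : derive1 (fun r => phi (x, r)) t = time_derivative (x, t).
Proof.
rewrite derive1E /time_derivative /derive.
have -> // : (fun h : R => h^-1 *: (((fun r => phi (x, r)) \o shift t) (h *: 1) - phi (x, t)))
  = (fun h => h^-1 *: ((phi \o shift (x, t)) (h *: (0, 1)) - phi (x, t))).
apply/funext => h; congr (_ *: (phi _ - _)).
by congr pair => /=; rewrite scaler0 add0r.
Qed.

(** Only the part of the support over [0, T] is bounded, so nothing is claimed
    at other times. *)
Lemma slab_support : exists2 r, 0 <= r &
  forall x t, 0 <= t <= T -> ~ box r x -> phi (x, t) = 0.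
Proof.
have [_ /compact_bounded[M [_ HM]]] := test.
exists (Num.max 0 (M + 1)) => [|x t tT bx]; first by rewrite le_max lexx.
apply: contra_notP bx => /eqP phix i.
have H : `|(x, t)| <= Num.max 0 (M + 1).
  apply: (HM (Num.max 0 (M + 1))); first by rewrite lt_max ltrDl ltr01 orbT.
  exact: subset_closure.
apply: le_trans H; rewrite prod_normE le_max; apply/orP; left.
rewrite [leRHS]mx_normrE.
exact: (le_bigmax _ (fun ij : 'I_1 * 'I_d => `|x ij.1 ij.2|) (ord0, i)).
Qed.

Lemma time_line x (t : R) : (x, 0) + t *: (0, 1) = (x, t) :> V * R.
Proof.
by rewrite [LHS]surjective_pairing /= scaler0 addr0 add0r [_ *: _]mulr1.
Qed.

Lemma is_derive_time x (t : R) : is_derive t 1 (fun t => phi (x, t)) (time_derivative (x, t)).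
Proof.
have := is_derive_line (x, 0) (0, 1) t phi_diff; rewrite time_line.
by under eq_fun do rewrite time_line.
Qed.

Lemma FTC_slab x a b : a <= b ->
  \int[leb]_(t in `[a, b]) time_derivative (x, t) = phi (x, b) - phi (x, a).
Proof.
rewrite le_eqVlt => /predU1P[->|ab].
  by rewrite subrr set_itv1 Rintegral_set1.
have cslice (h : V * R -> R) : continuous h -> continuous (fun t => h (x, t)).
  move=> ch t; apply: (continuous_comp (f := fun t => (x, t)) (g := h)); last exact: ch.
  exact: (cvg_pair (cvg_cst x) cvg_id).
have cp := cslice _ phi_cont.
rewrite /Rintegral (continuous_FTC2 (F := fun t => phi (x, t)))//.
- by apply: continuous_subspaceT; exact: (cslice _ dt_cont).
- split.
  + by move=> t _; have [] := is_derive_time x t.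
  + by apply: cvg_at_right_filter; exact: cp.
  + by apply: cvg_at_left_filter; exact: cp.
- by move=> t _; rewrite derive1_time.
Qed.

(** On [0, T] the function vanishes identically; at the end points the
    derivative is computed from inside, as a one-sided limit. *)
Lemma time_derivative_support r : (forall x t, 0 <= t <= T -> ~ box r x -> phi (x, t) = 0) ->
  forall x t, 0 <= t <= T -> ~ box r x -> time_derivative (x, t) = 0.
Proof.
move=> phi0 x t /andP[t0 tT] bx.
have [dx <-] := is_derive_time x t; rewrite /derive.
set q := fun h => _; have qc : cvg (q @ 0^') by exact: dx.
have z u : 0 <= u <= T -> phi (x, u) = 0 by move=> uT; exact: phi0 bx.
have zt : phi (x, t) = 0 by apply: z; rewrite t0.
move: tT; rewrite le_eqVlt => /predU1P[tT|tT].
  have ql : q @ 0^'- --> lim (q @ 0^') by exact: cvg_dnbhs_at_left.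
  have q0 : q @ 0^'- --> (0 : R).
    apply: cvg_near_cst; near=> h.
    have h0 : h < 0 by near: h; exact: nbhs_left_lt.
    have hT : - T <= h by near: h; apply: nbhs_left_ge; rewrite oppr_lt0.
    rewrite /q /= zt z ?subrr ?scaler0// [h *: 1]mulr1 tT.
    by rewrite -lerBlDr sub0r hT gerDr ltW.
  by have := cvg_lim (@norm_hausdorff _ R) ql; rewrite (cvg_lim (@norm_hausdorff _ R) q0) => <-.
have ql : q @ 0^'+ --> lim (q @ 0^') by exact: cvg_dnbhs_at_right.
have q0 : q @ 0^'+ --> (0 : R).
  apply: cvg_near_cst; near=> h.
  have h0 : 0 < h by near: h; exact: nbhs_right_gt.
  have hT : h <= T - t by near: h; apply: nbhs_right_le; rewrite subr_gt0.
  rewrite /q /= zt z ?subrr ?scaler0// [h *: 1]mulr1.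
  by rewrite addr_ge0 ?(ltW h0)//= -lerBrDr.
by have := cvg_lim (@norm_hausdorff _ R) ql; rewrite (cvg_lim (@norm_hausdorff _ R) q0) => <-.
Unshelve. all: by end_near. Qed.

Let psi i := 'D_(space_dir i) phi.
Let psi2 i j := 'D_(space_dir j) (psi i).

Let psi_diff i p : differentiable (psi i) p.
Proof. by have [/(_ 2%N)[_ H] _] := test; have [] := H (space_dir i). Qed.

Let psi2_cont i j : continuous (psi2 i j).
Proof. by have [/(_ 2%N)[_ H] _] := test; have [_] := H (space_dir i); apply. Qed.

Lemma slab_bounds r : exists B, [/\ 0 <= B,
  forall x t, box r x -> 0 <= t <= T -> `|phi (x, t)| <= B,
  forall x t, box r x -> 0 <= t <= T -> `|time_derivative (x, t)| <= B &
  forall i j x t, box r x -> 0 <= t <= T -> `|psi2 i j (x, t)| <= B].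
Proof.
have [B1 B10 HB1] := bounded_on_box r T phi_cont.
have [B2 B20 HB2] := bounded_on_box r T dt_cont.
have /choice[B3 HB3] (ij : 'I_d * 'I_d) : exists B, 0 <= B /\
    forall x t, box r x -> 0 <= t <= T -> `|psi2 ij.1 ij.2 (x, t)| <= B.
  by have [B ? ?] := bounded_on_box r T (@psi2_cont ij.1 ij.2); exists B.
have B30 : 0 <= \sum_ij B3 ij by apply: sumr_ge0 => ij _; case: (HB3 ij).
exists (B1 + B2 + \sum_ij B3 ij); split=> [|x t bx tT|x t bx tT|i j x t bx tT].
- by rewrite !addr_ge0.
- by rewrite (le_trans (HB1 _ _ bx tT))// -addrA lerDl addr_ge0.
- by rewrite (le_trans (HB2 _ _ bx tT))// addrAC lerDr addr_ge0.
- rewrite (le_trans ((HB3 (i, j)).2 x t bx tT))// (bigD1 (i, j))//= addrCA lerDl.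
  by rewrite !addr_ge0// sumr_ge0// => ij _; case: (HB3 ij).
Qed.

(** Two mean values of the first derivative along z, then one of each partial
    derivative between them; each application of [derive_space_dir] gives a
    factor |z|. Outside the box of radius r + 1 all three points are outside
    the support. *)
Lemma second_diff_slab r B t : 0 <= t <= T -> 0 <= B ->
  (forall x, ~ box r x -> phi (x, t) = 0) ->
  (forall i j x, box (r + 2) x -> `|psi2 i j (x, t)| <= B) ->
  second_diff (2 * d%:R * d%:R * B) (r + 1) (fun x => phi (x, t)).
Proof.
move=> tT B0 phi0 HB x z z1.
have zi i : `|z ord0 i| <= 1 := le_trans (coord_le_enorm z i) z1.
have [bx|bx] := pselect (box (r + 1) x); last first.
  have out y (w : V) : (forall i, `|w ord0 i| <= 1) -> y = x + w -> phi (y, t) = 0.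
    move=> w1 ->; apply: phi0; apply: contra_not bx => bxw i.
    have -> : x ord0 i = (x + w) ord0 i - w ord0 i by rewrite !mxE addrK.
    by rewrite (le_trans (ler_normB _ _))// lerD.
  rewrite (out _ z)// (out (x - z) (- z))//; last by move=> i; rewrite mxE normrN.
  rewrite (out x 0) ?addr0//; last by move=> i; rewrite mxE normr0.
  by rewrite mulr0 subrr normr0 indicE memNset// mulr0.
rewrite indicE mem_set// mulr1.
pose w : V * R := (z, 0).
(* E1 and E2 are the mean values over [0, 1] and [-1, 0]; the order c2 <= c1 makes
   the segment between the two points stay within increments of length 1 *)
have line a : (x, t) + a *: w = (x + a *: z, t).
  by rewrite [LHS]surjective_pairing /= [_ *: 0]mulr0 addr0.
have [c1 /andP[c10 c11]] := mean_value_line (x, t) w phi_diff (@ler01 R).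
have [c2 /andP[c20 c21]] := mean_value_line (x, t) w phi_diff (lerN10 R).
rewrite !line scale1r !scale0r !addr0 scaleN1r subr0 mulr1 sub0r opprK mulr1 => E2 E1.
have -> : phi (x + z, t) + phi (x - z, t) - 2 * phi (x, t) =
  \sum_i z ord0 i * (psi i ((x, t) + c1 *: w) - psi i ((x, t) + c2 *: w)).
  have -> : phi (x + z, t) + phi (x - z, t) - 2 * phi (x, t) =
    (phi (x + z, t) - phi (x, t)) - (phi (x, t) - phi (x - z, t)) by ring.
  rewrite E1 E2 -!line !(derive_space_dir _ (phi_diff _)) -sumrB.
  by apply: eq_bigr => i _; rewrite mulrBr.
have c12 : c2 <= c1 := le_trans c21 c10.
have cell i : `|psi i ((x, t) + c1 *: w) - psi i ((x, t) + c2 *: w)| <=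
    2 * (d%:R * (enorm z * B)).
  have [c /andP[cc1 cc2] ->] := mean_value_line (x, t) w (@psi_diff i) c12.
  have c1' : `|c| <= 1 by rewrite ler_norml (le_trans c20 cc1) (le_trans cc2 c11).
  rewrite (derive_space_dir _ (@psi_diff i _)) normrM mulrC ler_pM//.
    by rewrite ger0_norm ?subr_ge0//; lra.
  rewrite (le_trans (ler_norm_sum _ _ _))// (@le_trans _ _ (\sum_(j < d) enorm z * B))//.
    apply: ler_sum => j _; rewrite normrM ler_pM// ?coord_le_enorm// line.
    apply: HB => k; rewrite !mxE (le_trans (ler_normD _ _))//.
    have -> : r + 2 = r + 1 + 1 by rewrite -addrA.
    by rewrite lerD// normrM -[leRHS]mulr1 ler_pM.
  by rewrite sumr_const card_ord mulr_natl.
rewrite (le_trans (ler_norm_sum _ _ _))//.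
apply: (@le_trans _ _ (\sum_(i < d) enorm z * (2 * (d%:R * (enorm z * B))))).
  by apply: ler_sum => i _; rewrite normrM ler_pM// coord_le_enorm.
rewrite sumr_const card_ord -[leLHS]mulr_natl le_eqVlt; apply/orP; left; apply/eqP; ring.
Qed.

End slab_test_data.

(** * Discrete data of a smooth test function *)

Section test_data_of_slab_test.
Context {R : realType} {d : nat}.
Local Notation V := 'rV[R]_d.
Local Notation mu := (lebesgue_rV R d).
Local Notation leb := (@lebesgue_measure R).
Variable s : R.
Hypotheses (s0 : 0 < s) (s1 : s < 1).
Variables (T : R) (phi : V * R -> R).
Hypotheses (T0 : 0 < T) (test : slab_test T phi).

Let phi_cont : continuous phi. Proof. by have [/(_ 0)] := test. Qed.
Let dt_cont : continuous (time_derivative phi).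
Proof. by have [/(_ 1%N)[_ H] _] := test; exact: H. Qed.

(** Freezing the time outside [0, T] makes the test function and its
    derivatives bounded with bounded support at all times, without altering
    them on [0, T]. *)
Definition clamp (t : R) : R := Num.max 0 (Num.min T t).

Lemma clamp_itv t : 0 <= clamp t <= T.
Proof. by rewrite le_max lexx/= ge_max (ltW T0) ge_min lexx. Qed.

Lemma clamp_id t : 0 <= t <= T -> clamp t = t.
Proof. by move=> /andP[t0 tT]; rewrite /clamp min_r// max_r. Qed.

Definition clamped (h : V * R -> R) (q : V * R) : R := h (q.1, clamp q.2).

Lemma measurable_clamped h : continuous h -> measurable_fun setT (clamped h).
Proof.
move=> ch; have mh := continuous_measurable_rV ch.
have mc : measurable_fun setT clamp.
  by apply: measurable_maxr => //; exact: measurable_minr.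
apply: (measurableT_comp mh); apply/measurable_fun_pairP; split => /=.
  exact: measurable_fst.
exact: (measurableT_comp mc measurable_snd).
Qed.

(** The fractional Laplacian up to its constant, which is absorbed in the
    nonlinearity. *)
Definition fractional (q : V * R) : R := pv s (fun y => clamped phi (y, q.2)) q.1.

(** [second_diff_slab] and [pv_near] give the rate of the truncated operators;
    measurability of the limit comes from that of its approximations. *)
Lemma slab_test_data : exists C r,
  test_data s T C r (clamped phi) (clamped (time_derivative phi)) fractional /\
  forall x t, 0 <= t <= T ->
    fracLap s (fun y => phi (y, t)) x = fracLap_const d s * fractional (x, t).
Proof.
have [r r0 phi0] := slab_support test.
have dt0 := time_derivative_support T0 test phi0.
have [B [B0 HB1 HB2 HB3]] := slab_bounds test (r + 2).
(* the constant of [second_diff_slab] *)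
pose D : R := 2 * d%:R * d%:R * B.
have D0 : 0 <= D by rewrite !mulr_ge0.
have BD : B <= B + D by rewrite lerDl.
have DB : D <= B + D by rewrite lerDr.
have C0 : 0 <= B + D by rewrite addr_ge0.
have mphi := measurable_clamped phi_cont.
have bound (h : V * R -> R) :
    (forall x t, 0 <= t <= T -> ~ box r x -> h (x, t) = 0) ->
    (forall x t, box (r + 2) x -> 0 <= t <= T -> `|h (x, t)| <= B) ->
    forall x t, `|clamped h (x, t)| <= (B + D) * \1_(box (r + 1)) x.
  move=> h0 hB x t; rewrite /clamped /=; have ct := clamp_itv t.
  have [bx|bx] := pselect (box (r + 1) x).
    rewrite indicE mem_set// mulr1 (le_trans _ BD)// hB//.
    by apply: sub_box bx; rewrite lerD2l ler1n.
  rewrite h0// ?normr0 ?mulr_ge0// ?indicE//.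
  by apply: contra_not bx; apply: sub_box; rewrite lerDl.
have mslice t : measurable_fun setT (fun y => clamped phi (y, t)).
  exact: measurable_slice.
have phiC x t : `|clamped phi (x, t)| <= B + D.
  by rewrite (le_trans (bound phi phi0 HB1 x t))// ler_piMr// indicE lern1 leq_b1.
have sd t : second_diff (B + D) (r + 1) (fun y => clamped phi (y, t)).
  move=> x z z1.
  have ct := clamp_itv t.
  have := second_diff_slab test ct B0 (fun x bx => phi0 x _ ct bx)
    (fun i j x bx => HB3 i j x _ bx ct) x z1.
  rewrite /clamped /= => h; rewrite (le_trans h)// ler_wpM2r ?indicE//.
  by rewrite ler_wpM2r// sqr_ge0.
exists (B + D), (r + 1); split; last first.
  move=> x t tT; rewrite -(fracLapE s0 s1 (mslice t) (fun x => phiC x t) C0 (sd t)).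
  by congr (fracLap s _ x); apply/funext => y; rewrite /clamped /= clamp_id.
split.
- split=> //; first exact: measurable_clamped dt_cont.
  apply: (measurable_fun_cvg (h := fun p q =>
    pv_defect s (fun y => clamped phi (y, q.2)) (2 ^- p) q.1)) => [p|[x t] _]; last first.
    exact: (pv_is_cvg s0 s1 (mslice t) (fun x => phiC x t) C0 (sd t)).
  apply: measurable_funB; first by apply: measurable_funM => //=.
  pose g (p : V * R * V) := clamped phi (p.1.1 + p.2, p.1.2).
  apply: (measurable_kint (@level_kernel R d s s0 s1 p) (B := B + D) (g := g)).
    apply: (measurableT_comp mphi); apply/measurable_fun_pairP; split => /=.
      have m1 : measurable_fun setT (fun p : V * R * V => (p.1.1, p.2)).
        apply/measurable_fun_pairP; split => /=; last exact: measurable_snd.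
        exact: (measurableT_comp measurable_fst measurable_fst).
      exact: (measurableT_comp (@measurable_rV_add R d) m1).
    exact: (measurableT_comp measurable_snd measurable_fst).
  by move=> [[x t] z]; exact: phiC.
- split=> //; [by rewrite addr_ge0|exact: ltW|exact: bound|exact: bound].
- move=> x a b a0 ab bT.
  have aI : 0 <= a <= T by rewrite a0 (le_trans ab).
  have bI : 0 <= b <= T by rewrite (le_trans a0).
  rewrite /clamped /= (clamp_id aI) (clamp_id bI) -(FTC_slab test x ab).
  apply: eq_Rintegral => t; rewrite inE/= in_itv/= => /andP[ta tb].
  by rewrite clamp_id// (le_trans a0 ta) (le_trans tb).
- move=> p x t.
  have := pv_near s0 s1 (mslice t) (fun x => phiC x t) C0 (sd t) p x.
  rewrite /fractional /= /pv_defect => h; rewrite -[X in _ + X]opprB.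
  exact: h.
Qed.

End test_data_of_slab_test.

(** * Bounded functions and local Lipschitz continuity *)

Section bounded_functions.
Context d (X : measurableType d) (R : realType).
Variable m : {measure set X -> \bar R}.

Lemma Lfun_bounded (f : X -> R) : (0 < m setT)%E -> f \in Lfun m +oo%E ->
  measurable_fun setT f /\ exists2 M, 0 <= M & {ae m, forall x, `|f x| <= M}.
Proof.
move=> m0 /andP[mf ff]; split; first by rewrite inE in mf.
move: ff; rewrite inE /= /finite_norm unlock m0 => h.
have ge := ess_sup_ge m (abse \o (EFin \o f)).
exists (Num.max 0 (fine (ess_sup m (abse \o (EFin \o f))))); first by rewrite le_max lexx.
apply: filterS ge => x /=.
case: (ess_sup _ _) h => [r||] //= _.
by rewrite lee_fin => h; rewrite le_max h orbT.
Qed.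

Lemma bounded_Lfun (f : X -> R) M : measurable_fun setT f -> (forall x, `|f x| <= M) ->
  f \in Lfun m +oo%E.
Proof.
move=> mf fM; apply/andP; split; rewrite inE//=.
rewrite /finite_norm unlock; case: ifP => // _.
apply: (@le_lt_trans _ _ M%:E); last exact: ltry.
by apply/ess_supP; apply: aeW => x /=; rewrite lee_fin.
Qed.

End bounded_functions.

Section locally_lipschitz.
Context {R : realType}.

(** By compactness a single constant K works for all pairs at distance at most
    1 / K; for the others, monotonicity bounds the increment by that over the
    whole interval. *)
Lemma locally_lipschitz_itv (Phi : R -> R) M : {homo Phi : x y / x <= y} ->
  locally_lipschitz Phi -> exists2 L, 0 <= L &
  forall a b, - M <= a <= M -> - M <= b <= M -> `|Phi a - Phi b| <= L * `|a - b|.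
Proof.
move=> Phi_nd Phi_lip.
have : \forall K \near +oo, `[- M, M]%classic `<=` [set x : R |
    forall y, `|x - y| <= K^-1 -> `|Phi x - Phi y| <= K * `|x - y|].
  move: (@segment_compact R (- M) M) => /compact_near_coveringP/(_ R (pinfty_nbhs R)) H.
  apply: (H (fun (K : R) (x : R) => forall y, `|x - y| <= K^-1 -> `|Phi x - Phi y| <= K * `|x - y|)).
  move=> x _; have [U /nbhs_ballP[e /= e0 eU] [k [_ Hk]]] := Phi_lip x.
  have e2 : 0 < e / 2 by rewrite divr_gt0.
  near=> x' K => y xy.
  have K0 : 0 < K by near: K; exact: nbhs_pinfty_gt.
  have Kk : k < K by near: K; apply: nbhs_pinfty_gt; exact: num_real.
  have Ke : K^-1 < e / 2.
    rewrite -[e / 2]invrK ltf_pV2 ?posrE ?invr_gt0//.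
    by near: K; apply: nbhs_pinfty_gt; exact: num_real.
  have xx' : `|x - x'| < e / 2 by near: x'; exact: (nbhsx_ballx x _ e2).
  have Ux' : U x' by apply: eU; rewrite /ball/= (lt_trans xx')// gtr_pMr ?invf_lt1 ?ltr1n.
  have Uy : U y.
    apply: eU; rewrite /ball/= -(subrKA x') (le_lt_trans (ler_normD _ _))//.
    by rewrite [ltRHS](splitr e) ltr_leD// (le_trans xy)// ltW.
  exact: (Hk K Kk (x', y)).
move=> [K0 [_ HK]].
pose K := Num.max (K0 + 1) 1.
have {}HK := HK K _.
have K1 : 1 <= K by rewrite le_max lexx orbT.
have Kgt : K0 < K by rewrite lt_max ltrDl ltr01.
have Kp : 0 < K by exact: lt_le_trans K1.
have DM : 0 <= `|Phi M - Phi (- M)| by [].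
exists (K + K * `|Phi M - Phi (- M)|) => [|a b aM bM]; first by rewrite addr_ge0 ?mulr_ge0 ?(ltW Kp).
rewrite mulrDl.
have [ab|ab] := leP `|a - b| K^-1.
  have := HK Kgt a _ b ab; rewrite /= in_itv => /(_ aM) h.
  by rewrite (le_trans h)// lerDl mulr_ge0// mulr_ge0// ltW.
have far : `|Phi a - Phi b| <= `|Phi M - Phi (- M)|.
  move: aM bM => /andP[a1 a2] /andP[b1 b2].
  have := Phi_nd _ _ a1; have := Phi_nd _ _ a2; have := Phi_nd _ _ b1; have := Phi_nd _ _ b2.
  move=> h1 h2 h3 h4; rewrite [leRHS]ger0_norm; last by rewrite subr_ge0 (le_trans h4).
  by rewrite ler_norml; apply/andP; split; lra.
rewrite (le_trans far)// ler_wpDl ?mulr_ge0 ?(ltW Kp)// mulrAC ler_peMl//.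
by rewrite mulrC -ler_pdivrMr// div1r ltW.
Unshelve. all: by end_near. Qed.

End locally_lipschitz.

(** * Mean values of test data *)

Section test_data_means.
Context {R : realType} {d : nat}.
Local Notation V := 'rV[R]_d.
Local Notation mu := (lebesgue_rV R d).
Local Notation leb := (@lebesgue_measure R).
Variable s : R.
Hypotheses (s0 : 0 < s) (s1 : s < 1).
Local Notation tail := (@tail R d s).
Variables (T C r : R) (f ft Lam : V * R -> R).
Hypothesis test : @test_data R d s T C r f ft Lam.

Let bound (x : V) : R := C * \1_(box r) x.

Let C0 : 0 <= C. Proof. by case: test => _ []. Qed.
Let r0 : 0 <= r. Proof. by case: test => _ []. Qed.

Let ibound : mu.-integrable setT (EFin \o bound).
Proof. exact: (integrableZl measurableT C (integrable_box d r0)). Qed.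

Lemma f_dominated : dominated bound f.
Proof. by case: test => -[mf _ _] [_ _ _ fC _] _ _. Qed.

Lemma ft_dominated : dominated bound ft.
Proof. by case: test => -[_ mf _] [_ _ _ _ fC] _ _. Qed.

Lemma Lam_dominated : dominated (@Lam_dom R d s C r) Lam.
Proof. by split=> [|x t]; [case: test => -[]|exact: (Lam_le s0 s1 test)]. Qed.

(** Fubini and the fundamental theorem of calculus: the case of the weak
    formulation for a constant. *)
Lemma mean_ft : \int[leb]_(t in `[0, T]) \int[mu]_x ft (x, t) =
  \int[mu]_x f (x, T) - \int[mu]_x f (x, 0).
Proof.
have [_ [_ _ T0 _ _] FTC _] := test.
rewrite (iterated_Fubini ibound T ft_dominated).
rewrite -RintegralB//; [|exact: (dominated_slice ibound T f_dominated)
  |exact: (dominated_slice ibound 0 f_dominated)].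
by apply: eq_Rintegral => x _; exact: FTC.
Qed.

(** Jumps conserve the integral; split g into its positive and negative parts
    to use Tonelli. *)
Lemma mean_convol (K g : V -> R) (B : R) : jump_kernel K -> measurable_fun setT g ->
  (forall x, `|g x| <= B) -> mu.-integrable setT (EFin \o g) ->
  mu.-integrable setT (EFin \o (fun x => convol K g x - mass K * g x)) /\
  \int[mu]_x (convol K g x - mass K * g x) = 0.
Proof.
move=> hK mg gB ig.
have B0 : 0 <= B := le_trans (normr_ge0 _) (gB 0).
pose p x := Num.max (g x) 0; pose n x := Num.max (- g x) 0.
have mp : measurable_fun setT p by exact: measurable_maxr.
have mn : measurable_fun setT n by apply: measurable_maxr => //; exact: measurableT_comp.
have pn x : g x = p x - n x.
  by rewrite /p /n; case: (leP (g x) 0) => h; case: (leP (- g x) 0) => h'; lra.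
have pB x : 0 <= p x <= B.
  by have := gB x; rewrite ler_norml /p => /andP[? ?]; rewrite le_max lexx orbT/= ge_max B0 andbT.
have nB x : 0 <= n x <= B.
  have := gB x; rewrite ler_norml /n => /andP[? ?]; rewrite le_max lexx orbT/= ge_max B0 andbT.
  by rewrite lerNl.
have ip : mu.-integrable setT (EFin \o p).
  apply: le_integrable ig => //; first exact/measurable_EFinP.
  move=> x _ /=; rewrite lee_fin (ger0_norm (_ : 0 <= p x)); last by case/andP: (pB x).
  by rewrite /p ge_max ler_norm normr_ge0.
have in_ : mu.-integrable setT (EFin \o n).
  apply: le_integrable ig => //; first exact/measurable_EFinP.
  move=> x _ /=; rewrite lee_fin (ger0_norm (_ : 0 <= n x)); last by case/andP: (nB x).
  by rewrite /n ge_max normr_ge0 andbT -normrN ler_norm.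
have pB' x : `|p x| <= B by have /andP[? ?] := pB x; rewrite ger0_norm.
have nB' x : `|n x| <= B by have /andP[? ?] := nB x; rewrite ger0_norm.
have cE x : convol K g x - mass K * g x = (convol K p x - mass K * p x) - (convol K n x - mass K * n x).
  rewrite {1}/convol (_ : (fun z => _) = (fun z => p (x + z) - n (x + z))); last first.
    by apply/funext => z; rewrite pn.
  rewrite (kintB hK (measurable_shiftl x mp) (fun z => pB' (x + z))
    (measurable_shiftl x mn) (fun z => nB' (x + z))) -/(convol K p x) -/(convol K n x) pn; ring.
have cp := convol_integrable hK mp pB ip; have cn := convol_integrable hK mn nB in_.
have mp' := integrableZl measurableT (mass K) ip.
have mn' := integrableZl measurableT (mass K) in_.
have dp := integrableB measurableT cp mp'; have dn := integrableB measurableT cn mn'.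
split.
  apply: eq_integrable (integrableB measurableT dp dn) => // x _.
  by rewrite /= cE.
under eq_Rintegral do rewrite cE.
rewrite (RintegralB measurableT dp dn) (RintegralB measurableT cp mp').
rewrite (RintegralB measurableT cn mn') (Rintegral_convol hK mp pB ip) (Rintegral_convol hK mn nB in_).
by rewrite (RintegralZl _ measurableT ip) (RintegralZl _ measurableT in_) !subrr.
Qed.

(** Lam is an L1 limit of functions of integral 0. *)
Lemma mean_Lam t : \int[mu]_x Lam (x, t) = 0.
Proof.
have [_ [_ _ _ fC _] _ LamE] := test.
have iLam := dominated_slice (Lam_dom_integrable s0 s1 test) t Lam_dominated.
have fB x : `|f (x, t)| <= C.
  by rewrite (le_trans (fC x t))// ler_piMr// indicE lern1 leq_b1.
have mft := measurable_slice t f_dominated.1.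
have ift := dominated_slice ibound t f_dominated.
have H p : `|\int[mu]_x Lam (x, t)| <= tail (2 ^- p) * (C * (r *+ 2) ^+ d).
  have [iA A0] := mean_convol (@level_kernel R d s s0 s1 p) mft fB ift.
  rewrite -[\int[mu]_x Lam (x, t)]addr0 -A0 -(RintegralD measurableT iLam iA).
  have iD := integrableD measurableT iLam iA.
  rewrite (le_trans (le_normr_Rintegral _ iD))// mulrA [_ * C]mulrC -Rintegral_box//.
  apply: (le_Rintegral measurableT (integrable_norm iD)) => //.
    exact: (integrableZl measurableT _ (integrable_box d r0)).
  by move=> x _; exact: LamE.
have H0 : tail (2 ^- p) * (C * (r *+ 2) ^+ d) @[p --> \oo] --> (0 : R).
  rewrite -(mul0r (C * (r *+ 2) ^+ d)).
  by apply: cvgM; [exact: tail_cvg0|exact: cvg_cst].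
apply/eqP; rewrite -normr_le0.
by apply: (ler_cvg_to (cvg_cst `|\int[mu]_x Lam (x, t)|) H0); apply: nearW.
Qed.

End test_data_means.

(** * Back to the original problem *)

Section transfer.
Context {R : realType} {d : nat}.
Local Notation V := 'rV[R]_d.
Local Notation mu := (lebesgue_rV R d).
Local Notation leb := (@lebesgue_measure R).
Variable s : R.
Hypotheses (s0 : 0 < s) (s1 : s < 1).

Lemma Gamma_ge0 (z : R) : 0 <= Gamma z.
Proof. by apply: Rintegral_ge0 => t _; rewrite mulr_ge0 ?powR_ge0 ?expR_ge0. Qed.

Lemma fracLap_const_ge0 : 0 <= fracLap_const d s :> R.
Proof.
by rewrite /fracLap_const divr_ge0 ?mulr_ge0 ?powR_ge0 ?Gamma_ge0// ltW.
Qed.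

(** The norm of index infinity is declared to be 0 for the zero measure, so
    that this is needed to read a bound off it. *)
Lemma lebesgue_rV_gt0 : (0 < mu setT)%E.
Proof.
apply: (@lt_le_trans _ _ (mu (box 1))).
  by rewrite lebesgue_rV_boxr// lte_fin exprn_gt0// mulrn_wgt0.
by apply: le_measure; rewrite ?inE//; exact: measurable_box.
Qed.

(** Makes a locally Lipschitz nonlinearity globally Lipschitz without changing
    it on the range of the data. *)
Definition truncate (M y : R) : R := Num.max (- M) (Num.min M y).

Lemma truncate_itv M y : 0 <= M -> - M <= truncate M y <= M.
Proof. by move=> M0; rewrite le_max lexx/= ge_max ge_min lexx ge0_cp. Qed.

Lemma truncate_id M y : - M <= y <= M -> truncate M y = y.
Proof. by move=> /andP[y0 yM]; rewrite /truncate min_r// max_r. Qed.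

Lemma le_truncate M : {homo truncate M : x y / x <= y}.
Proof.
by move=> x y xy; rewrite /truncate ge_max !le_max lexx/= le_min !ge_min lexx/= xy !orbT.
Qed.

Lemma truncate_lip M x y : 0 <= M -> `|truncate M x - truncate M y| <= `|x - y|.
Proof.
move=> M0; wlog xy : x y / y <= x.
  by move=> H; case: (leP y x) => [|/ltW] /H//; rewrite distrC [leRHS]distrC.
rewrite !ger0_norm ?subr_ge0 ?le_truncate// /truncate /Num.max /Num.min.
by do ![case: ifPn; rewrite -?leNgt] => *; lra.
Qed.

Lemma measurable_truncate M : measurable_fun setT (truncate M).
Proof. by apply: measurable_maxr => //; exact: measurable_minr. Qed.

Section solution.
Variables (L M : R) (u0 : V -> R) (Phi : R -> R) (U : V * R -> R).
Local Notation c := (fracLap_const d s).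
Let Psi v := c * (Phi (truncate M (v - M)) - Phi (- M)).
Let w0 x := truncate M (u0 x) + M.
Hypotheses (M0 : 0 <= M) (mu0 : measurable_fun setT u0)
  (u0M : {ae mu, forall x, `|u0 x| <= M})
  (Phi_nd : {homo Phi : x y / x <= y})
  (L0 : 0 <= L) (Psi0 : Psi 0 = 0) (Psi_nd : {homo Psi : x y / x <= y})
  (Psi_lip : forall a b, `|Psi a - Psi b| <= L * `|a - b|)
  (rU : rangedT (M + M) U)
  (HU : forall T C r f ft Lam, test_data s T C r f ft Lam ->
     weak_defect Psi T f ft Lam w0 U = 0).

Lemma shifted_range q : - M <= U q - M <= M.
Proof. by have [_ /(_ q)/andP[? ?]] := rU; apply/andP; split; lra. Qed.

(** By [mean_ft] and [mean_Lam] the constants M and Phi(-M) drop out of the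
    weak formulation. *)
Lemma translate_solution : very_weak_solution s Phi u0 (fun q => U q - M).
Proof.
have mU : measurable_fun setT U by case: rU.
have mUM : measurable_fun setT (fun q => U q - M) by exact: measurable_funB.
have UM q : `|U q - M| <= M by rewrite ler_norml; exact: shifted_range.
split.
  apply: (@bounded_Lfun _ _ _ _ _ M).
    have mQ : measurable ([set: V] `*` `]0, +oo[%classic : set (V * R)).
      by apply: measurableX => //; exact: measurable_itv.
    by apply/(measurable_restrictT _ mQ); exact: measurable_funTS.
  by move=> q; rewrite patchE; case: ifP => // _; rewrite normr0.
apply: aeW => T T0 phi test.
have [C [r [td fracE]]] := slab_test_data s0 s1 T0 test.
set f := clamped T phi in td; set ft := clamped T _ in td.
have HD := HU td.
have [[mf mft mLam] [C0 r0 _ fC ftC] _ _] := td.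
have ib := integrableZl measurableT C (integrable_box d r0).
have iL := Lam_dom_integrable s0 s1 td.
have iMb := integrableZl measurableT ((M + M) * C) (integrable_box d r0).
have iL' := integrableZl measurableT (L * (M + M)) iL.
have TI : 0 <= T <= T by rewrite lexx ltW.
have OI : 0 <= (0 : R) <= T by rewrite lexx ltW.
have fE x t : 0 <= t <= T -> phi (x, t) = f (x, t).
  by move=> tT; rewrite /f /clamped /= clamp_id.
have sU t := measurable_slice t mU.
have iUf t := dominated_slice iMb t (dominated_f td rU).
have i_f t := dominated_slice ib t (f_dominated td).
have spaceU t : 0 <= t <= T ->
    \int[mu]_x ((U (x, t) - M) * phi (x, t)) =
    \int[mu]_x (U (x, t) * f (x, t)) - M * \int[mu]_x f (x, t).
  move=> tT; rewrite -(RintegralZl _ measurableT (i_f t)).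
  rewrite -(RintegralB measurableT (iUf t) (integrableZl measurableT M (i_f t))).
  by apply: eq_Rintegral => x _; rewrite fE// mulrBl.
have -> : \int[mu]_x (u0 x * phi (x, 0)) =
    \int[mu]_x (w0 x * f (x, 0)) - M * \int[mu]_x f (x, 0).
  have w0M x : `|w0 x| <= M + M.
    have /andP[? ?] := truncate_itv (u0 x) M0; rewrite /w0 ger0_norm; lra.
  have mw0 : measurable_fun setT w0.
    by apply: measurable_funD => //; exact: (measurableT_comp (measurable_truncate M) mu0).
  have dw : dominated (fun x => (M + M) * C * \1_(box r) x) (fun q => w0 q.1 * f q).
    split; first by apply: measurable_funM => //; exact: (measurableT_comp mw0 measurable_fst).
    by move=> x t; rewrite normrM -mulrA ler_pM.
  have iw := dominated_slice iMb 0 dw.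
  rewrite -(RintegralZl _ measurableT (i_f 0)).
  rewrite -(RintegralB measurableT iw (integrableZl measurableT M (i_f 0))).
  congr fine; apply: ae_eq_integral => //.
  - apply/measurable_EFinP; apply: measurable_funM => //.
    rewrite (_ : (fun x => phi (x, 0)) = (fun x => f (x, 0))); first exact: measurable_slice.
    by apply/funext => x; exact: fE.
  - by case/integrableP: (integrableB measurableT iw (integrableZl measurableT M (i_f 0))).
  - apply: filterS u0M => x; rewrite ler_norml => xM _.
    by rewrite fE// /w0 (truncate_id xM) -mulrBl addrK.
rewrite (spaceU T TI).
have iUft t := dominated_slice iMb t (dominated_ft td rU).
have i_ft t := dominated_slice ib t (ft_dominated td).
have oUft := dominated_outer iMb T (dominated_ft td rU).
have o_ft := dominated_outer ib T (ft_dominated td).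
have mD : @measurable _ (measurableTypeR R) `[0, T]%classic by exact: measurable_itv.
have -> : \int[leb]_(t in `[0, T]) \int[mu]_x
      ((U (x, t) - M) * derive1 (fun r => phi (x, r)) t) =
    \int[leb]_(t in `[0, T]) \int[mu]_x (U (x, t) * ft (x, t)) -
    M * \int[leb]_(t in `[0, T]) \int[mu]_x ft (x, t).
  rewrite -(RintegralZl _ mD o_ft) -(RintegralB mD oUft (integrableZl mD M o_ft)).
  apply: eq_Rintegral => t; rewrite inE/= in_itv/= => tT.
  rewrite -(RintegralZl _ measurableT (i_ft t)).
  rewrite -(RintegralB measurableT (iUft t) (integrableZl measurableT M (i_ft t))).
  apply: eq_Rintegral => x _; rewrite derive1_time.
  by rewrite /ft /clamped /= clamp_id// mulrBl.
have -> : \int[leb]_(t in `[0, T]) \int[mu]_x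
      (Phi (U (x, t) - M) * fracLap s (fun y => phi (y, t)) x) =
    \int[leb]_(t in `[0, T]) \int[mu]_x (Psi (U (x, t)) * fractional s T phi (x, t)).
  apply: eq_Rintegral => t; rewrite inE/= in_itv/= => tT.
  have iP := dominated_slice iL' t (dominated_Lam Psi0 Psi_nd L0 Psi_lip s0 s1 td rU).
  have i_L := dominated_slice iL t (Lam_dominated s0 s1 td).
  rewrite -[RHS]addr0 -(mulr0 (c * Phi (- M))) -(mean_Lam s0 s1 td t).
  rewrite -(RintegralZl _ measurableT i_L).
  rewrite -(RintegralD measurableT iP (integrableZl measurableT _ i_L)).
  apply: eq_Rintegral => x _; rewrite fracE// /Psi truncate_id; last exact: shifted_range.
  by ring.
rewrite (mean_ft td); move: HD; rewrite /weak_defect.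
set A := \int[leb]_(t in _) _; set B := \int[leb]_(t in _) _.
set D := \int[mu]_x (U (x, T) * _); set E := \int[mu]_x (w0 x * _).
set F := \int[mu]_x f (x, T); set G := \int[mu]_x f (x, 0).
move=> {}HD; apply/eqP; rewrite -subr_eq0; apply/eqP; rewrite -[RHS]HD; ring.
Qed.

End solution.
End transfer.

Theorem theorem1p2 (R : realType) (d : nat) (hd : (0 < d)%N)
    (s : R) (hs0 : 0 < s) (hs1 : s < 1)
    (u0 : 'rV[R]_d -> R) (hu0 : u0 \in Lfun (lebesgue_rV R d) +oo%E)
    (Phi : R -> R) (Phi_nondecreasing : {homo Phi : x y / x <= y})
    (Phi_lipschitz : locally_lipschitz Phi) :
  exists u : 'rV[R]_d * R -> R, very_weak_solution s Phi u0 u.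
Proof.
have [mu0 [M M0 u0M]] := Lfun_bounded (@lebesgue_rV_gt0 R d) hu0.
have [K K0 HK] := locally_lipschitz_itv M Phi_nondecreasing Phi_lipschitz.
pose c : R := fracLap_const d s.
have c0 : 0 <= c by exact: (@fracLap_const_ge0 R d s hs0).
pose Psi v := c * (Phi (truncate M (v - M)) - Phi (- M)).
pose w0 x := truncate M (u0 x) + M.
have Psi0 : Psi 0 = 0.
  by rewrite /Psi sub0r truncate_id ?subrr ?mulr0// lexx ge0_cp.
have Psi_nd : {homo Psi : x y / x <= y}.
  move=> x y xy; rewrite ler_wpM2l// lerD2r Phi_nondecreasing// le_truncate//.
  by rewrite lerD2r.
have cK0 : 0 <= c * K by rewrite mulr_ge0.
have Psi_lip a b : `|Psi a - Psi b| <= c * K * `|a - b|.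
  rewrite /Psi -mulrBr opprB addrA subrK normrM (ger0_norm c0) -mulrA ler_wpM2l//.
  rewrite (le_trans (HK _ _ (truncate_itv _ M0) (truncate_itv _ M0)))// ler_wpM2l//.
  rewrite (le_trans (truncate_lip _ _ M0))//.
  by rewrite opprB addrA subrK.
have MM0 : 0 <= M + M by rewrite addr_ge0.
have mw0 : measurable_fun setT w0.
  by apply: measurable_funD => //; exact: (measurableT_comp (measurable_truncate M) mu0).
have w0M x : 0 <= w0 x <= M + M.
  by have /andP[? ?] := truncate_itv (u0 x) M0; rewrite /w0; apply/andP; split; lra.
have [p0 cfl] := @cfl_eventually R d (c * K) cK0 s hs0 hs1.
have [U rU HU] := solution_exists Psi0 Psi_nd cK0 Psi_lip MM0 hs0 hs1 cfl mw0 w0M.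
exists (fun q => U q - M).
exact: (translate_solution hs0 hs1 M0 mu0 u0M cK0 Psi0 Psi_nd Psi_lip rU HU).
Qed.
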